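(* Let $d\ge1$ and $d<\alpha<d+2$, and assume that $\operatorname{ess\,inf}_{B(R)}u>0$ for any $R\ge1$. Then for any $p\ge1$, $$\lim_{t\uparrow\infty}t^{-(d+\theta)/(\alpha+\theta)}\log\mathbb{E}_\theta[v_\xi(t;x_0)^p]=-p^{(d+\theta)/(\alpha+\theta)}\,c(d,\alpha,\theta,C_0),$$ uniformly in $x_0\in\Lambda_1$, where $$c(d,\alpha,\theta,C_0)=\int_{\mathbb{R}^d}\inf_{y\in\mathbb{R}^d}\Bigl(\frac{C_0}{|q+y|^\alpha}+|y|^\theta\Bigr)\,dq.$$
   Context: Model. Let $\theta>0$, $C_0>0$. The function $u:\mathbb{R}^d\to[0,\infty)$ belongs to the Kato class $K_d$ (in the sense of Sznitman's book ''Brownian motion, obstacles and random media'') and satisfies $u(x)=C_0|x|^{-\alpha}(1+o(1))$ as $|x|\to\infty$. The random vectors $\xi=(\xi_q)_{q\in\mathbb{Z}^d}$ are i.i.d. with values in $\mathbb{Z}^d$ and law $\mathbb{P}_\theta(\xi_q=p)=Z(d,\theta)^{-1}\exp(-|p|^\theta)$, $p\in\mathbb{Z}^d$, where $Z(d,\theta)$ is the normalizing constant; $\mathbb{E}_\theta$ is the corresponding expectation. Set $V_\xi(x)=\sum_{q\in\mathbb{Z}^d}u(x-q-\xi_q)$ and $$v_\xi(t;x_0)=E_{x_0}\Bigl[\exp\Bigl\{-\int_0^tV_\xi(B_s)\,ds\Bigr\}\Bigr],$$ where $(B_s)_{s\ge0}$ is standard Brownian motion on $\mathbb{R}^d$ and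 $E_{x_0}$ is expectation for the motion started at $x_0$. $B(R)$ is the ball of radius $R$ centered at $0$, and $\Lambda_1=[-1/2,1/2]^d$. *)

(* Defs.v *)
From HB Require Import structures.
From mathcomp Require Import all_boot all_order all_algebra.
From mathcomp Require Import all_classical all_reals all_analysis.
From mathcomp Require Import measurable_realfun ess_sup_inf.
Import Order.TTheory GRing.Theory Num.Theory.
Import numFieldNormedType.Exports.

Set Implicit Arguments.
Unset Strict Implicit.
Unset Printing Implicit Defensive.

Local Open Scope classical_set_scope.
Local Open Scope ring_scope.

HB.instance Definition _ := isPointed.Build int 0.
HB.instance Definition _ := @isMeasurable.Build default_measure_display int
  discrete_measurable discrete_measurable0
  discrete_measurableC discrete_measurableU.

Definition measure_rv_display : measure_display -> measure_display.
Proof. exact. Qed.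

(* Product sigma-algebra on row vectors, as the library does for tuples; it is
   the Borel sigma-algebra for 'rV[R]_n and the discrete one for 'rV[int]_n. *)
Section measurable_rv.
Context {disp} {T : measurableType disp}.
Variable n : nat.

Let coors : 'I_n -> 'rV[T]_n -> T := fun i x => x ord0 i.

Let rv_set0 : g_sigma_preimage coors set0.
Proof. exact: sigma_algebra0. Qed.

Let rv_setC A : g_sigma_preimage coors A -> g_sigma_preimage coors (~` A).
Proof. exact: sigma_algebraC. Qed.

Let rv_bigcup (F : _^nat) : (forall i, g_sigma_preimage coors (F i)) ->
  g_sigma_preimage coors (\bigcup_i (F i)).
Proof. exact: sigma_algebra_bigcup. Qed.

HB.instance Definition _ := @isMeasurable.Build (measure_rv_display disp)
  'rV[T]_n (g_sigma_preimage coors) rv_set0 rv_setC rv_bigcup.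

Lemma measurable_coord_rv (i : 'I_n) :
  measurable_fun [set: 'rV[T]_n] (fun x => x ord0 i).
Proof.
move=> _ Y mY; rewrite setTI; apply: sub_sigma_algebra.
rewrite -bigcup_seq/=; exists i => /=; first by rewrite mem_index_enum.
by exists Y => //; rewrite setTI.
Qed.

End measurable_rv.

Section measurable_rv_theory.
Context {d1 d2} {T1 : measurableType d1} {T2 : measurableType d2}.
Lemma measurable_fun_rvP n (f : T1 -> 'rV[T2]_n) :
  (forall i, measurable_fun setT (fun x => f x ord0 i)) ->
  measurable_fun setT f.
Proof.
move=> mf _ Y mY; rewrite setTI.
suff: Y \in [set A | measurable (f @^-1` A)] by rewrite inE.
rewrite inE; move: Y mY.
apply: smallest_sub.
- split => /=.
  + by rewrite preimage_set0.
  + by move=> A mA; rewrite setTD preimage_setC; exact: measurableC.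
  + by move=> F mF; rewrite preimage_bigcup; exact: bigcupT_measurable.
- case: n => [|n] in f mf *; first by rewrite big_ord0.
  rewrite -bigcup_mkord_ord => A [i _ [B mB <-]] /=.
  rewrite setTI -comp_preimage -[X in measurable X]setTI; exact: mf.
Qed.
End measurable_rv_theory.

Section lebesgue_measure_rv.
Variable R : realType.
Local Open Scope ereal_scope.

Definition cons_rv n (p : measurableTypeR R * 'rV[R]_n) : 'rV[R]_n.+1 :=
  row_mx (const_mx p.1 : 'rV_1) p.2.

Definition uncons_rv n (x : 'rV[R]_n.+1) : measurableTypeR R * 'rV[R]_n :=
  (x ord0 ord0, rsubmx (x : 'rV_(1 + n))).

Lemma cons_rvK n : cancel (@cons_rv n) (@uncons_rv n).
Proof.
move=> [a v]; rewrite /uncons_rv /cons_rv/= row_mxKr; congr (_, _).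
rewrite (_ : ord0 = lshift n (ord0 : 'I_1)); last exact/val_inj.
by rewrite (row_mxEl (const_mx a : 'rV_1)) mxE.
Qed.

Lemma uncons_rvK n : cancel (@uncons_rv n) (@cons_rv n).
Proof.
move=> x; rewrite /uncons_rv /cons_rv/= -[RHS](@hsubmxK _ 1 1 n).
congr (@row_mx _ 1 1 n _ _); apply/rowP => i; rewrite !mxE !ord1.
by congr (x _ _); exact/val_inj.
Qed.

Lemma measurable_cons_rv n : measurable_fun setT (@cons_rv n).
Proof.
apply: measurable_fun_rvP => i; have := @splitP 1 n i; case => k ik.
  rewrite (_ : i = lshift n k); last exact/val_inj.
  under eq_fun do rewrite /cons_rv (row_mxEl (const_mx _ : 'rV_1)) mxE.
  exact: measurable_fst.
rewrite (_ : i = rshift 1 k); last exact/val_inj.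
under eq_fun do rewrite /cons_rv (row_mxEr (const_mx _ : 'rV_1)).
exact: (measurableT_comp (measurable_coord_rv k) measurable_snd).
Qed.

Lemma measurable_uncons_rv n : measurable_fun setT (@uncons_rv n).
Proof.
apply: measurable_fun_pair; first exact: measurable_coord_rv.
apply: measurable_fun_rvP => i; under eq_fun do rewrite mxE.
exact: measurable_coord_rv.
Qed.

Fixpoint lebesgue_measure_rv n : set 'rV[R]_n -> \bar R :=
  match n with
  | 0 => \d_(0%R : 'rV[R]_0)
  | m.+1 => pushforward (lebesgue_measure \x @lebesgue_measure_rv m) (@cons_rv m)
  end.

Section pushforward_cons_rv.
Variables (n : nat) (mu : {sigma_finite_measure set 'rV[R]_n -> \bar R}).

Let nu : set 'rV[R]_n.+1 -> \bar R :=
  pushforward (lebesgue_measure \x mu) (@cons_rv n).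

Let nu0 : nu set0 = 0.
Proof. by rewrite /nu /pushforward preimage_set0 measure0. Qed.

Let nu_ge0 A : 0 <= nu A.
Proof. exact: (measure_ge0 (lebesgue_measure \x mu)). Qed.

Let nu_sigma_additive : semi_sigma_additive nu.
Proof.
move=> F mF tF mUF; rewrite /nu /pushforward preimage_bigcup.
apply: measure_semi_sigma_additive.
- by move=> k; rewrite -[X in measurable X]setTI; exact: measurable_cons_rv.
- apply/trivIsetP => /= i j _ _ ij; rewrite -preimage_setI.
  by move/trivIsetP : tF => /(_ _ _ _ _ ij) ->//; rewrite preimage_set0.
- rewrite -preimage_bigcup -[X in measurable X]setTI.
  exact: measurable_cons_rv.
Qed.

HB.instance Definition _ := isMeasure.Build _ _ _ nu
  nu0 nu_ge0 nu_sigma_additive.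

Let nu_sigma_finite : sigma_finite setT nu.
Proof.
have /sigma_finiteP[F [TF ndF Foo]] :=
  sigma_finiteT (@lebesgue_measure R : {sigma_finite_measure set _ -> \bar R}).
have /sigma_finiteP[G [TG ndG Goo]] := sigma_finiteT mu.
exists (fun k => @uncons_rv n @^-1` (F k `*` G k)).
  apply/esym; rewrite -subTset => x _.
  have [i _ Fi] : (\bigcup_i F i) (x ord0 ord0) by rewrite -TF.
  have [j _ Gj] : (\bigcup_j G j) (rsubmx (x : 'rV_(1 + n))) by rewrite -TG.
  exists (maxn i j) => //; split => /=.
    by move: Fi; exact/subsetPset/ndF/leq_maxl.
  by move: Gj; exact/subsetPset/ndG/leq_maxr.
move=> k; have [mF Fk] := Foo k; have [mG Gk] := Goo k; split.
  rewrite -[X in measurable X]setTI; apply: measurable_uncons_rv => //.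
  exact: measurableX.
rewrite /nu /pushforward -comp_preimage.
rewrite (_ : @uncons_rv n \o _ = id); last exact/funext/cons_rvK.
by rewrite preimage_id product_measure1E// lte_mul_pinfty// ge0_fin_numE.
Qed.

HB.instance Definition _ := Measure_isSigmaFinite.Build _ _ _ nu
  nu_sigma_finite.

Definition pushforward_cons_rv :
  {sigma_finite_measure set 'rV[R]_n.+1 -> \bar R} := nu.

End pushforward_cons_rv.

Let lebesgue_measure_rv_pack n :
  {mu : {sigma_finite_measure set 'rV[R]_n -> \bar R} |
    mu = @lebesgue_measure_rv n :> (set 'rV[R]_n -> \bar R)}.
Proof.
elim: n => [|n [mu muE]]; first by exists (\d_(0%R : 'rV[R]_0)).
by exists (pushforward_cons_rv mu); rewrite /= -muE.
Qed.

Let lebesgue_measure_rv0 n : @lebesgue_measure_rv n set0 = 0.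
Proof. by have [mu <-] := lebesgue_measure_rv_pack n. Qed.

Let lebesgue_measure_rv_ge0 n A : 0 <= @lebesgue_measure_rv n A.
Proof. by have [mu <-] := lebesgue_measure_rv_pack n. Qed.

Let lebesgue_measure_rv_sigma_additive n :
  semi_sigma_additive (@lebesgue_measure_rv n).
Proof.
have [mu <-] := lebesgue_measure_rv_pack n.
exact: measure_semi_sigma_additive.
Qed.

HB.instance Definition _ n := isMeasure.Build _ _ _ (@lebesgue_measure_rv n)
  (lebesgue_measure_rv0 n) (@lebesgue_measure_rv_ge0 n)
  (@lebesgue_measure_rv_sigma_additive n).

Let lebesgue_measure_rv_sigma_finite n :
  sigma_finite setT (@lebesgue_measure_rv n).
Proof.
by have [mu <-] := lebesgue_measure_rv_pack n; exact: sigma_finiteT.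
Qed.

HB.instance Definition _ n := Measure_isSigmaFinite.Build _ _ _
  (@lebesgue_measure_rv n) (@lebesgue_measure_rv_sigma_finite n).

End lebesgue_measure_rv.

Arguments lebesgue_measure_rv {R} n.

Section euclidean.
Variable R : realType.

(* The library's norm on 'rV[R]_n is the sup norm, hence this definition. *)
Definition enorm n (x : 'rV[R]_n) : R := Num.sqrt (\sum_(i < n) x ord0 i ^+ 2).

Definition eball n (r : R) : set 'rV[R]_n := [set x | enorm x < r].

Definition unit_cube n : set 'rV[R]_n :=
  [set x | forall i, - (1 / 2) <= x ord0 i <= 1 / 2].

Definition of_Zd n (p : 'rV[int]_n) : 'rV[R]_n := map_mx intr p.

Lemma measurable_enorm n : measurable_fun setT (@enorm n).
Proof.
have mS : measurable_fun setT (fun x : 'rV[R]_n => \sum_(i < n) x ord0 i ^+ 2).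
  apply: measurable_sum => i; apply: measurable_funX.
  exact: measurable_coord_rv.
have ms : measurable_fun setT (Num.sqrt : R -> R).
  by apply: continuous_measurable_fun; exact: sqrt_continuous.
exact: (measurableT_comp ms mS).
Qed.

Lemma measurable_eball n r : measurable (@eball n r).
Proof.
rewrite -[X in measurable X]setTI.
rewrite (_ : eball r = @enorm n @^-1` `]-oo, r[); last first.
  by apply/seteqP; split => x; rewrite /eball/= in_itv.
by apply: measurable_enorm => //; exact: measurable_itv.
Qed.

End euclidean.

Arguments unit_cube : clear implicits.
Arguments eball {R} n r.

Section kato.
Variables (R : realType) (n : nat).

(* Singularity of the Green function of the Laplacian for n >= 2; for n = 1
   the Kato condition is uniform local integrability instead. *)
Definition kato_kernel (z : 'rV[R]_n) : R :=
  if n == 2%N then - ln (enorm z) else enorm z `^ (2 - n%:R).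

Definition kato_sup (u g : 'rV[R]_n -> R) (r : R) : \bar R :=
  ereal_sup [set (\int[lebesgue_measure_rv n]_(y in [set y | (enorm (x - y) <= r)%R])
                     (g (x - y) * `|u y|)%:E)%E | x in [set: 'rV[R]_n]].

Definition kato_class (u : 'rV[R]_n -> R) : Prop :=
  measurable_fun setT u /\
  if n == 1%N then (kato_sup u (cst 1%R) 1%R < +oo)%E : Prop
  else kato_sup u kato_kernel r @[r --> 0^'+] --> 0%E.

End kato.

Section probability.
Context dO (O : measurableType dO) (R : realType) (P : probability O R).
Local Open Scope ereal_scope.

Definition mutually_independent (I : choiceType) dT (T : measurableType dT)
    (X : I -> O -> T) : Prop :=
  forall (s : seq I) (A : I -> set T), uniq s -> (forall i, measurable (A i)) ->
    P (\bigcap_(i in [set` s]) (X i @^-1` A i)) =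
    \prod_(i <- s) P (X i @^-1` A i).

Definition lattice_weight (theta : R) d (p : 'rV[int]_d) : \bar R :=
  (expR (- (enorm (of_Zd R p) `^ theta)))%:E.

Definition iid_displacements (theta : R) d
    (xi : 'rV[int]_d -> O -> 'rV[int]_d) : Prop :=
  [/\ forall q, measurable_fun setT (xi q),
      mutually_independent xi &
      forall q p, P (xi q @^-1` [set p]) =
        lattice_weight theta p / \esum_(k in [set: 'rV[int]_d]) lattice_weight theta k].

Definition brownian_motion d (x : 'rV[R]_d) (B : R -> O -> 'rV[R]_d) : Prop :=
  [/\ (forall t, (0 <= t)%R -> measurable_fun setT (B t)) /\
        (forall w, {within `[0%R, +oo[, continuous (fun t => B t w)}),
      {ae P, forall w, B 0%R w = x},
      (forall (s t : R) (A : 'I_d -> set R), (0 <= s < t)%R ->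
        (forall i, measurable (A i)) ->
        P [set w | forall i, A i ((B t w - B s w)%R ord0 i)] =
        \prod_(i < d) normal_prob 0%R (Num.sqrt (t - s)%R) (A i)) &
      (forall (n : nat) (t : nat -> R), (0 <= t 0%N)%R ->
        (forall k, (t k <= t k.+1)%R) ->
        mutually_independent
          (fun (k : 'I_n) w => B (t k.+1) w - B (t k) w)%R)].

End probability.

Section model.
Variables (R : realType) (d : nat).
Local Open Scope ereal_scope.

Definition potential (u : 'rV[R]_d -> R) (xi : 'rV[int]_d -> 'rV[int]_d)
    (x : 'rV[R]_d) : \bar R :=
  \esum_(q in [set: 'rV[int]_d]) (u (x - of_Zd R q - of_Zd R (xi q))%R)%:E.

(* The integral over W lies in [0, 1], so that [fine] loses nothing. *)
Definition survival dW (W : measurableType dW) (Q : probability W R)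
    (B : R -> W -> 'rV[R]_d) (V : 'rV[R]_d -> \bar R) (t : R) : R :=
  fine (\int[Q]_w expeR (- \int[lebesgue_measure]_(s in `[0%R, t]) V (B s w))).

(* The division is the one of \bar R: C0 / |q + y|^alpha is +oo at y = -q.
   The integral is finite for alpha > d. *)
Definition rate_constant (alpha theta C0 : R) : R :=
  fine (\int[lebesgue_measure_rv d]_q
    ereal_inf [set C0%:E / (enorm (q + y)%R `^ alpha)%:E + (enorm y `^ theta)%:E
              | y in [set: 'rV[R]_d]]).

End model.

(* Main.v *)
From HB Require Import structures.
Require Import Defs.
From mathcomp Require Import all_boot all_order all_algebra.
From mathcomp Require Import all_classical all_reals all_analysis.
From mathcomp Require Import measurable_realfun ess_sup_inf.
From mathcomp Require Import ring lra.
Import Order.TTheory GRing.Theory Num.Theory.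
Import numFieldNormedType.Exports.

Set Implicit Arguments.
Unset Strict Implicit.
Unset Printing Implicit Defensive.

Local Open Scope classical_set_scope.
Local Open Scope ring_scope.

(** Why the theorem holds. Put [T = p t] and let [L] be the scale with
    [L^(alpha + theta) = T], so that [T L^-alpha = L^theta] and
    [T^((d + theta) / (alpha + theta)) = L^(d + theta)]. Consider a particle at rest near
    the origin during a time [T], and an obstacle attached to a lattice point at distance
    [b L]. If the obstacle is displaced by [s L] radially outwards, the potential costs
    [T C0 ((b + s) L)^-alpha] and the law of the displacement costs [(s L)^theta], in total
    [L^theta] times [cost b s]. The infimum over [s] is [rate b]; since radial displacements
    are optimal, [rate |q|] is the integrand of the constant [c] ([rate_integrand]). The
    obstacles act independently, so the total cost is the sum of [L^theta rate (|q| / L)]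
    over the lattice points [q], that is [L^(d + theta)] times a Riemann sum of [c]
    ([riemann_rate_upper], [riemann_rate_lower]).

    Upper bound. By Jensen's inequality, [v^p] is at most the average over the time [s] and
    over the motion of [exp (- T V (B_s))]. With the expectation over the field innermost,
    it remains to bound the latter for a fixed position [y] ([survival_moment_upper]). Only
    the obstacles around [y] are kept; by independence the expectation is a product, and
    each factor is a sum over the displacements of the exponential of minus a cost, hence
    at most a constant times the exponential of minus the minimal cost
    ([displacement_factor]). There are [O(L^d)] factors, so these constants are negligible
    against [exp (L^(d + theta))]. Where [u] is not described by its asymptotics, its
    essential infimum bounds it from below almost everywhere; the exceptional positions form
    a null set, which [B_s] avoids because its law is absolutely continuous
    ([good_points], [bm_abs_continuous]).

    Lower bound. Let the obstacles attached to lattice points within distance [r L] take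
    near-optimal displacements, let the others move by at most half of their distance to
    the origin, and let the motion stay in a box with side of order [L] up to time [t]. The
    first event and the potential of the near obstacles together cost [L^(d + theta)] times
    the Riemann sum; the second event has probability at least 1 / 2, and the potential of
    the far obstacles is small for large [r]
    ([annealed_lower]). Confining the motion costs [exp (- O(t / L^2))] ([bm_stay_box]),
    which is negligible because [alpha < d + 2]. The estimate for the box follows the
    product of the first eigenfunctions of the sides, truncated to the box, along the
    motion on finer and finer time grids: each Gaussian step of duration [h] multiplies its
    expectation by at least [1 - O(h)], up to an error [O(h^2)] ([normal_psi]). *)

(** * Integrals without measurability, and independence *)

Section integral_tools.
Local Open Scope ereal_scope.
Context d (T : measurableType d) (R : realType).
Variable mu : {measure set T -> \bar R}.

(** The integral of a nonnegative function is the supremum over the simple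
    functions below it, measurable or not; hence it is monotone. *)
Lemma ge0_le_integral_nomeas (D : set T) (f g : T -> \bar R) :
  (forall x, D x -> 0 <= f x) -> (forall x, D x -> f x <= g x) ->
  \int[mu]_(x in D) f x <= \int[mu]_(x in D) g x.
Proof.
move=> f0 fg; rewrite !ge0_integralE//; last first.
  by move=> x Dx; exact: le_trans (f0 _ Dx) (fg _ Dx).
apply/ge_ereal_sup => _ [h hf <-]; apply: ereal_sup_ubound; exists h => //= x.
by apply: le_trans (hf x) _; apply: lee_restrict.
Qed.

End integral_tools.

Lemma integral_prob_cst d (T : measurableType d) (R : realType)
    (P : probability T R) (c : R) : (\int[P]_x c%:E = c%:E)%E.
Proof.
by rewrite integral_cst//= -[RHS]mule1; congr (_ * _)%E; exact: probability_setT.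
Qed.

Section independence.
Local Open Scope ereal_scope.
Context dW (W : measurableType dW) (R : realType) (P : probability W R).
Context (I : choiceType) dT (T : measurableType dT).
Variable X : I -> W -> T.
Hypothesis mX : forall i, measurable_fun setT (X i).
Hypothesis indX : mutually_independent P X.

(** A pi-system that generates the sigma-algebra of the variables with index in [s]. *)
Definition past (s : seq I) : set (set W) :=
  [set E | exists2 A : I -> set T, (forall i, measurable (A i)) &
    E = \bigcap_(i in [set` s]) (X i @^-1` A i)].

Let mpre i B : measurable B -> measurable (X i @^-1` B).
Proof. by move=> mB; rewrite -[X in measurable X]setTI; exact: mX. Qed.

Lemma measurable_past s E : past s E -> measurable E.
Proof.
move=> [A mA ->]; rewrite bigcap_seq.
by apply: bigsetI_measurable => i _; exact: mpre.
Qed.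

Lemma measurable_gpast s E : <<s past s >> E -> measurable E.
Proof.
apply: smallest_sub => [|F]; last exact: measurable_past.
exact: sigma_algebra_measurable.
Qed.

(** Dynkin's lemma: the events that are independent of [X i @^-1` B] form a Dynkin
    system, and independence puts the pi-system [past s] into it. *)
Lemma gpast_indep s i E B : uniq (i :: s) -> <<s past s >> E -> measurable B ->
  P (E `&` X i @^-1` B) = P E * P (X i @^-1` B).
Proof.
move=> /= /andP[nis us] sE mB; set F := X i @^-1` B.
have mF : measurable F by exact: mpre.
suff : <<s past s >> `<=` [set E | measurable E /\ P (E `&` F) = P E * P F].
  by move=> /(_ _ sE)[].
rewrite -setI_closed_g_dynkin_g_sigma_algebra; last first.
  move=> _ _ [A mA ->] [A' mA' ->]; exists (fun i => A i `&` A' i).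
    by move=> j; exact: measurableI.
  by rewrite -bigcapI; apply: eq_bigcapr => j _; rewrite preimage_setI.
apply: smallest_sub.
- split.
  + by split => //; rewrite setTI probability_setT mul1e.
  + move=> G [mG PG]; split; first exact: measurableC.
    have -> : P (~` G `&` F) = P F - P (G `&` F).
      by rewrite setIC -setDE measureD// ?(setIC F)// (le_lt_trans (probability_le1 _ _)) ?ltry.
    rewrite probability_setC// PG.
    by rewrite muleBl ?mul1e// ?fin_num_adde_defr ?fin_num_measure.
  + move=> G tG HG; split; first by apply: bigcup_measurable => k _; apply HG.
    rewrite setI_bigcupl measure_bigcup//; last 2 first.
      by move=> k _; apply: measurableI => //; apply HG.
      exact/trivIset_setIr.
    rewrite measure_bigcup//; last by move=> k _; apply HG.
    have PF : P F \is a fin_num by exact: fin_num_measure.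
    rewrite muleC -(fineK PF) -nneseriesZl//.
    by apply: eq_eseriesr => k _; rewrite fineK// muleC; exact: (HG k).2.
- move=> _ [A mA ->]; split; first by apply: (@measurable_past s); exists A.
  pose A' j := if j == i then B else A j.
  have mA' j : measurable (A' j) by rewrite /A'; case: ifP.
  have -> : \bigcap_(i in [set` s]) X i @^-1` A i =
            \bigcap_(i in [set` s]) X i @^-1` A' i.
    apply: eq_bigcapr => j /= js; rewrite /A'; case: eqP => // ji.
    by rewrite ji (negbTE nis) in js.
  have -> : (\bigcap_(i in [set` s]) X i @^-1` A' i) `&` F =
            \bigcap_(i in [set` (i :: s)]) X i @^-1` A' i.
    by rewrite [RHS]bigcap_seq big_cons -bigcap_seq {2}/A' eqxx setIC.
  by rewrite !indX//= ?nis// big_cons {1}/A' eqxx muleC.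
Qed.

Lemma measurable_past_fun dY (T' : measurableType dY) s
    (Y : g_sigma_algebraType (past s) -> T') :
  measurable_fun setT Y -> measurable_fun setT (Y : W -> T').
Proof.
move=> mY _ A mA; rewrite setTI; apply: (@measurable_gpast s).
by rewrite -[X in <<s _ >> X]setTI; exact: mY.
Qed.

Section fubini.
Context dY (T' : measurableType dY).

(** The joint law of a function [Y] of the past and of a new variable is the
    product of their laws, so that Fubini's theorem applies to it. *)
Lemma past_fubini s i (Y : g_sigma_algebraType (past s) -> T')
    (F : T' * T -> \bar R) :
  uniq (i :: s) -> measurable_fun setT Y -> measurable_fun setT F ->
  (forall z, 0 <= F z) ->
  \int[P]_w F (Y w, X i w) = \int[P]_w \int[P]_w' F (Y w, X i w').
Proof.
move=> us mY mF F0; pose Y' : W -> T' := Y.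
have pY A : measurable A -> <<s past s >> (Y' @^-1` A).
  by move=> mA; rewrite -[X in <<s _ >> X]setTI; exact: mY.
have mY' : measurable_fun setT Y'.
  exact: measurable_past_fun mY.
pose Ym : {mfun W >-> T'} := HB.pack Y' (isMeasurableFun.Build _ _ _ _ _ mY').
pose Xm : {mfun W >-> T} := HB.pack (X i) (isMeasurableFun.Build _ _ _ _ _ (mX i)).
pose Z w := (Y' w, X i w).
have mZ : measurable_fun setT Z by exact: measurable_fun_pair.
pose Zm : {mfun W >-> (T' * T)%type} := HB.pack Z (isMeasurableFun.Build _ _ _ _ _ mZ).
have ZE S : measurable S ->
    (distribution P Ym \x distribution P Xm) S = distribution P Zm S.
  apply: product_measure_unique => A B mA mB.
  rewrite /distribution /pushforward /= -(gpast_indep us)//; exact: pY.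
transitivity (\int[distribution P Zm]_z F z).
  by rewrite ge0_integral_distribution.
transitivity (\int[distribution P Ym \x distribution P Xm]_z F z).
  by apply: eq_measure_integral => A mA _; apply/esym; exact: ZE.
rewrite fubini_tonelli1//.
rewrite ge0_integral_distribution//=; first last.
- by move=> y; exact: integral_ge0.
- exact: measurable_fun_fubini_tonelli_F.
apply: eq_integral => w _ /=; rewrite /fubini_F ge0_integral_distribution//.
exact: measurableT_comp.
Qed.

End fubini.

Lemma measurable_past_coord s i : i \in s ->
  measurable_fun setT (X i : g_sigma_algebraType (past s) -> T).
Proof.
move=> si _ A mA; rewrite setTI; apply: sub_sigma_algebra.
exists (fun j => if j == i then A else setT).
  by move=> j; case: ifP.
apply/seteqP; split => [w Aw j /= _|w /(_ i si)]; last by rewrite eqxx.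
by case: eqP => // ->.
Qed.

(** By induction on [s]: the product over the tail is a function of the past. *)
Lemma integral_prod_indep (s : seq I) (f : I -> T -> R) : uniq s ->
  (forall i, measurable_fun setT (f i)) -> (forall i x, (0 <= f i x)%R) ->
  \int[P]_w (\prod_(i <- s) f i (X i w))%:E =
  \prod_(i <- s) \int[P]_w (f i (X i w))%:E.
Proof.
move=> + mf f0; elim: s => [_|i s IH us].
  rewrite big_nil; under eq_integral do rewrite big_nil.
  exact: integral_prob_cst.
pose Y (w : g_sigma_algebraType (past s)) := (\prod_(i <- s) f i (X i w))%R.
pose F (z : R * T) := (`|z.1| * f i z.2)%:E.
have Y0 w : (0 <= Y w)%R by apply: prodr_ge0 => j _.
have mY : measurable_fun setT Y.
  apply: measurable_prod => j js.
  exact: (measurableT_comp (mf j) (measurable_past_coord js)).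
have mF : measurable_fun setT F.
  apply/measurable_EFinP; apply: measurable_funM.
    exact: (measurableT_comp (@normr_measurable _ _)).
  exact: (measurableT_comp (mf i)).
rewrite big_cons.
transitivity (\int[P]_w F (Y w, X i w)).
  by apply: eq_integral => w _; rewrite big_cons /F/= ger0_norm// mulrC.
rewrite (@past_fubini _ _ s i Y F)//; last by move=> z; rewrite lee_fin mulr_ge0.
rewrite -IH; last by case/andP: us.
have I0 : 0 <= \int[P]_w (f i (X i w))%:E by apply: integral_ge0 => w _; rewrite lee_fin.
transitivity (\int[P]_w ((Y w)%:E * \int[P]_w (f i (X i w))%:E)).
  apply: eq_integral => w _; rewrite /F/=.
  under eq_integral do rewrite EFinM.
  rewrite ge0_integralZl//= ?ger0_norm ?lee_fin//.
    by apply/measurable_EFinP; exact: measurableT_comp.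
  by move=> x _; rewrite lee_fin.
rewrite ge0_integralZr//.
- by rewrite muleC.
- by apply/measurable_EFinP; exact: measurable_past_fun mY.
- by move=> w _; rewrite lee_fin.
Qed.

End independence.

Section transfer.
Local Open Scope ereal_scope.
Context d1 d2 (T1 : measurableType d1) (T2 : measurableType d2) (R : realType).
Variables (mu : {measure set T1 -> \bar R}) (nu : {measure set T2 -> \bar R}).
Variable phi : T1 -> T2.
Hypothesis mphi : measurable_fun setT phi.
Hypothesis muphi : forall A, measurable A -> mu (phi @^-1` A) = nu A.

Lemma ge0_integral_transfer (f : T2 -> \bar R) : measurable_fun setT f ->
  (forall y, 0 <= f y) -> \int[mu]_x f (phi x) = \int[nu]_y f y.
Proof.
move=> mf f0.
pose m2 : {measure set T2 -> \bar R} :=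
  measure_function_pushforward__canonical__measure_function_Measure mu mphi.
transitivity (\int[m2]_y f y).
  by rewrite (ge0_integral_pushforward mphi)// preimage_setT.
by apply: eq_measure_integral => A mA _; exact: muphi.
Qed.

End transfer.

(** * Gaussian estimates *)

Section density.
Local Open Scope ereal_scope.
Context d (T : measurableType d) (R : realType).
Variables (mu nu : {measure set T -> \bar R}) (g : T -> R).
Hypothesis mg : measurable_fun setT g.
Hypothesis g0 : forall x, (0 <= g x)%R.
Hypothesis nuE : forall A, measurable A -> nu A = \int[mu]_(x in A) (g x)%:E.

Import HBNNSimple.

Lemma ge0_integral_density_nnsfun (h : {nnsfun T >-> R}) :
  \int[nu]_x (h x)%:E = \int[mu]_x ((h x)%:E * (g x)%:E).
Proof.
under eq_integral do rewrite fimfunE -fsumEFin//.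
rewrite ge0_integral_fsum//; last 2 first.
- by move=> r; exact/measurable_EFinP/measurableT_comp.
- by move=> n x _; rewrite EFinM nnfun_muleindic_ge0.
transitivity (\int[mu]_x
   (\sum_(y \in range h) ((y * \1_(h @^-1` [set y]) x)%:E * (g x)%:E))).
  rewrite ge0_integral_fsum//; last 2 first.
  - move=> y; apply: emeasurable_funM; last exact/measurable_EFinP.
    by apply/measurable_EFinP; exact: measurable_funM.
  - move=> y x _; rewrite mule_ge0 ?lee_fin//.
    by have := nnfun_muleindic_ge0 h y x; rewrite -EFinM lee_fin.
  apply: eq_fsbigr => r /[!inE] -[t _ hr].
  have r0 : (0 <= r)%R by rewrite -hr.
  under [RHS]eq_integral do rewrite EFinM -muleA.
  have m1 : measurable (h @^-1` [set r]) by exact: measurable_funPTI.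
  have mi : measurable_fun setT (fun x => (\1_(h @^-1` [set r]) x)%:E : \bar R).
    exact/measurable_EFinP.
  have mig : measurable_fun setT (fun x => (\1_(h @^-1` [set r]) x)%:E * (g x)%:E).
    by apply: emeasurable_funM => //; exact/measurable_EFinP.
  have ig0 x : setT x -> 0 <= (\1_(h @^-1` [set r]) x)%:E * (g x)%:E.
    by rewrite mule_ge0 ?lee_fin.
  have i0 x : setT x -> 0 <= (\1_(h @^-1` [set r]) x)%:E :> \bar R.
    by rewrite lee_fin.
  rewrite (ge0_integralZl _ measurableT mig ig0); last by rewrite lee_fin.
  under eq_integral do rewrite EFinM.
  rewrite (ge0_integralZl _ measurableT mi i0); last by rewrite lee_fin.
  congr (_ * _); rewrite integral_indic// setIT nuE// integral_mkcond.
  apply: eq_integral => x _; rewrite patchE indicE.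
  by case: ifPn => xr; rewrite ?mul1e ?mul0e.
apply: eq_integral => x _; rewrite [in RHS]fimfunE -fsumEFin// ge0_mule_fsuml//.
by move=> y; have := nnfun_muleindic_ge0 h y x; rewrite -EFinM.
Qed.

(** By monotone approximation with simple functions. *)
Lemma ge0_integral_density (f : T -> \bar R) :
  measurable_fun setT f -> (forall x, 0 <= f x) ->
  \int[nu]_x f x = \int[mu]_x (f x * (g x)%:E).
Proof.
move=> mf f0; pose h := nnsfun_approx measurableT mf.
have fE x : f x = limn (fun n => (h n x)%:E).
  by apply/esym/cvg_lim => //; exact: cvg_nnsfun_approx.
transitivity (limn (fun n => \int[nu]_x (h n x)%:E)).
  under eq_integral do rewrite fE.
  apply: monotone_convergence => //.
  - by move=> n; exact/measurable_EFinP.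
  - by move=> n x _; rewrite lee_fin.
  - by move=> x _ a b ab; rewrite lee_fin; exact/lefP/nd_nnsfun_approx.
transitivity (limn (fun n => \int[mu]_x ((h n x)%:E * (g x)%:E))).
  by congr (limn _); apply/funext => n; exact: ge0_integral_density_nnsfun.
rewrite -monotone_convergence//.
- apply: eq_integral => x _; apply/cvg_lim => //; apply: cvgeZr => //.
  exact: cvg_nnsfun_approx.
- by move=> n; apply: emeasurable_funM; exact/measurable_EFinP.
- by move=> n x _; rewrite mule_ge0 ?lee_fin.
- move=> x _ a b ab; rewrite lee_wpmul2r ?lee_fin//.
  exact/lefP/nd_nnsfun_approx.
Qed.

End density.

Section trig.
Variable R : realType.
Implicit Types x y : R.

Lemma abs_sin_le x : `|sin x| <= `|x|.
Proof.
wlog x0 : x / 0 < x => [H|].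
  have [x0|x0|->] := ltgtP x 0; last by rewrite sin0.
    by rewrite -(normrN x) -(normrN (sin x)) -sinN; apply: H; rewrite oppr_gt0.
  exact: H.
have [c _] := @MVT R sin cos 0 x x0 (fun y _ => is_derive_sin y)
  (continuous_subspaceT (@continuous_sin R)).
rewrite sin0 !subr0 => ->; rewrite normrM ler_piMl//; exact: cos_max.
Qed.

Lemma cos_ge1Bsqr x : 1 - x ^+ 2 / 2 <= cos x.
Proof.
have -> : cos x = 1 - 2 * sin (x / 2) ^+ 2.
  have {1}-> : x = (x / 2) *+ 2 by rewrite -mulr_natr divfK.
  by rewrite cos_mulr2n cos2sin2 -mulr_natr; ring.
have : sin (x / 2) ^+ 2 <= (x / 2) ^+ 2.
  by rewrite -(real_normK (num_real (sin _))) -[leRHS]real_normK ?num_real// lerXn2r ?nnegrE// abs_sin_le.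
nra.
Qed.

End trig.

Section gauss.
Variable R : realType.
Implicit Types x y r s : R.
Local Notation mu := (@lebesgue_measure R).

Lemma ge0_integral_normal s (f : R -> \bar R) :
  measurable_fun setT f -> (forall x, 0 <= f x)%E ->
  (\int[normal_prob 0 s]_x f x = \int[mu]_x (f x * (normal_pdf 0 s x)%:E))%E.
Proof.
move=> mf f0; apply: ge0_integral_density => //.
- exact: measurable_normal_pdf.
- by move=> x; exact: normal_pdf_ge0.
Qed.

(** Powers of [y] are absorbed by doubling the scale of the density: the constant
    [3 / (8 s^2)] is the difference of the exponents [1 / (2 s^2)] and
    [1 / (2 (2 s)^2)]. *)
Lemma normal_pdf_dilate s y (n : nat) (C : R) : 0 < s ->
  (3 / (8 * s ^+ 2) * y ^+ 2) ^+ n <= C * expR (3 / (8 * s ^+ 2) * y ^+ 2) ->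
  (3 / (8 * s ^+ 2) * y ^+ 2) ^+ n * normal_pdf 0 s y <= 2 * C * normal_pdf 0 (2 * s) y.
Proof.
move=> s0 H.
have s0' : s != 0 by rewrite gt_eqF.
have s20' : 2 * s != 0 by rewrite mulf_neq0.
rewrite !normal_pdfE// /normal_peak /normal_fun !subr0.
have -> : (2 * s) ^+ 2 * pi *+ 2 = 2 ^+ 2 * (s ^+ 2 * pi *+ 2) by ring.
rewrite sqrtrM ?sqr_ge0// sqrtr_sqr ger0_norm//.
set q := Num.sqrt _; rewrite (invfM 2 q); set p := q^-1.
have p0 : 0 <= p by rewrite invr_ge0 sqrtr_ge0.
have -> : 2 * C * (2^-1 * p * expR (- y ^+ 2 / ((2 * s) ^+ 2 *+ 2))) =
   p * (C * expR (3 / (8 * s ^+ 2) * y ^+ 2) * expR (- y ^+ 2 / (s ^+ 2 *+ 2))).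
  have -> : - y ^+ 2 / ((2 * s) ^+ 2 *+ 2) =
     3 / (8 * s ^+ 2) * y ^+ 2 + (- y ^+ 2 / (s ^+ 2 *+ 2)).
    by field.
  by rewrite expRD; field.
rewrite mulrCA ler_wpM2l// ler_wpM2r// ltW// expR_gt0.
Qed.

(** Up to the factors of [normal_pdf_dilate], the moment is the total mass of the
    normal law at scale [2 s]. *)
Lemma normal_moment s (n : nat) (C : R) : 0 < s -> 0 <= C ->
  (forall u, 0 <= u -> u ^+ n <= C * expR u) ->
  (\int[normal_prob 0 s]_y ((y ^+ 2) ^+ n)%:E <= (2 * C * (8 / 3 * s ^+ 2) ^+ n)%:E)%E.
Proof.
move=> s0 C0 H.
have m1 k : measurable_fun setT (fun y : R => ((y ^+ 2) ^+ k)%:E).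
  by apply/measurable_EFinP; do 2 apply: measurable_funX.
rewrite ge0_integral_normal//; last by move=> y; rewrite lee_fin exprn_ge0// sqr_ge0.
apply: (@le_trans _ _ (\int[mu]_y ((2 * C * (8 / 3 * s ^+ 2) ^+ n)%:E *
     (normal_pdf 0 (2 * s) y)%:E))%E).
  apply: ge0_le_integral_nomeas => y _.
    by rewrite mule_ge0 ?lee_fin ?normal_pdf_ge0// exprn_ge0// sqr_ge0.
  rewrite -!EFinM lee_fin.
  have := @normal_pdf_dilate s y n C s0.
  have k0 : 0 <= 3 / (8 * s ^+ 2) * y ^+ 2.
    by rewrite mulr_ge0 ?sqr_ge0// divr_ge0// mulr_ge0// sqr_ge0.
  move=> /(_ (H _ k0)).
  have k1 : 0 <= (8 / 3 * s ^+ 2) ^+ n.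
    by rewrite exprn_ge0// mulr_ge0 ?sqr_ge0.
  move=> /(ler_wpM2l k1); rewrite mulrA -exprMn.
  have -> : 8 / 3 * s ^+ 2 * (3 / (8 * s ^+ 2) * y ^+ 2) = y ^+ 2.
    by field; rewrite gt_eqF.
  by rewrite mulrA [X in _ <= X * _]mulrC.
rewrite ge0_integralZl//.
- by rewrite integral_normal_pdf mule1.
- by apply/measurable_EFinP; exact: measurable_normal_pdf.
- by move=> y _; rewrite lee_fin normal_pdf_ge0.
- by rewrite lee_fin !mulr_ge0// exprn_ge0// mulr_ge0 ?sqr_ge0.
Qed.

Lemma expR_ge_sqr4 (u : R) : 0 <= u -> u ^+ 2 <= 4 * expR u.
Proof.
move=> u0; have -> : expR u = expR (u / 2) ^+ 2.
  by rewrite -expRM_natr mulr_natr -[in RHS]mulr_natr divfK.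
have := expR_ge1Dx (u / 2); nra.
Qed.

Lemma normal_moment2 s : 0 < s ->
  (\int[normal_prob 0 s]_y (y ^+ 2)%:E <= (6 * s ^+ 2)%:E)%E.
Proof.
move=> s0; apply: le_trans (@normal_moment s 1 1 s0 _ _) _ => //.
  by move=> u u0; rewrite mul1r; have := expR_ge1Dx u; lra.
by rewrite lee_fin expr1; have := sqr_ge0 s; nra.
Qed.

Lemma normal_moment4 s : 0 < s ->
  (\int[normal_prob 0 s]_y (y ^+ 4)%:E <= (64 * s ^+ 4)%:E)%E.
Proof.
move=> s0; under eq_integral do rewrite (exprM _ 2 2).
apply: le_trans (@normal_moment s 2 4 s0 _ _) _ => //.
  exact: expR_ge_sqr4.
rewrite lee_fin exprMn -exprM; have : 0 <= s ^+ 4 by rewrite exprn_ge0// ltW.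
rewrite /=; lra.
Qed.

Lemma normal_sym s (f : R -> \bar R) : 0 < s -> measurable_fun setT f ->
  (forall x, 0 <= f x)%E ->
  (\int[normal_prob 0 s]_x f (- x)%R = \int[normal_prob 0 s]_x f x)%E.
Proof.
move=> s0 mf f0.
have mN : measurable_fun setT (-%R : R -> measurableTypeR R).
  by apply: continuous_measurable_fun; exact: opp_continuous.
rewrite !ge0_integral_normal//; last exact: measurableT_comp.
pose g x := (f x * (normal_pdf 0 s x)%:E)%E.
have mg : measurable_fun setT g.
  by apply: emeasurable_funM => //; apply/measurable_EFinP; exact: measurable_normal_pdf.
transitivity (\int[mu]_x (g \o -%R) x)%E.
  apply: eq_integral => x _; rewrite /g/=; congr (_ * (_)%:E)%E.
  by rewrite !normal_pdfE ?gt_eqF// /normal_fun !subr0 sqrrN.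
have g0 y : (0 <= g y)%E by rewrite mule_ge0// lee_fin normal_pdf_ge0.
have HN (A : set (measurableTypeR R)) : measurable A -> mu ((-%R : R -> measurableTypeR R) @^-1` A) = mu A.
  by move=> mA; rewrite -[RHS](lebesgue_measureN mA).
exact: (@ge0_integral_transfer _ _ _ _ R mu mu _ mN HN g mg g0).
Qed.

(** First Dirichlet eigenfunction of the interval [-r, r], extended by zero. *)
Definition psi r x : R := if `|x| < r then cos (pi / 2 / r * x) else 0.

Lemma measurable_psi r : measurable_fun setT (psi r).
Proof.
apply: measurable_fun_ifT; last exact: measurable_cst.
  apply: measurable_fun_ltr; last exact: measurable_cst.
  exact: normr_measurable.
apply: continuous_measurable_fun => x; apply: continuous_comp.
  exact: mulrl_continuous.
exact: continuous_cos.
Qed.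

Lemma psi_ge0 r x : 0 < r -> 0 <= psi r x.
Proof.
move=> r0; rewrite /psi; case: ifPn => // xr.
apply: cos_ge0_pihalf; rewrite -ler_norml normrM (gtr0_norm (_ : 0 < pi / 2 / r)).
  by rewrite mulrAC ler_pdivrMr// ler_wpM2l ?(ltW xr) ?divr_ge0 ?pi_ge0.
by rewrite divr_gt0// divr_gt0// pi_gt0.
Qed.

Lemma psi_le1 r x : psi r x <= 1.
Proof. by rewrite /psi; case: ifP => // _; exact: cos_le1. Qed.

(** Outside of the interval, the cosine is nonpositive up to distance [3 r], and
    farther away [|y| / (2 r)] exceeds 1, so that its fourth power compensates. *)
Lemma psi_cos r x y : 0 < r -> `|x| < r ->
  cos (pi / 2 / r * (x + y)) - (y / (2 * r)) ^+ 4 <= psi r (x + y).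
Proof.
move=> r0 xr; rewrite /psi; case: ifPn => xyr.
  by rewrite lerBlDr lerDl (exprM _ 2 2) sqr_ge0.
rewrite -leNgt in xyr.
have [yr|yr] := leP (2 * r) `|y|.
  have : 1 <= (y / (2 * r)) ^+ 4.
    rewrite -[X in _ <= X]ger0_norm ?(exprM _ 2 2) ?sqr_ge0//.
    rewrite -(exprM _ 2 2) normrX exprn_ege1// normrM normfV (gtr0_norm (_ : 0 < 2 * r)).
      by rewrite ler_pdivlMr ?mul1r// mulr_gt0.
    by rewrite mulr_gt0.
  by have := cos_le1 (pi / 2 / r * (x + y)); lra.
have : cos (pi / 2 / r * (x + y)) <= 0.
  rewrite -cos_norm normrM gtr0_norm; last by rewrite !divr_gt0// pi_gt0.
  set w := _ * `|_|; rewrite -(subrK pi w) cosDpi oppr_le0.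
  apply: cos_ge0_pihalf; rewrite lerBrDr lerBlDr.
  have p0 := pi_gt0 R.
  have H : `|x + y| <= 3 * r by have := ler_normD x y; lra.
  have -> : w = pi / 2 * (`|x + y| / r) by rewrite /w; field; rewrite gt_eqF.
  have h1 : 1 <= `|x + y| / r by rewrite ler_pdivlMr// mul1r.
  have h2 : `|x + y| / r <= 3 by rewrite ler_pdivrMr.
  nra.
have : 0 <= (y / (2 * r)) ^+ 4 by rewrite (exprM _ 2 2) sqr_ge0.
lra.
Qed.

(** A Gaussian step of variance [s^2] multiplies the eigenfunction by a factor
    [1 - O(s^2 / r^2)], up to an error of order [s^4] due to the truncation. In the
    expansion [cos (a x + a y) = cos (a x) cos (a y) - sin (a x) sin (a y)], the
    second term has mean zero by symmetry and the first one is controlled by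
    [cos_ge1Bsqr] and the second moment. *)
Lemma normal_psi r s x : 0 < r -> 0 < s ->
  (((1 - 12 * s ^+ 2 / r ^+ 2) * psi r x - 4 * s ^+ 4 / r ^+ 4)%:E <=
  \int[normal_prob 0 s]_y (psi r (x + y))%:E)%E.
Proof.
move=> r0 s0; have [xr|xr] := ltP `|x| r; last first.
  rewrite {1}/psi ltNge xr/= mulr0 sub0r.
  apply: (@le_trans _ _ 0%E); last first.
    by apply: integral_ge0 => y _; rewrite lee_fin psi_ge0.
  by rewrite lee_fin oppr_le0 divr_ge0 ?mulr_ge0 ?exprn_ge0// ltW.
have mpsi := @measurable_psi r.
pose a := pi / 2 / r.
have a0 : 0 < a by rewrite !divr_gt0// pi_gt0.
have psixE : psi r x = cos (a * x) by rewrite /psi xr.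
have c0 : 0 <= cos (a * x) by rewrite -psixE psi_ge0.
set N := normal_prob 0 s.
have mcont (f : R -> R) : continuous f -> measurable_fun setT (EFin \o f).
  by move=> cf; apply/measurable_EFinP; exact: continuous_measurable_fun.
have csin b : continuous (fun y : R => 1 + b * sin (a * y)).
  move=> y; apply: cvgD; first exact: cvg_cst.
  apply: cvgM; first exact: cvg_cst.
  apply: continuous_comp; first exact: mulrl_continuous.
  exact: continuous_sin.
have b01 : `|sin (a * x)| <= 1 by exact: sin_max.
have s01 y : `|sin (a * y)| <= 1 by exact: sin_max.
pose b := sin (a * x).
have sinb0 b' y : `|b'| <= 1 -> 0 <= 1 + b' * sin (a * y).
  move=> b'1; have : `|b' * sin (a * y)| <= 1.
    by rewrite normrM -[leRHS]mulr1 ler_pM.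
  by rewrite ler_norml; lra.
(* Only nonnegative integrands are used: adding 1 makes the odd term one of them. *)
pose Is (b : R) : \bar R := (\int[N]_y (1 + b * sin (a * y))%:E)%E.
have IsE : Is b = 1%E.
  have E1 : Is b = Is (- b).
    rewrite /Is -normal_sym//; last 2 first.
      exact: (mcont _ (csin b)).
      by move=> y; rewrite lee_fin sinb0.
    by apply: eq_integral => y _; rewrite mulrN sinN mulrN mulNr.
  have E2 : (Is b + Is (- b)%R = 2%:E)%E.
    rewrite /Is -ge0_integralD//.
    - under eq_integral do rewrite -EFinD mulNr.
      transitivity (\int[N]_y (2%:E : \bar R))%E.
        by apply: eq_integral => y _; congr (_%:E); ring.
      exact: integral_prob_cst.
    - by move=> y _; rewrite lee_fin sinb0.
    - exact: (mcont _ (csin b)).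
    - by move=> y _; rewrite lee_fin sinb0// normrN.
    - exact: (mcont _ (csin (- b))).
  have I0 : (0 <= Is b)%E.
    by apply: integral_ge0 => y _; rewrite lee_fin sinb0.
  move: E2; rewrite -E1; case: (Is b) I0 => [z| |] // _ [].
  by move=> z2; congr (_%:E); lra.
have m4 : measurable_fun setT (fun y : R => ((y / (2 * r)) ^+ 4)%:E).
  by apply/measurable_EFinP; apply: measurable_funX; exact: measurable_funM.
have m2 : measurable_fun setT (fun y : R => (cos (a * x) * a ^+ 2 / 2 * y ^+ 2)%:E).
  by apply/measurable_EFinP; apply: measurable_funM => //; exact: measurable_funX.
have mp : measurable_fun setT (fun y : R => (psi r (x + y))%:E).
  apply/measurable_EFinP; apply: (measurableT_comp mpsi).
  exact: measurable_funD.
have p4 y : 0 <= (y / (2 * r)) ^+ 4 by rewrite (exprM _ 2 2) sqr_ge0.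
have p2 y : 0 <= cos (a * x) * a ^+ 2 / 2 * y ^+ 2.
  by rewrite mulr_ge0 ?sqr_ge0// divr_ge0// mulr_ge0// sqr_ge0.
have I4 : (\int[N]_y ((y / (2 * r)) ^+ 4)%:E <= (4 * s ^+ 4 / r ^+ 4)%:E)%E.
  have -> : (\int[N]_y ((y / (2 * r)) ^+ 4)%:E =
             ((2 * r) ^- 4)%:E * \int[N]_y (y ^+ 4)%:E)%E.
    rewrite -ge0_integralZl//.
    - by apply: eq_integral => y _; rewrite -EFinM expr_div_n mulrC.
    - by apply/measurable_EFinP; exact: measurable_funX.
    - by move=> y _; rewrite lee_fin (exprM _ 2 2) sqr_ge0.
    - by rewrite lee_fin invr_ge0 exprn_ge0// mulr_ge0// ltW.
  apply: le_trans (lee_wpmul2l _ (normal_moment4 s0)) _.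
    by rewrite lee_fin invr_ge0 exprn_ge0// mulr_ge0// ltW.
  rewrite -EFinM lee_fin le_eqVlt; apply/orP; left; apply/eqP.
  by field; rewrite gt_eqF.
(* The constant 12 is 6 / 2 times 2 ^ 2, an upper bound of (pi / 2) ^ 2. *)
have I2 : (\int[N]_y (cos (a * x) * a ^+ 2 / 2 * y ^+ 2)%:E <=
           (12 * s ^+ 2 / r ^+ 2 * cos (a * x))%:E)%E.
  under eq_integral do rewrite EFinM.
  rewrite ge0_integralZl//; last 3 first.
  - by apply/measurable_EFinP; exact: measurable_funX.
  - by move=> y _; rewrite lee_fin sqr_ge0.
  - by rewrite lee_fin divr_ge0// mulr_ge0// sqr_ge0.
  apply: le_trans (lee_wpmul2l _ (normal_moment2 s0)) _.
    by rewrite lee_fin divr_ge0// mulr_ge0// sqr_ge0.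
  rewrite -EFinM lee_fin.
  have -> : cos (a * x) * a ^+ 2 / 2 * (6 * s ^+ 2) =
    (pi / 2) ^+ 2 * (3 * s ^+ 2 / r ^+ 2 * cos (a * x)).
    by rewrite /a; field; rewrite gt_eqF.
  have -> : 12 * s ^+ 2 / r ^+ 2 * cos (a * x) = 2 ^+ 2 * (3 * s ^+ 2 / r ^+ 2 * cos (a * x)).
    by ring.
  have s2 := sqr_ge0 s; have r2 := sqr_ge0 r.
  apply: ler_wpM2r; first by rewrite mulr_ge0// divr_ge0// mulr_ge0.
  by rewrite lerXn2r ?nnegrE ?divr_ge0 ?pi_ge0 ?ltW// pihalf_lt2.
pose F y := (psi r (x + y) + (y / (2 * r)) ^+ 4 + cos (a * x) * a ^+ 2 / 2 * y ^+ 2 +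
   (1 + b * sin (a * y)))%:E.
have : ((cos (a * x) + 1)%:E <= \int[N]_y F y)%E.
  apply: (@le_trans _ _ (\int[N]_y (cos (a * x) + 1)%:E)%E).
    by rewrite [leRHS]integral_prob_cst.
  apply: ge0_le_integral_nomeas => y _; first by rewrite lee_fin addr_ge0.
  rewrite lee_fin; have := psi_cos y r0 xr; rewrite -/a mulrDr cosD -/b.
  have := ler_wpM2l c0 (cos_ge1Bsqr (a * y)); rewrite exprMn.
  set A := cos (a * y); set B := sin (a * y).
  rewrite mulrBr mulr1 => H1 H2; lra.
have -> : (\int[N]_y F y = \int[N]_y (psi r (x + y))%:E + \int[N]_y ((y / (2 * r)) ^+ 4)%:E +
   \int[N]_y (cos (a * x) * a ^+ 2 / 2 * y ^+ 2)%:E + 1)%E.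
  rewrite -IsE /Is -!ge0_integralD//.
  all: try exact: (mcont _ (csin b)).
  all: try exact: mp; try exact: m4; try exact: m2.
  all: try exact: (emeasurable_funD (emeasurable_funD mp m4) m2).
  all: try exact: (emeasurable_funD mp m4).
  all: try by move=> y _; rewrite -?EFinD lee_fin ?sinb0// ?addr_ge0 ?psi_ge0.
rewrite psixE.
have Ip0 : (0 <= \int[N]_y (psi r (x + y))%:E)%E.
  by apply: integral_ge0 => y _; rewrite lee_fin psi_ge0.
case: (\int[N]_y (psi r (x + y))%:E)%E Ip0 => [z| |] //; last by move=> *; rewrite leey.
move=> _ H; have {H} := le_trans H (leeD (leeD (leeD (lexx _) I4) I2) (lexx _)).
by rewrite -!EFinD !lee_fin; lra.
Qed.

End gauss.

(** * Brownian motion stays in a box *)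

Section rv_measurability.
Context dT (T : measurableType dT) (R : realType) (n : nat).

Lemma measurable_rvD (f g : T -> 'rV[R]_n) : measurable_fun setT f ->
  measurable_fun setT g -> measurable_fun setT (fun x => f x + g x).
Proof.
move=> mf mg; apply: measurable_fun_rvP => i.
under eq_fun do rewrite mxE.
by apply: measurable_funD; exact: (measurableT_comp (measurable_coord_rv i)).
Qed.

Lemma measurable_rvN (f : T -> 'rV[R]_n) : measurable_fun setT f ->
  measurable_fun setT (fun x => - f x).
Proof.
move=> mf; apply: measurable_fun_rvP => i.
under eq_fun do rewrite mxE.
apply: measurableT_comp => //; exact: (measurableT_comp (measurable_coord_rv i)).
Qed.

End rv_measurability.

Section prod_lower.
Variable R : realType.

(** As all factors lie between 0 and 1, the errors [v] accumulate at most linearly. *)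
Lemma prod_lower_bound (I : Type) (s : seq I) (e a : I -> R) (q v : R) :
  0 <= q <= 1 -> 0 <= v ->
  (forall i, 0 <= e i <= 1) -> (forall i, 0 <= a i <= 1) ->
  (forall i, q * a i - v <= e i) ->
  q ^+ size s * \prod_(i <- s) a i - (size s)%:R * v <= \prod_(i <- s) e i.
Proof.
move=> /andP[q0 q1] v0 e01 a01 H; elim: s => [|i s IH].
  by rewrite !big_nil/= expr0 mul0r subr0 mul1r.
rewrite !big_cons /= exprS -natr1.
have A0 : 0 <= \prod_(j <- s) a j by apply: prodr_ge0 => j _; case/andP: (a01 j).
have A1 : \prod_(j <- s) a j <= 1.
  by apply: prodr_ile1 => j _; exact: a01.
have E0 : 0 <= \prod_(j <- s) e j by apply: prodr_ge0 => j _; case/andP: (e01 j).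
have Q0 : 0 <= q ^+ size s by exact: exprn_ge0.
have Q1 : q ^+ size s <= 1 by exact: exprn_ile1.
have N0 : 0 <= (size s)%:R :> R by [].
have := H i; have /andP[ei0 ei1] := e01 i; have /andP[ai0 ai1] := a01 i.
move: IH A0 A1 E0 Q0 Q1 N0.
move: (\prod_(j <- s) a j) (\prod_(j <- s) e j) (q ^+ size s) ((size s)%:R : R) (e i) (a i) ei0 ei1 ai0 ai1.
move=> A E Q N e1 a1 ei0 ei1 ai0 ai1 IH A0 A1 E0 Q0 Q1 N0 Hi.
have QA0 : 0 <= Q * A by rewrite mulr_ge0.
have QA1 : Q * A <= 1 by rewrite mulr_ile1.
have Nv : 0 <= N * v by rewrite mulr_ge0.
have -> : q * Q * (a1 * A) - (N + 1) * v = (q * a1) * (Q * A) - N * v - v by ring.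
have qa0 : 0 <= q * a1 by rewrite mulr_ge0.
have qa1 : q * a1 <= 1 by rewrite mulr_ile1.
have [le0|gt0] := leP (Q * A - N * v) 0.
  apply: (@le_trans _ _ 0); last by rewrite mulr_ge0.
  have : (q * a1) * (Q * A) <= (q * a1) * (N * v) by rewrite ler_wpM2l// -subr_le0.
  have : (q * a1) * (N * v) <= N * v by rewrite ler_piMl.
  lra.
apply: le_trans (ler_wpM2l ei0 IH).
have : (q * a1 - v) * (Q * A) <= e1 * (Q * A) by rewrite ler_wpM2r.
have : e1 * (N * v) <= N * v by rewrite ler_piMl.
have : v * (Q * A) <= v by rewrite ler_piMr.
lra.
Qed.

End prod_lower.

Section brownian.
Context dW (W : measurableType dW) (R : realType) (Q : probability W R).
Variables (d : nat) (x : 'rV[R]_d) (B : R -> W -> 'rV[R]_d).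
Hypothesis BM : brownian_motion Q x B.
Implicit Types (s t r : R).

Lemma bm_measurable t : 0 <= t -> measurable_fun setT (B t).
Proof. by case: BM => -[H _] _ _ _; exact: H. Qed.

Lemma bm_measurable_incr s t : 0 <= s -> 0 <= t ->
  measurable_fun setT (fun w => B t w - B s w).
Proof.
by move=> s0 t0; apply: measurable_rvD; last apply: measurable_rvN; exact: bm_measurable.
Qed.

Lemma bm_incr_law s t i (A : set R) : 0 <= s < t -> measurable A ->
  Q [set w | A ((B t w - B s w) ord0 i)] = normal_prob 0 (Num.sqrt (t - s)) A.
Proof.
move=> st mA; case: BM => _ _ /(_ s t (fun j => if j == i then A else setT) st) H _.
have -> : [set w | A ((B t w - B s w) ord0 i)] =
    [set w | forall j, (if j == i then A else setT) ((B t w - B s w) ord0 j)].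
  apply/seteqP; split => w /= => [Aw j|/(_ i)]; last by rewrite eqxx.
  by case: eqP => // ->.
rewrite H => [|j]; last by case: ifP.
rewrite (bigD1 i)//= eqxx big1 ?mule1// => j /negbTE ->.
exact: probability_setT.
Qed.

Lemma bm_incr_coord_indep s t : 0 <= s < t ->
  mutually_independent Q (fun (i : 'I_d) w => (B t w - B s w) ord0 i).
Proof.
move=> st S A uS mA.
case: BM => _ _ /(_ s t (fun j => if j \in S then A j else setT) st) H _.
have -> : \bigcap_(i in [set` S]) ((fun w => (B t w - B s w) ord0 i) @^-1` A i) =
    [set w | forall j, (if j \in S then A j else setT) ((B t w - B s w) ord0 j)].
  apply/seteqP; split => w /= H' j; last by move=> jS; have := H' j; rewrite jS.
  by case: ifPn => // jS; exact: H'.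
rewrite H => [|j]; last by case: ifP.
rewrite (bigID (mem S))/= [X in (_ * X)%E]big1 ?mule1; last first.
  by move=> j /negbTE ->; exact: probability_setT.
by rewrite [RHS]big_uniq//=; apply: eq_bigr => i iS; rewrite iS; apply/esym/bm_incr_law.
Qed.

Lemma bm_incr_prod s t (f : 'I_d -> R -> R) : 0 <= s < t ->
  (forall i, measurable_fun setT (f i)) -> (forall i y, 0 <= f i y) ->
  (\int[Q]_w (\prod_i f i ((B t w - B s w) ord0 i))%:E =
   \prod_i \int[normal_prob 0 (Num.sqrt (t - s))]_y (f i y)%:E)%E.
Proof.
move=> st mf f0.
have /andP[s0 /ltW t0] := st; have {}t0 := le_trans s0 t0.
have mX i : measurable_fun setT (fun w => (B t w - B s w) ord0 i).
  exact: (measurableT_comp (measurable_coord_rv i) (bm_measurable_incr s0 t0)).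
rewrite (integral_prod_indep mX (bm_incr_coord_indep st))//; last exact: index_enum_uniq.
apply: eq_bigr => i _.
have HL A : measurable A -> Q ((fun w => (B t w - B s w) ord0 i) @^-1` A) =
    normal_prob 0 (Num.sqrt (t - s)) A.
  by move=> mA; exact: bm_incr_law.
apply: (@ge0_integral_transfer _ _ _ _ R Q (normal_prob 0 (Num.sqrt (t - s)))
  _ (mX i) HL (fun y => (f i y)%:E)) => //.
  by apply/measurable_EFinP; exact: mf.
by move=> y; rewrite lee_fin.
Qed.

Lemma bm_incr_indep (T : nat -> R) : 0 <= T 0%N -> (forall k, T k <= T k.+1) ->
  mutually_independent Q (fun k w => B (T k.+1) w - B (T k) w).
Proof.
move=> T0 Tm S A uS mA; case: BM => _ _ _ H.
pose n := (\max_(k <- S) k).+1.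
have Sn k : k \in S -> (k < n)%N.
  by move=> kS; rewrite ltnS; exact: leq_bigmax_seq.
have := H n T T0 Tm (map inord S) (fun k => A k).
have val_in k : k \in S -> (inord k : 'I_n) = k :> nat.
  by move=> kS; rewrite inordK// Sn.
rewrite map_inj_in_uniq => [|j k jS kS /(congr1 val)/=]; last by rewrite !val_in.
move=> /(_ uS (fun k => mA k)) HQ.
transitivity (\prod_(k <- map (inord : nat -> 'I_n) S)
    Q ((fun w => B (T k.+1) w - B (T k) w)%R @^-1` A k))%E; last first.
  by rewrite big_map; apply: eq_big_seq => k kS; rewrite val_in.
rewrite -HQ; congr (Q _); apply/seteqP; split => w /= Hw k.
  by move=> /mapP[j jS ->]; rewrite val_in//; exact: Hw.
by move=> kS; have := Hw (inord k); rewrite val_in//; apply; apply: map_f.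
Qed.

Definition Psi r (z : 'rV[R]_d) : R := \prod_i psi r (z ord0 i).

Lemma measurable_Psi r : measurable_fun setT (Psi r).
Proof.
apply: measurable_prod => i _.
exact: (measurableT_comp (@measurable_psi R r) (measurable_coord_rv i)).
Qed.

Lemma Psi_ge0 r z : 0 < r -> 0 <= Psi r z.
Proof. by move=> r0; apply: prodr_ge0 => i _; exact: psi_ge0. Qed.

Lemma Psi_le1 r z : 0 < r -> Psi r z <= 1.
Proof. by move=> r0; apply: prodr_ile1 => i _; rewrite psi_ge0// psi_le1. Qed.

Lemma Psi_out r z : Psi r z != 0 -> forall i, `|z ord0 i| < r.
Proof.
move=> H i; apply: contra_neqT H => zr.
by rewrite /Psi (bigD1 i)//= {1}/psi (negbTE zr) mul0r.
Qed.

(** The coordinates of an increment are independent, so the product form of [Psi]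
    reduces the step to dimension one. *)
Lemma bm_Psi_step r s t z : 0 < r -> 0 <= s < t -> 12 * (t - s) / r ^+ 2 <= 1 ->
  (((1 - 12 * (t - s) / r ^+ 2) ^+ d * Psi r z)%:E <=
   \int[Q]_w (Psi r (z + (B t w - B s w)))%:E +
     (d%:R * (4 * (t - s) ^+ 2 / r ^+ 4))%:E)%E.
Proof.
move=> r0 st h1; have /andP[s0 ts] := st.
have h0 : 0 < t - s by rewrite subr_gt0.
pose sg := Num.sqrt (t - s).
have sg0 : 0 < sg by rewrite sqrtr_gt0.
have sg2 : sg ^+ 2 = t - s by rewrite sqr_sqrtr// ltW.
have sg4 : sg ^+ 4 = (t - s) ^+ 2 by rewrite (exprM _ 2 2) sg2.
have mf i : measurable_fun setT (fun y => psi r (z ord0 i + y)).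
  apply: measurableT_comp; first exact: measurable_psi.
  exact: measurable_funD.
have E : (\int[Q]_w (Psi r (z + (B t w - B s w)))%:E =
   \prod_i \int[normal_prob 0 sg]_y (psi r (z ord0 i + y))%:E)%E.
  rewrite -(@bm_incr_prod s t (fun i y => psi r (z ord0 i + y)))//.
    apply: eq_integral => w _; congr (_%:E); apply: eq_bigr => i _.
    by rewrite mxE.
  by move=> i y; exact: psi_ge0.
pose e i := fine (\int[normal_prob 0 sg]_y (psi r (z ord0 i + y))%:E).
have I01 i : (0 <= \int[normal_prob 0 sg]_y (psi r (z ord0 i + y))%:E <= 1)%E.
  rewrite integral_ge0/=; last by move=> y _; rewrite lee_fin psi_ge0.
  apply: (@le_trans _ _ (\int[normal_prob 0 sg]_y (1%:E))%E).
    by apply: ge0_le_integral_nomeas => y _; rewrite lee_fin ?psi_ge0 ?psi_le1.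
  by rewrite [leLHS]integral_prob_cst.
have Ie i : (\int[normal_prob 0 sg]_y (psi r (z ord0 i + y))%:E = (e i)%:E)%E.
  rewrite fineK// ge0_fin_numE; last by case/andP: (I01 i).
  by case/andP: (I01 i) => _ /le_lt_trans -> //; rewrite ltry.
rewrite E (eq_bigr (fun i => (e i)%:E)) => [|i _]; last exact: Ie.
rewrite prodEFin -EFinD lee_fin -lerBlDr.
have := @prod_lower_bound R 'I_d (index_enum 'I_d) e (fun i => psi r (z ord0 i))
  (1 - 12 * (t - s) / r ^+ 2) (4 * (t - s) ^+ 2 / r ^+ 4).
have -> : size (index_enum 'I_d) = d by rewrite -[RHS]card_ord cardT enumT.
apply.
- by rewrite subr_ge0 h1/= gerBl divr_ge0 ?sqr_ge0// mulr_ge0// ltW.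
- apply: divr_ge0; first by rewrite mulr_ge0// sqr_ge0.
  by rewrite (exprM _ 2 2) sqr_ge0.
- by move=> i; have := I01 i; rewrite Ie !lee_fin.
- by move=> i; rewrite psi_ge0// psi_le1.
- move=> i; have := @normal_psi R r sg (z ord0 i) r0 sg0.
  by rewrite Ie lee_fin sg2 sg4.
Qed.

Lemma bm_measurable_grid n h r : 0 <= h ->
  measurable [set w | forall k, (k <= n)%N -> forall i, `|B (k%:R * h) w ord0 i| <= r].
Proof.
move=> h0; set A := [set w | _].
have -> : A = \bigcap_(k in `I_n.+1) \bigcap_(i in [set: 'I_d])
    [set w | `|B (k%:R * h) w ord0 i| <= r].
  by apply/seteqP; split => w Hw k kn; [move=> i _; exact: Hw|move=> i; exact: Hw].
apply: fin_bigcap_measurable => [|k _]; first exact: finite_II.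
apply: fin_bigcap_measurable => // i _.
have mB : measurable_fun setT (fun w => `|B (k%:R * h) w ord0 i|).
  apply: measurableT_comp; first exact: normr_measurable.
  apply: (measurableT_comp (measurable_coord_rv i)); apply: bm_measurable.
  exact: mulr_ge0.
rewrite -[X in measurable X]setTI.
by have := mB measurableT `]-oo, r]%classic (measurable_itv _); rewrite set_itvE.
Qed.

Section walk.
Variables (h r : R).
Hypotheses (h0 : 0 < h) (r0 : 0 < r) (hr : 12 * h / r ^+ 2 <= 1).

Let T (k : nat) : R := k%:R * h.
Let D (k : nat) w : 'rV[R]_d := B (T k.+1) w - B (T k) w.

Let T0 : 0 <= T 0%N. Proof. by rewrite /T mul0r. Qed.
Let T_ge0 k : 0 <= T k. Proof. by rewrite mulr_ge0// ltW. Qed.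
Let Tm k : T k <= T k.+1. Proof. by rewrite ler_wpM2r ?ltW// ltr_nat. Qed.
Let TS k : T k.+1 - T k = h. Proof. by rewrite /T -natr1; ring. Qed.

Let indD : mutually_independent Q D := bm_incr_indep T0 Tm.
Let mD k : measurable_fun setT (D k).
Proof. exact: bm_measurable_incr. Qed.

(** The motion on the grid of mesh [h], written with its increments from the
    deterministic starting point [x], so that it depends on these only. *)
Let S (k : nat) w : 'rV[R]_d := x + \sum_(j < k) D j w.

Let inb (z : 'rV[R]_d) : R := \prod_(i < d) (`|z ord0 i| < r)%R%:R.
Let stay (k : nat) w : R := \prod_(j < k) inb (S j.+1 w).

Let inb01 z : 0 <= inb z <= 1.
Proof.
by rewrite prodr_ge0//= prodr_ile1// => i _; case: (_ < _); rewrite ?ler01 ?lexx.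
Qed.

Let stay01 k w : 0 <= stay k w <= 1.
Proof.
apply/andP; split; last by apply: prodr_ile1 => i _; exact: inb01.
by apply: prodr_ge0 => i _; case/andP: (inb01 (S i.+1 w)).
Qed.

Let measurable_inb : measurable_fun setT inb.
Proof.
apply: measurable_prod => i _.
apply: (@measurableT_comp _ _ _ _ _ _ (fun b : bool => (b%:R : R)%R)) => //.
apply: measurable_fun_ltr; last exact: measurable_cst.
apply: measurableT_comp; first exact: normr_measurable.
exact: measurable_coord_rv.
Qed.

Let past_S k j : (j <= k)%N ->
  measurable_fun setT (S j : g_sigma_algebraType (past D (iota 0 k)) -> 'rV[R]_d).
Proof.
move=> jk; apply: measurable_fun_rvP => i.
rewrite /S; under eq_fun do rewrite mxE summxE.
apply: measurable_funD; first exact: measurable_cst.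
apply: measurable_sum => j'.
apply: (measurableT_comp (measurable_coord_rv i)).
by apply: measurable_past_coord; rewrite mem_iota /= add0n (leq_trans _ jk).
Qed.

Let past_stay k :
  measurable_fun setT (stay k : g_sigma_algebraType (past D (iota 0 k)) -> R).
Proof.
apply: measurable_prod => j _; apply: measurableT_comp; first exact: measurable_inb.
exact: past_S.
Qed.

(** [Psi] vanishes outside of the box, so that the indicator of the box at the
    current step may be dropped in front of it. *)
Let inbPsi z : inb z * Psi r z = Psi r z.
Proof.
have [->|] := eqVneq (Psi r z) 0; first by rewrite mulr0.
move=> /Psi_out zr; rewrite /inb big1 ?mul1r// => i _.
by rewrite zr.
Qed.

Let E k := (\int[Q]_w (stay k w * Psi r (S k w))%:E)%E.

(** Given the first [k] increments, the next one is a Gaussian step from [S k]. *)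
Let E_step k : (((1 - 12 * h / r ^+ 2) ^+ d)%:E * E k <=
   E k.+1 + (d%:R * (4 * h ^+ 2 / r ^+ 4))%:E)%E.
Proof.
set q := (1 - _) ^+ d; set v := d%:R * _.
have q0 : 0 <= q by rewrite exprn_ge0// subr_ge0.
have v0 : 0 <= v.
  rewrite mulr_ge0// divr_ge0//; first by rewrite mulr_ge0// sqr_ge0.
  by rewrite (exprM _ 2 2) sqr_ge0.
have stP j w : 0 <= stay j w * Psi r (S j w).
  by rewrite mulr_ge0 ?Psi_ge0//; case/andP: (stay01 j w).
have mst k' : measurable_fun setT (fun w => (stay k' w * Psi r (S k' w))%:E).
  apply/measurable_EFinP; apply: measurable_funM.
    exact: measurable_past_fun (@past_stay k').
  apply: (measurableT_comp (measurable_Psi r)).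
  exact: measurable_past_fun (@past_S k' k' (leqnn _)).
pose F (z : (R * 'rV[R]_d) * 'rV[R]_d) := (`|z.1.1| * Psi r (z.1.2 + z.2))%:E.
have mF : measurable_fun setT F.
  apply/measurable_EFinP; apply: measurable_funM.
    apply: measurableT_comp; first exact: normr_measurable.
    exact: (measurableT_comp measurable_fst measurable_fst).
  apply: (measurableT_comp (measurable_Psi r)); apply: measurable_rvD => //.
  exact: (measurableT_comp measurable_snd measurable_fst).
have F0 z : (0 <= F z)%E by rewrite lee_fin mulr_ge0// Psi_ge0.
pose Y (w : g_sigma_algebraType (past D (iota 0 k))) := (stay k w, S k w).
have mY : measurable_fun setT Y.
  by apply: measurable_fun_pair; [exact: past_stay|exact: past_S].
(* Without the indicator at step k.+1, the integrand is the weight stay k of the past,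
   times Psi after one more step. *)
have -> : E k.+1 = (\int[Q]_w F (Y w, D k w))%E.
  apply: eq_integral => w _; rewrite /F/= ger0_norm; last by case/andP: (stay01 k w).
  congr (_%:E); rewrite /stay big_ord_recr/= -mulrA inbPsi.
  by congr (_ * Psi r _); rewrite /S big_ord_recr/= addrA.
rewrite (past_fubini mD indD _ mY mF F0); last by rewrite /= mem_iota ltnn andbF iota_uniq.
rewrite /E -ge0_integralZl//; last first.
  by move=> w _; rewrite lee_fin.
rewrite -[X in (_ + X)%E](integral_prob_cst Q) -ge0_integralD//; last 2 first.
- by move=> w _; exact: integral_ge0.
- apply: (@measurable_fun_fubini_tonelli_F _ _ W W R Q (fun z => F (Y z.1, D k z.2))) => //.
  apply: (measurableT_comp mF); apply: measurable_fun_pair.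
    exact: (measurableT_comp (measurable_past_fun mD mY) measurable_fst).
  exact: (measurableT_comp (mD k) measurable_snd).
apply: ge0_le_integral_nomeas => w _; first by rewrite mule_ge0 ?lee_fin.
have := @bm_Psi_step r (T k) (T k.+1) (S k w) r0 _ _.
rewrite TS T_ge0/= -subr_gt0 TS => /(_ h0 hr) H.
have [st0 st1] := andP (stay01 k w).
rewrite /F/=; under eq_integral do rewrite ger0_norm// EFinM.
rewrite ge0_integralZl//; last 2 first.
- apply/measurable_EFinP; apply: (measurableT_comp (measurable_Psi r)).
  exact: measurable_rvD.
- by move=> w' _; rewrite lee_fin Psi_ge0.
apply: (@le_trans _ _ ((stay k w)%:E * (q * Psi r (S k w))%:E)%E).
  by rewrite -!EFinM lee_fin mulrCA.
apply: le_trans (lee_wpmul2l _ H) _; first by rewrite lee_fin.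
rewrite ge0_muleDr//; last by apply: integral_ge0 => w' _; rewrite lee_fin Psi_ge0.
by apply: leeD => //; rewrite -EFinM lee_fin ler_piMl.
Qed.

(** [E n] is at most the probability of remaining in the box, since [Psi] is at most
    1; iterating [E_step] bounds it from below by the initial value [Psi r x]. *)
Lemma bm_walk n : (forall i, `|x ord0 i| < r) ->
  ((((1 - 12 * h / r ^+ 2) ^+ d) ^+ n * Psi r x -
      n%:R * (d%:R * (4 * h ^+ 2 / r ^+ 4)))%:E <=
  Q [set w | forall k, (k <= n)%N -> forall i, (`|(B (k%:R * h)%R w) ord0 i| <= r)%R])%E.
Proof.
move=> xr; set q := (1 - _) ^+ d; set v := d%:R * _; set A := [set w | _].
have q01 : 0 <= q <= 1.
  have u0 : 0 <= 12 * h / r ^+ 2 by rewrite divr_ge0 ?sqr_ge0// mulr_ge0// ltW.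
  by rewrite exprn_ge0/= ?exprn_ile1 ?subr_ge0// gerBl.
have [q0 q1] := andP q01.
have v0 : 0 <= v.
  rewrite mulr_ge0// divr_ge0//; first by rewrite mulr_ge0// sqr_ge0.
  by rewrite (exprM _ 2 2) sqr_ge0.
have En k : ((q ^+ k * Psi r x)%:E <= E k + (k%:R * v)%:E)%E.
  elim: k => [|k IH].
    rewrite expr0 mul1r mul0r adde0 /E -[leLHS](integral_prob_cst Q).
    apply: ge0_le_integral_nomeas => w _; first by rewrite lee_fin Psi_ge0.
    by rewrite lee_fin /stay /S !big_ord0 mul1r addr0.
  rewrite exprS -mulrA EFinM.
  apply: le_trans (lee_wpmul2l _ IH) _; first by rewrite lee_fin.
  have Ek0 : (0 <= E k)%E.
    apply: integral_ge0 => w _; rewrite lee_fin mulr_ge0 ?Psi_ge0//.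
    by case/andP: (stay01 k w).
  rewrite ge0_muleDr//; last by rewrite lee_fin mulr_ge0.
  apply: le_trans (leeD (E_step k) (lexx _)) _.
  rewrite -/v -addeA leeD2l// -EFinM -EFinD lee_fin -natr1 mulrDl mul1r addrC lerD2r.
  by rewrite ler_piMl// mulr_ge0.
rewrite EFinB leeBlDr//; apply: le_trans (En n) _; rewrite leeD2r//.
(* The walk is the motion only where B 0 is x, hence the null set. *)
have [N0 [mN0 QN0 HN0]] : Q.-negligible (~` [set w | B 0 w = x]).
  by case: BM => _ [N [mN QN HN]] _ _; exists N; split.
have mA : measurable A by apply: bm_measurable_grid; exact: ltW.
apply: (@le_trans _ _ (Q (A `|` N0))); last first.
  by apply: le_trans (measureU2 _ mA mN0) _; rewrite [X in (_ + X)%E]QN0 adde0.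
have mAN : measurable (A `|` N0) by exact: measurableU.
rewrite -[X in (_ <= Q X)%E]setIT -integral_indic//.
apply: ge0_le_integral_nomeas => w _.
  by rewrite lee_fin mulr_ge0 ?Psi_ge0//; case/andP: (stay01 n w).
rewrite lee_fin indicE; have [_|wAN] := boolP (w \in A `|` N0).
  by rewrite mulr_ile1 ?Psi_ge0 ?Psi_le1//; case/andP: (stay01 n w).
rewrite (_ : stay n w = 0) ?mul0r//; apply/eqP; apply: contraNT wAN => st0.
rewrite inE; have [Bx|Bx] := pselect (B 0 w = x); [left|by right; exact: HN0].
have SB k : S k w = B (T k) w.
  elim: k => [|k IH]; first by rewrite /S big_ord0 addr0 /T mul0r Bx.
  by rewrite /S big_ord_recr/= addrA -/(S k w) IH /D addrC subrK.
case=> [_ i|k kn i]; first by rewrite mul0r Bx ltW.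
have : inb (S k.+1 w) != 0.
  by move/prodf_neq0 : st0 => /(_ (Ordinal kn)); exact.
rewrite SB => /prodf_neq0/(_ i isT).
by case: (ltP `|_| r) => [/ltW|]; rewrite ?eqxx.
Qed.

End walk.

Let expR_1B (u : R) : 0 <= u <= 1 / 2 -> expR (- (2 * u)) <= 1 - u.
Proof.
move=> /andP[u0 u1].
have e0 : 0 < 1 + 2 * u by lra.
rewrite expRN -[leRHS]invrK lef_pV2 ?posrE ?invr_gt0 ?expR_gt0//; last by lra.
apply: le_trans (expR_ge1Dx (2 * u)).
rewrite -[leRHS]invrK lef_pV2 ?posrE ?invr_gt0//; last by lra.
rewrite -[leLHS]mul1r ler_pdivrMr//; nra.
Qed.

Lemma bm_coord_continuous w i (s e : R) : 0 <= s -> 0 < e ->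
  exists2 del : R, 0 < del &
    forall s', 0 <= s' -> `|s - s'| < del -> `|B s w ord0 i - B s' w ord0 i| < e.
Proof.
move=> s0 e0; case: BM => -[_ cB] _ _ _.
have /subspace_continuousP /(_ s) := cB w.
rewrite /= in_itv/= andbT => /(_ s0) H.
have F1 : Filter (within `[0, +oo[ (nbhs s)) by exact: within_filter.
have Hi : (fun s' => B s' w ord0 i) @ within `[0, +oo[ (nbhs s) --> B s w ord0 i.
  exact: (cvg_comp _ _ H (@coord_continuous _ 1 d ord0 i (B s w))).
move: Hi => /cvgrPdist_lt /(_ e e0); rewrite near_withinE.
move=> /nbhs_ballP[del /= del0 He].
exists del => // s' s'0 ss'; apply: (He s') => //=.
by rewrite in_itv/= s'0.
Qed.

(** By continuity of the paths, the event is the decreasing limit of its analogues on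
    the grids of mesh [h = t / 2^m]. In [bm_walk], the sum of the errors is of order
    [t h] and vanishes, while [(1 - 12 h / r^2)^(d t / h)] is bounded below by the
    exponential, because [1 - v >= exp (- 2 v)] for small [v]. *)
Lemma bm_stay_box t r : 0 < t -> 0 < r -> (forall i, `|x ord0 i| < r) ->
  let stay := [set w | forall s, 0 <= s <= t -> forall i, `|B s w ord0 i| <= r] in
  measurable stay /\
  ((expR (- (24 * d%:R * t / r ^+ 2)) * Psi r x)%:E <= Q stay)%E.
Proof.
move=> t0 r0 xr stay.
pose h (m : nat) := t / (2 ^ m)%:R.
have p0 m : 0 < (2 ^ m)%:R :> R by rewrite ltr0n expn_gt0.
have h0 m : 0 < h m by rewrite divr_gt0.
pose A (m : nat) := [set w | forall k, (k <= 2 ^ m)%N ->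
  forall i, `|B (k%:R * h m) w ord0 i| <= r].
have mA m : measurable (A m) by apply: bm_measurable_grid; exact: ltW.
have capA : \bigcap_m A m = stay.
  apply/seteqP; split => w Aw; last first.
    move=> m _ k km i; apply: Aw; rewrite mulr_ge0 ?(ltW (h0 m))//=.
    by rewrite /h mulrCA ler_piMr ?(ltW t0)// ler_pdivrMr// mul1r ler_nat.
  move=> s /andP[s0 st] i; rewrite leNgt; apply/negP => rB.
  have rB' : 0 < `|B s w ord0 i| - r by rewrite subr_gt0.
  have [e e0 He'] := bm_coord_continuous w i s0 rB'.
  have {He'} He s' : 0 <= s' -> `|s - s'| < e -> r < `|B s' w ord0 i|.
    move=> s'0 /(He' _ s'0); have := lerB_dist (B s w ord0 i) (B s' w ord0 i).
    by lra.
  have [m hm] : exists m, h m < e.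
    exists (Num.truncn (t / e)).+1.
    rewrite /h ltr_pdivrMr// mulrC -ltr_pdivrMr//.
    apply: (@lt_trans _ _ (Num.truncn (t / e)).+1%:R).
      by have /andP[] := truncn_itv (ltW (divr_gt0 t0 e0)).
    by rewrite ltr_nat ltn_expl.
  pose k := Num.truncn (s / h m).
  have sh0 : 0 <= s / h m by rewrite divr_ge0// ltW.
  have /andP[k1 k2] := truncn_itv sh0.
  have kh : k%:R * h m <= s by rewrite -ler_pdivlMr.
  have km : (k <= 2 ^ m)%N.
    rewrite -(ler_nat R) (le_trans k1)// ler_pdivrMr// /h mulrCA divff ?mulr1//.
  have kh0 : 0 <= k%:R * h m by rewrite mulr_ge0// ltW.
  have : `|s - k%:R * h m| < e.
    rewrite ger0_norm ?subr_ge0// (lt_trans _ hm)// ltrBlDr.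
    by rewrite -[X in X + _]mul1r -mulrDl -ltr_pdivrMr// addrC natr1.
  by move=> /(He _ kh0); rewrite ltNge (Aw m I k km i).
have ndA : nonincreasing_seq A.
  apply/nonincreasing_seqP => m; apply/subsetPset => w Aw k km i.
  have := Aw (2 * k)%N; rewrite expnS leq_mul2l km orbT => /(_ isT i).
  rewrite (_ : (2 * k)%:R * h m.+1 = k%:R * h m)// /h expnS !natrM.
  by field; rewrite ?gt_eqF.
rewrite -capA; split; first exact: bigcapT_measurable.
have cvgA : Q \o A @ \oo --> Q (\bigcap_m A m).
  apply: nonincreasing_cvg_mu => //.
  - by rewrite (le_lt_trans (probability_le1 _ _)) ?ltry.
  - exact: bigcapT_measurable.
apply/lee_subgt0Pr => e e0; rewrite -(cvg_lim _ cvgA)//.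
apply: lime_ge; first by apply/cvg_ex; eexists; exact: cvgA.
pose C := 4 * d%:R * t ^+ 2 / r ^+ 4.
have C0 : 0 <= C.
  have t2 := sqr_ge0 t; have r4 : 0 <= r ^+ 4 by rewrite exprn_ge0// ltW.
  by rewrite divr_ge0// mulr_ge0// mulr_ge0.
near=> m.
have mp : m%:R <= (2 ^ m)%:R :> R by rewrite ler_nat ltnW// ltn_expl.
have um : 12 * h m / r ^+ 2 <= 1 / 2.
  rewrite /h.
  have -> : 12 * (t / (2 ^ m)%:R) / r ^+ 2 = 24 * t / r ^+ 2 / (2 ^ m)%:R / 2.
    by field; rewrite !gt_eqF.
  rewrite ler_wpM2r// ler_pdivrMr// mul1r (le_trans _ mp)//.
  near: m; exact: nbhs_infty_ger.
have Cm : C / (2 ^ m)%:R <= e.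
  rewrite ler_pdivrMr// mulrC -ler_pdivrMr// (le_trans _ mp)//.
  near: m; exact: nbhs_infty_ger.
apply: le_trans (@bm_walk (h m) r (h0 m) r0 _ (2 ^ m) xr); last by lra.
rewrite -EFinB lee_fin lerB//; last first.
  rewrite (le_trans _ Cm)// le_eqVlt; apply/orP; left; apply/eqP; rewrite /C /h.
  by field; rewrite !gt_eqF.
apply: ler_wpM2r; first exact: Psi_ge0.
rewrite -exprM.
have u0 : 0 <= 12 * h m / r ^+ 2 by rewrite divr_ge0 ?sqr_ge0// mulr_ge0// ltW.
have := @expR_1B (12 * h m / r ^+ 2); rewrite u0 um => /(_ isT) He.
have -> : - (24 * d%:R * t / r ^+ 2) = - (2 * (12 * h m / r ^+ 2)) * (d * 2 ^ m)%:R.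
  by rewrite /h natrM; field; rewrite !gt_eqF.
by rewrite expRM_natr lerXn2r ?nnegrE ?expR_ge0// (le_trans (expR_ge0 _) He).
Unshelve. all: by end_near.
Qed.

End brownian.

Section absolute_continuity.
Context dW (W : measurableType dW) (R : realType) (Q : probability W R).

(** By induction on the dimension: by Fubini's theorem, almost all sections of a null
    set are null, and the other variables avoid the exceptional sections. *)
Lemma indep_abs_continuous n (X : 'I_n -> W -> R) (N : set 'rV[R]_n) :
  (forall i, measurable_fun setT (X i)) ->
  mutually_independent Q X ->
  (forall i (A : set R), measurable A -> lebesgue_measure A = 0%E -> Q (X i @^-1` A) = 0%E) ->
  measurable N -> lebesgue_measure_rv n N = 0%E ->
  Q [set w | N (\row_i X i w)] = 0%E.
Proof.
elim: n X N => [|n IH] X N mX iX aX mN N0.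
  have [->|/set0P[z Nz]] := eqVneq N set0; first by rewrite (_ : [set _ | _] = set0) ?measure0.
  move: N0; rewrite /= /dirac indicE mem_set.
    by move/eqP; rewrite onee_eq0.
  by rewrite (_ : 0 = z)//; apply/rowP; case.
pose s := [seq lift ord0 j | j <- enum 'I_n].
have us : uniq (ord0 :: s).
  rewrite /= map_inj_uniq ?enum_uniq ?andbT//; last exact: lift_inj.
  by apply/mapP => -[j _].
pose Y (w : g_sigma_algebraType (past X s)) := \row_j X (lift ord0 j) w.
have mY : measurable_fun setT Y.
  apply: measurable_fun_rvP => j; rewrite /Y; under eq_fun do rewrite mxE.
  by apply: measurable_past_coord; apply: map_f; rewrite mem_enum.
have mY' := measurable_past_fun mX mY.
pose F (z : 'rV[R]_n * R) := (\1_N (cons_rv (z.2, z.1)))%:E : \bar R.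
have mF : measurable_fun setT F.
  apply/measurable_EFinP; apply: (measurableT_comp (measurable_indic mN)).
  apply: (measurableT_comp (@measurable_cons_rv R n)).
  by apply: measurable_fun_pair; [exact: measurable_snd|exact: measurable_fst].
have F0 z : (0 <= F z)%E by rewrite lee_fin.
have rowE w : \row_i X i w = cons_rv (X ord0 w, Y w).
  rewrite -[LHS]uncons_rvK; congr cons_rv; rewrite /uncons_rv !mxE; congr (_, _).
  by apply/rowP => j; rewrite !mxE; congr (X _ w); exact/val_inj.
have mrow : measurable_fun setT (fun w => \row_i X i w).
  by apply: measurable_fun_rvP => j; under eq_fun do rewrite mxE; exact: mX.
have mE : measurable [set w | N (\row_i X i w)].
  by rewrite -[X in measurable X]setTI; exact: mrow.
transitivity (\int[Q]_w F (Y w, X ord0 w))%E.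
  rewrite -[X in Q X]setIT -integral_indic//; apply: eq_integral => w _.
  by rewrite /F/= -rowE.
rewrite (past_fubini mX iX us mY mF F0).
pose S : set (R * 'rV[R]_n) := @cons_rv R n @^-1` N.
have mS : measurable S.
  by rewrite -[X in measurable X]setTI; exact: measurable_cons_rv.
pose G (y : 'rV[R]_n) := (\int[lebesgue_measure]_x (\1_S (x, y))%:E)%E.
have m1S : measurable_fun setT (fun z : measurableTypeR R * 'rV[R]_n => (\1_S z)%:E : \bar R).
  exact/measurable_EFinP/measurable_indic.
have m1S0 (z : measurableTypeR R * 'rV[R]_n) : (0 <= (\1_S z)%:E :> \bar R)%E.
  by rewrite lee_fin.
have mG : measurable_fun setT G.
  exact: (@measurable_fun_fubini_tonelli_G _ _ (measurableTypeR R) 'rV[R]_n R lebesgue_measure _ m1S m1S0).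
have G0 y : (0 <= G y)%E by apply: integral_ge0 => x _; rewrite lee_fin.
have IG : (\int[lebesgue_measure_rv n]_y G y = 0)%E.
  rewrite -(@fubini_tonelli2 _ _ (measurableTypeR R) 'rV[R]_n R lebesgue_measure (@lebesgue_measure_rv R n) _ m1S m1S0).
  by rewrite integral_indic// setIT.
pose M := [set y | G y != 0%E].
have mM : measurable M.
  rewrite -[X in measurable X]setTI /M.
  have := mG measurableT (~` [set 0%E]) (measurableC (emeasurable_set1 _)).
  by congr (measurable (_ `&` _)); apply/seteqP; split => y /= /eqP.
have M0 : lebesgue_measure_rv n M = 0%E.
  have : (\int[lebesgue_measure_rv n]_y `|G y| = 0)%E.
    by rewrite -[RHS]IG; apply: eq_integral => y _; rewrite gee0_abs.
  move=> /(ae_eq_integral_abs _ measurableT mG)[M' [mM' M'0 MM']].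
  apply/eqP; rewrite eq_le measure_ge0 andbT -[X in (_ <= X)%E]M'0.
  apply: le_measure; rewrite ?inE// => y /= /eqP Gy; apply: MM' => /=.
  by move=> /(_ I).
have QM : Q [set w : W | M (Y w)] = 0%E.
  apply: (IH (fun j => X (lift ord0 j))) => //.
  - move=> s' A us' mA.
    have := iX (map (lift ord0) s') (fun i => if unlift ord0 i is Some j then A j else setT).
    rewrite map_inj_uniq ?us'; last exact: lift_inj.
    move=> /(_ isT) H; transitivity (Q (\bigcap_(i in [set` map (lift ord0) s'])
        (X i @^-1` (if unlift ord0 i is Some j then A j else setT)))).
      congr (Q _); apply/seteqP; split => w /= Hw j.
        by move=> /mapP[j' j's ->]; rewrite liftK; exact: Hw.
      by move=> js; have := Hw (lift ord0 j); rewrite liftK; apply; exact: map_f.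
    rewrite H => [|i]; last by case: unlift.
    by rewrite big_map; apply: eq_bigr => j _; rewrite liftK.
  - by move=> i A; exact: aX.
have mMY : measurable [set w : W | M (Y w)].
  by rewrite -[X in measurable X]setTI; exact: mY'.
apply/eqP; rewrite eq_le integral_ge0 ?andbT; last by move=> w _; exact: integral_ge0.
apply: (@le_trans _ _ (\int[Q]_w (\1_[set w : W | M (Y w)] w)%:E)%E); last first.
  by rewrite integral_indic// setIT; move: QM => /eqP; rewrite eq_le => /andP[].
apply: ge0_le_integral_nomeas => w _; first exact: integral_ge0.
rewrite indicE; have [wM|wM] := boolP (w \in _).
  apply: (@le_trans _ _ (\int[Q]_w' (1%:E))%E); last by rewrite integral_prob_cst.
  apply: ge0_le_integral_nomeas => w' _ //; rewrite lee_fin indicE.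
  by case: (_ \in _).
have Gy : G (Y w) = 0%E.
  by apply/eqP; apply: contraNT wM => H; rewrite inE.
have my : measurable [set x | S (x, Y w)].
  have -> : [set x | S (x, Y w)] = ysection S (Y w).
    by apply/seteqP; split => x /=; rewrite /ysection/= inE.
  exact: measurable_ysection.
have := aX ord0 [set x | S (x, Y w)] my.
have -> : lebesgue_measure [set x | S (x, Y w)] = 0%E.
  rewrite -[RHS]Gy -[X in lebesgue_measure X]setIT -integral_indic//.
move=> /(_ erefl) QX.
rewrite le_eqVlt; apply/orP; left; apply/eqP.
rewrite -[RHS]QX -[X in Q X]setIT -integral_indic//.
by rewrite -[X in measurable X]setTI; exact: mX.
Qed.

End absolute_continuity.

(** * Countable sums, convexity, and moments of the survival probability *)

Section esum_tools.
Local Open Scope ereal_scope.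
Variable R : realType.

Lemma esum_nneseries (I : countType) (a : I -> \bar R) :
  (forall i, 0 <= a i) ->
  \esum_(i in [set: I]) a i = \sum_(n <oo) oapp a 0 (pickle_inv n).
Proof.
move=> a0; rewrite nneseries_esumT; last by move=> n; case: pickle_inv.
rewrite [RHS](_ : _ = \esum_(n in range (@pickle I)) oapp a 0 (pickle_inv n)); last first.
  rewrite [RHS]esum_mkcond; apply: eq_esum => n _; case: ifPn => // nr.
  case E : (pickle_inv n) => [i|] //=; exfalso; move/negP: nr; apply; rewrite inE.
  by exists i => //; have := @pickle_invK I n; rewrite E.
rewrite (@reindex_esum R I nat setT (range (@pickle I)) (@pickle I)).
  by apply: eq_esum => i _; rewrite pickleK_inv.
split => //; by move=> i j _ _; exact: (pcan_inj pickleK_inv).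
Qed.

Lemma measurable_esum dT (T : measurableType dT) (I : countType) (f : I -> T -> \bar R) :
  (forall i x, 0 <= f i x) -> (forall i, measurable_fun setT (f i)) ->
  measurable_fun setT (fun x => \esum_(i in [set: I]) f i x).
Proof.
move=> f0 mf; under eq_fun do rewrite esum_nneseries//.
apply: ge0_emeasurable_sum => [n x _ _|n _]; first by case: pickle_inv => /=.
by case: pickle_inv => [i|] //=.
Qed.

Lemma esum_ge_sum (I : choiceType) (a : I -> \bar R) (s : seq I) : uniq s ->
  (forall i, 0 <= a i) -> \sum_(i <- s) a i <= \esum_(i in [set: I]) a i.
Proof.
move=> us a0; apply: esum_ge; exists [set` s]; first by split; [exact: finite_seq|].
by rewrite fsbig_seq.
Qed.

Lemma esumZl (I : countType) (a : I -> \bar R) (k : R) : (0 <= k)%R ->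
  (forall i, 0 <= a i) ->
  \esum_(i in [set: I]) (k%:E * a i) = k%:E * \esum_(i in [set: I]) a i.
Proof.
move=> k0 a0; rewrite !esum_nneseries// => [|i]; last by rewrite mule_ge0.
rewrite -nneseriesZl//; last by move=> j _; case: pickle_inv.
by apply: eq_eseriesr => j _; case: pickle_inv => //=; rewrite mule0.
Qed.

(** A function of a variable with countably many values is a countable sum of
    multiples of indicators, whatever the structure of its domain. *)
Section discrete.
Context dT (T : measurableType dT) (mu : {measure set T -> \bar R}) (I : countType).
Variables (X : T -> I) (f : I -> \bar R).
Hypothesis mX : forall i, measurable (X @^-1` [set i]).
Hypothesis f0 : forall i, 0 <= f i.

Let term i x : \bar R := f i * (\1_(X @^-1` [set i]) x)%:E.

Let term0 i x : 0 <= term i x. Proof. by rewrite mule_ge0// lee_fin. Qed.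

Let mterm i : measurable_fun setT (term i).
Proof.
by apply: measurable_funeM; apply/measurable_EFinP; exact: measurable_indic.
Qed.

Let discrete_esum x : f (X x) = \esum_(i in [set: I]) term i x.
Proof.
rewrite (esumID [set X x])// setTI esum_set1//.
rewrite /term indicE mem_set// mule1 esum1 ?adde0// => i [_ /= /eqP ix].
by rewrite indicE memNset ?mule0// => /esym/eqP; rewrite (negbTE ix).
Qed.

Lemma measurable_discrete : measurable_fun setT (f \o X).
Proof.
rewrite (_ : _ \o _ = fun x => \esum_(i in [set: I]) term i x).
  exact: measurable_esum.
by apply/funext => x; exact: discrete_esum.
Qed.

Lemma integral_discrete :
  \int[mu]_x f (X x) = \esum_(i in [set: I]) (f i * mu (X @^-1` [set i])).
Proof.
under eq_integral do rewrite discrete_esum esum_nneseries//.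
rewrite integral_nneseries//; last 2 first.
- by move=> k; case: pickle_inv => [i|] //=; exact: mterm.
- by move=> k x _; case: pickle_inv => [i|] //=; exact: term0.
rewrite esum_nneseries => [|i]; last exact: mule_ge0.
apply: eq_eseriesr => k _; case: pickle_inv => [i|] /=; last by rewrite integral0.
have mi : measurable_fun setT (fun x => (\1_(X @^-1` [set i]) x)%:E : \bar R).
  by apply/measurable_EFinP; exact: measurable_indic.
by rewrite ge0_integralZl// integral_indic// setIT.
Qed.

End discrete.

Lemma measurable_fun_fine : measurable_fun [set: \bar R] (@fine R).
Proof.
move=> _ A mA; rewrite setTI.
rewrite (_ : _ @^-1` A = (EFin @` A) `|` (if 0%R \in A then [set +oo; -oo] else set0)).
  apply: measurableU; first exact: measurable_image_EFin.
  by case: ifP => // _; apply: measurableU; exact: emeasurable_set1.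
apply/seteqP; split => [[r| |] /= Ar|x /= [[r Ar <-]//|]].
- by left; exists r.
- by right; rewrite mem_set//; left.
- by right; rewrite mem_set//; right.
- by case: ifPn => //; rewrite inE => A0 [->|->].
Qed.

Lemma measurable_expeR : measurable_fun [set: \bar R] (@expeR R).
Proof.
rewrite (_ : @expeR R = fun x => if x == +oo then +oo else
   if x == -oo then 0 else (expR (fine x))%:E); last first.
  by apply/funext => -[x| |]//.
apply: measurable_fun_ifT => //.
  apply: (measurable_fun_bool true); rewrite setTI.
  rewrite (_ : _ @^-1` _ = [set +oo]); first exact: emeasurable_set1.
  by apply/seteqP; split => x /= /eqP.
apply: measurable_fun_ifT => //.
  apply: (measurable_fun_bool true); rewrite setTI.
  rewrite (_ : _ @^-1` _ = [set -oo]); first exact: emeasurable_set1.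
  by apply/seteqP; split => x /= /eqP.
apply/measurable_EFinP; exact: (measurableT_comp (@measurable_expR R) measurable_fun_fine).
Qed.

Lemma measurable_expeRN dT (T : measurableType dT) (D : set T) (f : T -> \bar R) :
  measurable_fun D f -> measurable_fun D (fun x => expeR (- f x)).
Proof.
move=> mf; apply: (measurableT_comp measurable_expeR).
exact: measurableT_comp.
Qed.

End esum_tools.

Section jensen.
Variable R : realType.
Local Open Scope ereal_scope.

(** Young's inequality for [y] and 1. *)
Lemma powR_bernoulli (y p : R) : (0 <= y)%R -> (1 <= p)%R ->
  (1 + p * (y - 1) <= y `^ p)%R.
Proof.
move=> y0; rewrite le_eqVlt => /predU1P[<-|p1].
  by rewrite powRr1//; lra.
have p0 : (0 < p)%R by lra.
have p1' : (p - 1 != 0)%R by rewrite subr_eq0 gt_eqF.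
have := @conjugate_powR R y 1%R p (p / (p - 1))%R y0 ler01 p0.
rewrite divr_gt0// ?subr_gt0// => /(_ isT).
rewrite powR1 mulr1 => H.
have {}H : (y <= y `^ p / p + 1 / (p / (p - 1)))%R.
  by apply: H; rewrite invf_div; field; rewrite gt_eqF.
have := ler_wpM2l (ltW p0) H.
rewrite mulrDr (_ : p * (1 / (p / (p - 1))) = p - 1)%R; last first.
  by field; rewrite p1' gt_eqF.
by rewrite mulrCA divff ?gt_eqF// mulr1; lra.
Qed.

(** Integrate the tangent line of the power function at the mean value [a] of [h]. *)
Lemma jensen_powR dW (W : measurableType dW) (Q : probability W R)
    (h : W -> R) (p : R) : (1 <= p)%R -> measurable_fun setT h ->
  (forall w, (0 <= h w)%R) -> (forall w, (h w <= 1)%R) ->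
  ((fine (\int[Q]_w (h w)%:E)) `^ p)%:E <= \int[Q]_w (h w `^ p)%:E.
Proof.
move=> p1 mh h0 h1.
have p0 : (0 <= p)%R by lra.
have I1 : \int[Q]_w (h w)%:E <= 1%:E.
  rewrite -(integral_prob_cst Q 1); apply: ge0_le_integral_nomeas => w _.
    by rewrite lee_fin.
  by rewrite lee_fin.
have I0 : 0 <= \int[Q]_w (h w)%:E by apply: integral_ge0 => w _; rewrite lee_fin.
move: I1 I0; case aE : (\int[Q]_w (h w)%:E) => [a| |]//=.
rewrite !lee_fin => a1; rewrite le_eqVlt => /predU1P[<-|a0].
  rewrite powR0; last by rewrite gt_eqF//; lra.
  by apply: integral_ge0 => w _; rewrite lee_fin powR_ge0.
pose c : R := (p * a `^ (p - 1))%R.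
have c0 : (0 <= c)%R by rewrite mulr_ge0// powR_ge0.
have cE : (c * a = p * a `^ p)%R.
  rewrite /c -mulrA -[X in (_ * (_ * X))%R](powRr1 (ltW a0)) -powRD ?subrK//.
  by rewrite (gt_eqF a0) implybT.
have tang w : (c * h w + a `^ p <= h w `^ p + c * a)%R.
  have := @powR_bernoulli (h w / a) p (divr_ge0 (h0 w) (ltW a0)) p1.
  rewrite powRM ?invr_ge0 ?(ltW a0)// -powR_inv1 ?(ltW a0)// -powRrM mulN1r.
  move=> /(ler_wpM2r (powR_ge0 a p)).
  rewrite -[X in (_ <= X)%R]mulrA -powRD; last by rewrite (gt_eqF a0) implybT.
  rewrite addNr powRr0 mulr1.
  rewrite cE.
  have -> : (c * h w = p * (h w * a `^ -1) * a `^ p)%R.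
    rewrite powR_inv1 ?(ltW a0)//.
    have -> : (c = p * a `^ p / a)%R by rewrite -cE mulfK ?gt_eqF.
    by ring.
  lra.
have : \int[Q]_w (c * h w + a `^ p)%:E <= \int[Q]_w (h w `^ p + c * a)%:E.
  apply: ge0_le_integral_nomeas => w _.
    by rewrite lee_fin addr_ge0 ?mulr_ge0 ?powR_ge0.
  by rewrite lee_fin.
have mE (f : W -> R) : measurable_fun setT f -> measurable_fun setT (EFin \o f).
  by move=> mf; exact/measurable_EFinP.
under eq_integral do rewrite EFinD EFinM.
rewrite ge0_integralD//; last 3 first.
- by move=> w _; rewrite -EFinM lee_fin mulr_ge0.
- by apply: mE; exact: measurable_funM.
- by move=> w _; rewrite lee_fin powR_ge0.
rewrite ge0_integralZl//; last 2 first.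
- exact: mE.
- by move=> w _; rewrite lee_fin.
rewrite aE integral_prob_cst.
under [leRHS]eq_integral do rewrite EFinD.
rewrite ge0_integralD//; last 3 first.
- by move=> w _; rewrite lee_fin powR_ge0.
- apply: mE; exact: (measurableT_comp (@measurable_powR R p)).
- by move=> w _; rewrite lee_fin mulr_ge0// ltW.
rewrite integral_prob_cst.
by rewrite -EFinM addeC leeD2rE.
Qed.

(** Integrate the tangent line of [exp (- z)] at the mean value of [Z]; [Z] may take
    the value [+oo]. *)
Lemma jensen_exp dW (W : measurableType dW) (mu : {measure set W -> \bar R})
    (D : set W) (t : R) (Z : W -> \bar R) : measurable D -> mu D = t%:E -> (0 < t)%R ->
  measurable_fun D Z -> (forall w, 0 <= Z w) ->
  expeR (- ((t^-1)%:E * \int[mu]_(w in D) Z w)) <=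
    (t^-1)%:E * \int[mu]_(w in D) expeR (- Z w).
Proof.
move=> mD muD t0 mZ Z0.
have t1 : (0 < t^-1)%R by rewrite invr_gt0.
have I0 : 0 <= \int[mu]_(w in D) Z w by apply: integral_ge0.
have R0 : 0 <= (t^-1)%:E * \int[mu]_(w in D) expeR (- Z w).
  apply: mule_ge0; first by rewrite lee_fin ltW.
  by apply: integral_ge0 => w _; exact: expeR_ge0.
move: I0; case rE : (\int[mu]_(w in D) Z w) => [r| |]//=.
  rewrite lee_fin => r0.
  pose m := (t^-1 * r)%R.
  have m0 : (0 <= m)%R by rewrite mulr_ge0// ltW.
  have e0 : (0 < expR (- m))%R by exact: expR_gt0.
  have tang w : (expR (- m) * (1 + m))%:E <= (expR (- m))%:E * Z w + expeR (- Z w).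
    move: (Z0 w); case: (Z w) => [z| |]//= z0.
      rewrite -EFinM -EFinD lee_fin.
      have -> : expR (- z) = (expR (- m) * expR (m - z))%R.
        by rewrite -expRD; congr expR; ring.
      by rewrite -mulrDr ler_wpM2l ?(ltW e0)//; have := expR_ge1Dx (m - z); lra.
    by rewrite gt0_muley ?lte_fin// adde0 leey.
  have H : \int[mu]_(w in D) (expR (- m) * (1 + m))%:E <=
      \int[mu]_(w in D) ((expR (- m))%:E * Z w + expeR (- Z w)).
    apply: ge0_le_integral_nomeas => w _ //.
    by rewrite lee_fin mulr_ge0 ?(ltW e0)// addr_ge0.
  move: H; rewrite integral_cst// muD ge0_integralD//; last 4 first.
  - by move=> w _; rewrite mule_ge0// lee_fin ltW.
  - exact: measurable_funeM.
  - by move=> w _; exact: expeR_ge0.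
  - exact: measurable_expeRN.
  rewrite ge0_integralZl// rE.
  have : 0 <= \int[mu]_(w in D) expeR (- Z w).
    by apply: integral_ge0 => w _; exact: expeR_ge0.
  case: (\int[mu]_(w in D) expeR (- Z w)) => [z| |]//= _.
    rewrite -!EFinM -EFinD !lee_fin -/m => H.
    rewrite -(ler_pM2l t0) mulrA divff ?mul1r ?gt_eqF//.
    have rm : r = (t * m)%R by rewrite /m mulrA divff ?mul1r// gt_eqF.
    move: H; rewrite rm; lra.
  by move=> _; rewrite gt0_muley ?lte_fin// leey.
by move=> _; rewrite gt0_muley ?lte_fin.
Qed.

End jensen.

Section bm_law.
Context dW (W : measurableType dW) (R : realType) (Q : probability W R).
Variables (d : nat) (x : 'rV[R]_d) (B : R -> W -> 'rV[R]_d).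
Hypothesis BM : brownian_motion Q x B.

Lemma lebesgue_measure_shift (c : R) (A : set R) : measurable A ->
  lebesgue_measure ((fun y : R => c + y) @^-1` A) = lebesgue_measure A.
Proof.
move=> mA.
have mc : measurable_fun setT ((fun y : R => c + y) : R -> measurableTypeR R).
  exact: measurable_funD.
pose m2 : {measure set (measurableTypeR R) -> \bar R} :=
  measure_function_pushforward__canonical__measure_function_Measure (@lebesgue_measure R) mc.
have := @lebesgue_measure_unique R m2 _ A mA.
move=> ->// X [[a b]] _ <-.
rewrite /m2/= /pushforward (_ : _ @^-1` _ = `](a - c), (b - c)]%classic).
  rewrite !lebesgue_measure_itv/= !lte_fin ltrD2r; case: ifP => // _.
  by rewrite -!EFinB; congr (_%:E); ring.
by apply/seteqP; split => y /=; rewrite !in_itv/= ltrBlDl lerBrDl.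
Qed.

(** The increment from time 0 has independent Gaussian coordinates; the motion
    itself differs from it by [x] only almost surely. *)
Lemma bm_abs_continuous (s : R) (z : 'rV[R]_d) (N : set 'rV[R]_d) : 0 < s ->
  measurable N -> lebesgue_measure_rv d N = 0%E -> Q [set w | N (B s w - z)] = 0%E.
Proof.
move=> s0 mN N0.
have s0' : 0 <= (0 : R) < s by rewrite lexx s0.
pose X (i : 'I_d) w := (x - z) ord0 i + (B s w - B 0 w) ord0 i.
have mX0 i : measurable_fun setT (fun w => (B s w - B 0 w) ord0 i).
  by apply: (measurableT_comp (measurable_coord_rv i)); apply: (bm_measurable_incr BM) => //; exact: ltW.
have mX i : measurable_fun setT (X i) by exact: measurable_funD.
have mc (c : R) (A : set R) : measurable A -> measurable ((fun y : R => c + y) @^-1` A).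
  move=> mA; rewrite -[X in measurable X]setTI.
  have mcc : measurable_fun setT (fun y : R => c + y) by exact: measurable_funD.
  exact: mcc.
have iX : mutually_independent Q X.
  move=> S A uS mA.
  exact: (bm_incr_coord_indep BM s0' uS (fun i => mc ((x - z) ord0 i) _ (mA i))).
have aX i (A : set R) : measurable A -> lebesgue_measure A = 0%E -> Q (X i @^-1` A) = 0%E.
  move=> mA A0.
  transitivity (normal_prob 0 (Num.sqrt (s - 0)) ((fun y : R => (x - z) ord0 i + y) @^-1` A)).
    exact: (bm_incr_law BM i s0' (mc ((x - z) ord0 i) _ mA)).
  have /null_content_dominatesP := @normal_prob_dominates R 0 (Num.sqrt (s - 0)).
  by move=> H; apply: H; [exact: mc|rewrite -[RHS]A0; exact: lebesgue_measure_shift].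
have H := indep_abs_continuous mX iX aX mN N0.
have [N1 [mN1 QN1 HN1]] : Q.-negligible (~` [set w | B 0 w = x]).
  by case: BM => _ [N' [mN' QN' HN']] _ _; exists N'; split.
have m1 : measurable [set w | N (\row_i X i w)].
  rewrite -[X in measurable X]setTI.
  have mr : measurable_fun setT (fun w => \row_i X i w).
    by apply: measurable_fun_rvP => j; under eq_fun do rewrite mxE; exact: mX.
  exact: mr.
have m2 : measurable [set w | N (B s w - z)].
  rewrite -[X in measurable X]setTI.
  have mr : measurable_fun setT (fun w => B s w - z).
    by apply: measurable_rvD => //; exact: (bm_measurable BM) (ltW s0).
  exact: mr.
apply/eqP; rewrite eq_le measure_ge0 andbT.
apply: (@le_trans _ _ (Q ([set w | N (\row_i X i w)] `|` N1))).
  apply: le_measure; rewrite ?inE//; first exact: measurableU.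
  move=> w /= Nw; have [Bx|Bx] := pselect (B 0 w = x); [left|by right; exact: HN1].
  rewrite (_ : \row_i X i w = B s w - z)//; apply/rowP => i.
  by rewrite !mxE /X !mxE Bx; ring.
by apply: le_trans (measureU2 _ m1 mN1) _; rewrite [X in (X + _)%E]H [X in (_ + X)%E]QN1 adde0.
Qed.

End bm_law.

Section bm_joint.
Context dW (W : measurableType dW) (R : realType) (Q : probability W R).
Variables (d : nat) (x : 'rV[R]_d) (B : R -> W -> 'rV[R]_d).
Hypothesis BM : brownian_motion Q x B.

(** Continuity of the paths makes the motion the limit of its discretisations
    in time, which are jointly measurable. *)
Lemma measurable_bm :
  measurable_fun setT (fun z : R * W => B (Num.max z.1 0) z.2).
Proof.
apply: measurable_fun_rvP => i.
pose k (n : nat) (s : R) : nat := Num.truncn (Num.max s 0 * n.+1%:R).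
have mx0 (s : R) : 0 <= Num.max s 0 by rewrite le_max lexx orbT.
have m0 (s : R) n : 0 <= Num.max s 0 * n.+1%:R by rewrite mulr_ge0.
pose f (n : nat) (z : R * W) := B ((k n z.1)%:R / n.+1%:R) z.2 ord0 i.
apply: (@measurable_fun_cvg _ _ _ _ f) => [n|[s w] _].
- move=> _ A mA; rewrite setTI.
  have -> : f n @^-1` A = \bigcup_j ([set s | k n s = j] `*`
      [set w | A (B (j%:R / n.+1%:R) w ord0 i)]).
    apply/seteqP; split => [[s w] /= H|[s w] [j _ [/= <-]]//].
    by exists (k n s).
  apply: bigcupT_measurable => j; apply: measurableX.
    have mg : measurable_fun setT (fun s : R => Num.max s 0 * n.+1%:R).
      apply: measurable_funM => //.
      exact: measurable_maxr.
    have := mg measurableT `[j%:R, j.+1%:R[%classic (measurable_itv _).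
    rewrite setTI; congr measurable; apply/seteqP; split => s /=.
      by rewrite in_itv/= -truncn_eq// => /eqP.
    by move=> kn; rewrite in_itv/= -truncn_eq//; exact/eqP.
  rewrite -[X in measurable X]setTI.
  have mm : measurable_fun setT (fun w => B (j%:R / n.+1%:R) w ord0 i).
    apply: (measurableT_comp (measurable_coord_rv i)); apply: (bm_measurable BM).
    by rewrite divr_ge0.
  exact: mm.
- have s0 : 0 <= Num.max s 0 by rewrite le_max lexx orbT.
  apply/cvgrPdist_lt => e e0.
  have [del del0 H] := bm_coord_continuous BM w i s0 e0.
  near=> n; apply: H; first by rewrite divr_ge0.
  have /andP[k1 k2] := truncn_itv (m0 s n).
  have n0 : 0 < n.+1%:R :> R by [].
  rewrite ger0_norm; last by rewrite subr_ge0 ler_pdivrMr.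
  apply: (@le_lt_trans _ _ (1 / n.+1%:R)).
    by rewrite lerBlDr -mulrDl ler_pdivlMr// nat1r ltW.
  rewrite ltr_pdivrMr// mulrC -ltr_pdivrMr//.
  apply: (@le_lt_trans _ _ n%:R); last by rewrite ltr_nat.
  near: n; exact: nbhs_infty_ger.
Unshelve. all: by end_near. Qed.

End bm_joint.

Section survival_upper.
Context dW (W : measurableType dW) (R : realType) (Q : probability W R).
Variables (d : nat) (x : 'rV[R]_d) (B : R -> W -> 'rV[R]_d).
Hypothesis BM : brownian_motion Q x B.
Context dO (O : measurableType dO) (P : probability O R).
Variable U : O -> 'rV[R]_d -> \bar R.
Hypothesis mU : measurable_fun setT (fun z : O * 'rV[R]_d => U z.1 z.2).
Hypothesis U0 : forall om y, (0 <= U om y)%E.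
Local Open Scope ereal_scope.

(** Jensen's inequality, for the power [p] and for the exponential of the average over
    the time interval, bounds the moment by the average over time and over the motion of
    [exp (- p t U)] at the current position. Tonelli's theorem puts the expectation over
    the field innermost, and at each time the motion almost surely avoids the
    positions in [N]. *)
Lemma survival_moment_upper (t p K : R) (N : set 'rV[R]_d) : (0 < t)%R -> (1 <= p)%R ->
  (0 <= K)%R ->
  measurable N -> (forall s, (0 < s)%R -> Q [set w | N (B s w)] = 0) ->
  (forall y, ~ N y -> \int[P]_om expeR (- ((p * t)%:E * U om y)) <= K%:E) ->
  \int[P]_om (survival Q B (U om) t `^ p)%:E <= K%:E.
Proof.
move=> t0 p1 K0 mN QN HK.
have p0 : (0 < p)%R by lra.
pose B' (s : R) w := B (Num.max s 0%R) w.
have mB' : measurable_fun setT (fun z : R * W => B' z.1 z.2) by exact: (measurable_bm BM).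
have UB om : measurable_fun setT (U om).
  exact: (measurableT_comp mU (measurable_pair1 om)).
pose D : set R := `]0%R, t]%classic.
have mD : measurable D by exact: measurable_itv.
have muD : lebesgue_measure D = t%:E by rewrite lebesgue_measure_itv/= lte_fin t0 sube0.
pose J om s w := expeR (- ((p * t)%:E * U om (B' s w))).
have J0 om s w : 0 <= J om s w by exact: expeR_ge0.
have mJ : measurable_fun setT (fun z : (O * R) * W => J z.1.1 z.1.2 z.2).
  apply: measurable_expeRN; apply: measurable_funeM.
  have m1 : measurable_fun setT (fun z : (O * R) * W => (z.1.2, z.2)).
    apply: measurable_fun_pair => //.
    exact: (measurableT_comp measurable_snd measurable_fst).
  have m2 : measurable_fun setT (fun z : (O * R) * W => (z.1.1, B' z.1.2 z.2)).
    apply: measurable_fun_pair.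
      exact: (measurableT_comp measurable_fst measurable_fst).
    exact: (measurableT_comp mB' m1).
  exact: (measurableT_comp mU m2).
have mJom om : measurable_fun setT (fun z : R * W => J om z.1 z.2).
  have m1 : measurable_fun setT (fun z : R * W => ((om, z.1), z.2)).
    by apply: measurable_fun_pair => //; exact: measurable_fun_pair.
  exact: (measurableT_comp mJ m1).
have step1 om : (survival Q B (U om) t `^ p)%:E <=
    \int[Q]_w ((t^-1)%:E * \int[lebesgue_measure]_(s in D) J om s w).
  have mUs w : measurable_fun setT (fun s => U om (B' s w)).
    apply: (measurableT_comp (UB om)).
    exact: (measurableT_comp mB' (measurable_pair2 w)).
  pose I w := \int[lebesgue_measure]_(s in D) U om (B' s w).
  have I0 w : 0 <= I w by apply: integral_ge0.
  have mI : measurable_fun setT I.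
    have -> : I = fun w => \int[lebesgue_measure]_s (U om (B' s w) * (\1_D s)%:E).
      apply/funext => w; rewrite /I integral_mkcond; apply: eq_integral => s _.
      by rewrite patchE indicE; case: ifP; rewrite ?mule1 ?mule0.
    apply: (@measurable_fun_fubini_tonelli_G _ _ (measurableTypeR R) W R
      lebesgue_measure (fun z => U om (B' z.1 z.2) * (\1_D z.1)%:E)) => [|z].
      apply: emeasurable_funM; first exact: (measurableT_comp (UB om) mB').
      apply/measurable_EFinP; apply: (measurableT_comp (measurable_indic _)) => //.
    by rewrite mule_ge0// lee_fin.
  pose h w := fine (expeR (- I w)).
  have e1 w : 0 <= expeR (- I w) <= 1.
    rewrite expeR_ge0 -expeR0 lee_expeR.
    by rewrite -oppe0 leeN2 I0.
  have hE w : (h w)%:E = expeR (- I w).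
    rewrite fineK// ge0_fin_numE ?expeR_ge0//.
    by have /andP[_ /le_lt_trans->] := e1 w; rewrite ?ltry.
  have -> : survival Q B (U om) t = fine (\int[Q]_w (h w)%:E).
    rewrite /survival; congr fine; apply: eq_integral => w _; rewrite hE.
    congr (expeR (- _)); rewrite /I integral_itv_obnd_cbnd//.
      apply: eq_integral => s; rewrite inE/= in_itv/= => /andP[s0 _].
      by rewrite /B' max_l.
    by apply: measurable_funS (mUs w).
  have mh : measurable_fun setT h.
    exact: (measurableT_comp (@measurable_fun_fine R) (measurable_expeRN mI)).
  have h0 w : (0 <= h w)%R by rewrite -lee_fin hE; case/andP: (e1 w).
  have h1 w : (h w <= 1)%R by rewrite -lee_fin hE; case/andP: (e1 w).
  apply: (le_trans (jensen_powR Q p1 mh h0 h1)).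
  apply: ge0_le_integral_nomeas => w _; first by rewrite lee_fin powR_ge0.
  have -> : (h w `^ p)%:E = expeR (- ((t^-1)%:E *
      \int[lebesgue_measure]_(s in D) ((p * t)%:E * U om (B' s w)))).
    rewrite ge0_integralZl//; last 2 first.
    - by apply: measurable_funS (mUs w).
    - by rewrite lee_fin mulr_ge0// ltW.
    rewrite muleA -EFinM mulrCA mulVf ?mulr1 ?gt_eqF// -/(I w) /h.
    move: (I0 w); case: (I w) => [r| |]//= _.
      by rewrite mulrC -mulNr expRM.
    by rewrite gt0_muley ?lte_fin// powR0// gt_eqF.
  apply: jensen_exp => //.
  - by apply: measurable_funeM; apply: measurable_funS (mUs w).
  - by move=> s; rewrite mule_ge0// lee_fin mulr_ge0 ?ltW.
pose Jd om s w := J om s w * (\1_D s)%:E.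
have Jd0 om s w : 0 <= Jd om s w by rewrite mule_ge0// lee_fin.
have mJd : measurable_fun setT (fun z : (O * R) * W => Jd z.1.1 z.1.2 z.2).
  apply: emeasurable_funM => //; apply/measurable_EFinP.
  apply: (measurableT_comp (measurable_indic mD)).
  exact: (measurableT_comp measurable_snd measurable_fst).
have JdE om w : \int[lebesgue_measure]_(s in D) J om s w =
    \int[lebesgue_measure]_s Jd om s w.
  rewrite integral_mkcond; apply: eq_integral => s _.
  by rewrite /Jd patchE indicE; case: ifP; rewrite ?mule1 ?mule0.
have mJds s : measurable_fun setT (fun z : O * W => Jd z.1 s z.2).
  have m1 : measurable_fun setT (fun z : O * W => ((z.1, s), z.2)).
    by apply: measurable_fun_pair => //; exact: measurable_fun_pair.
  exact: (measurableT_comp mJd m1).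
have mJdo om : measurable_fun setT (fun z : measurableTypeR R * W => Jd om z.1 z.2).
  have m1 : measurable_fun setT (fun z : R * W => ((om, z.1), z.2)).
    by apply: measurable_fun_pair => //; exact: measurable_fun_pair.
  exact: (measurableT_comp mJd m1).
have Jd1 om s w : Jd om s w <= 1.
  rewrite /Jd -[leRHS]mule1 lee_pmul// ?lee_fin ?indicE; last by case: (_ \in _).
  rewrite /J -expeR0 lee_expeR -oppe0 leeN2 mule_ge0// lee_fin mulr_ge0 ?ltW//.
apply: (@le_trans _ _ (\int[P]_om ((t^-1)%:E * \int[lebesgue_measure]_s \int[Q]_w Jd om s w))).
  apply: ge0_le_integral_nomeas => om _; first by rewrite lee_fin powR_ge0.
  apply: le_trans (step1 om) _.
  rewrite ge0_integralZl//; last 3 first.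
  - under eq_fun do rewrite JdE.
    exact: (@measurable_fun_fubini_tonelli_G _ _ (measurableTypeR R) W R
      lebesgue_measure (fun z => Jd om z.1 z.2) (mJdo om)).
  - by move=> w _; apply: integral_ge0.
  - by rewrite lee_fin invr_ge0 ltW.
  under eq_integral do rewrite JdE.
  by rewrite -(@fubini_tonelli _ _ (measurableTypeR R) W R lebesgue_measure Q
      (fun z => Jd om z.1 z.2) (mJdo om)).
have mJQ : measurable_fun setT (fun z : O * measurableTypeR R => \int[Q]_w Jd z.1 z.2 w).
  exact: (@measurable_fun_fubini_tonelli_F _ _ (O * R)%type W R Q
      (fun z => Jd z.1.1 z.1.2 z.2) mJd).
rewrite ge0_integralZl//; last 3 first.
- apply: (@measurable_fun_fubini_tonelli_F _ _ O (measurableTypeR R) R lebesgue_measure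
     (fun z => \int[Q]_w Jd z.1 z.2 w) mJQ) => z; exact: integral_ge0.
- by move=> om _; apply: integral_ge0 => s _; apply: integral_ge0.
- by rewrite lee_fin invr_ge0 ltW.
have -> : \int[P]_om \int[lebesgue_measure]_s \int[Q]_w Jd om s w =
    \int[lebesgue_measure]_s \int[P]_om \int[Q]_w Jd om s w.
  apply: (@fubini_tonelli _ _ O (measurableTypeR R) R P lebesgue_measure
     (fun z => \int[Q]_w Jd z.1 z.2 w) mJQ).
  by move=> z; exact: integral_ge0.
have bound s : \int[P]_om \int[Q]_w Jd om s w <= (K * \1_D s)%:E.
  rewrite (@fubini_tonelli _ _ O W R P Q (fun z => Jd z.1 s z.2) (mJds s))//.
  have [sD|sD] := boolP (s \in D); last first.
    rewrite /Jd indicE (negbTE sD) mulr0 integral0_eq// => w _.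
    by rewrite /fubini_G integral0_eq// => om _; rewrite mule0.
  rewrite indicE sD mulr1.
  have s0 : (0 < s)%R by move: sD => /set_mem; rewrite /D/= in_itv/= => /andP[].
  have mNs : measurable [set w | N (B s w)].
    by rewrite -[X in measurable X]setTI; apply: (bm_measurable BM (ltW s0)).
  apply: (@le_trans _ _ (\int[Q]_w ((K%:E) + (\1_[set w | N (B s w)] w)%:E))).
    apply: ge0_le_integral_nomeas => w _; first exact: integral_ge0.
    rewrite indicE; have [wN|wN] := boolP (w \in _).
      apply: (@le_trans _ _ (\int[P]_om (1%:E))).
        by apply: ge0_le_integral_nomeas.
      by rewrite integral_prob_cst leeDr// lee_fin.
    rewrite adde0; apply: le_trans (HK (B s w) _); last by move=> H; move/negP: wN; apply; exact: mem_set.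
    apply: ge0_le_integral_nomeas => om _ //.
    by rewrite /Jd indicE sD mule1 /J /B' max_l// ltW.
  rewrite ge0_integralD//; last exact/measurable_EFinP/measurable_indic.
  by rewrite integral_prob_cst integral_indic// setIT [X in _ + X]QN// adde0.
apply: (@le_trans _ _ ((t^-1)%:E * \int[lebesgue_measure]_s (K * \1_D s)%:E)).
  rewrite lee_pmul2l//; last by rewrite lte_fin invr_gt0.
  apply: ge0_le_integral_nomeas => s _ //.
  by apply: integral_ge0 => om _; apply: integral_ge0.
under eq_integral do rewrite EFinM.
rewrite ge0_integralZl//; last exact/measurable_EFinP/measurable_indic.
rewrite integral_indic// setIT [X in (_ * (_ * X))%E]muD.
by rewrite -!EFinM lee_fin mulrCA mulVf ?mulr1// gt_eqF.
Qed.

End survival_upper.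

(** * Euclidean geometry of the lattice *)

Section euclidean_norm.
Variables (R : realType) (n : nat).
Implicit Types x y : 'rV[R]_n.

Let S x : R := \sum_(i < n) x ord0 i ^+ 2.

Let S0 x : 0 <= S x. Proof. by apply: sumr_ge0 => i _; exact: sqr_ge0. Qed.

Let S_enorm x : S x = enorm x ^+ 2. Proof. by rewrite /enorm sqr_sqrtr; [|exact: S0]. Qed.

Lemma enorm_ge0 x : 0 <= enorm x. Proof. exact: sqrtr_ge0. Qed.

Lemma enormZ (a : R) x : enorm (a *: x) = `|a| * enorm x.
Proof.
rewrite /enorm -sqrtr_sqr -sqrtrM ?sqr_ge0//; congr Num.sqrt.
by rewrite mulr_sumr; apply: eq_bigr => i _; rewrite mxE exprMn.
Qed.

Lemma enormN x : enorm (- x) = enorm x.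
Proof. by rewrite -scaleN1r enormZ normrN1 mul1r. Qed.

Lemma enorm0 : enorm (0 : 'rV[R]_n) = 0.
Proof. by rewrite -(scale0r 0) enormZ normr0 mul0r. Qed.

Let cauchy_schwarz x y : \sum_(i < n) x ord0 i * y ord0 i <= enorm x * enorm y.
Proof.
have [y0|y0] := eqVneq (S y) 0.
  rewrite big1 ?mulr_ge0 ?enorm_ge0// => i _.
  have /eqP := y0; rewrite psumr_eq0 => [/allP/(_ i (mem_index_enum _))/=|j _]; last exact: sqr_ge0.
  by rewrite sqrf_eq0 => /eqP ->; rewrite mulr0.
have Sy : 0 < S y by rewrite lt_neqAle eq_sym y0 S0.
set D := \sum_(i < n) _.
have H (a : R) : 0 <= S x - 2 * a * D + a ^+ 2 * S y.
  have -> : S x - 2 * a * D + a ^+ 2 * S y = \sum_(i < n) (x ord0 i - a * y ord0 i) ^+ 2.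
    rewrite /S /D !mulr_sumr -sumrB -big_split/=.
    by apply: eq_bigr => i _; ring.
  by apply: sumr_ge0 => i _; exact: sqr_ge0.
have : D ^+ 2 <= S x * S y.
  have := H (D / S y); rewrite -(ler_pM2r Sy) mul0r.
  have -> : (S x - 2 * (D / S y) * D + (D / S y) ^+ 2 * S y) * S y = S x * S y - D ^+ 2.
    by field.
  by rewrite subr_ge0.
rewrite !S_enorm -exprMn => H2.
have [D0|D0] := leP 0 D; last by rewrite (le_trans (ltW D0))// mulr_ge0 ?enorm_ge0.
by rewrite -ler_sqr ?nnegrE ?mulr_ge0 ?enorm_ge0.
Qed.

Lemma enormD x y : enorm (x + y) <= enorm x + enorm y.
Proof.
rewrite -ler_sqr ?nnegrE ?addr_ge0 ?enorm_ge0// -S_enorm sqrrD -!S_enorm.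
have -> : S (x + y) = S x + (\sum_(i < n) x ord0 i * y ord0 i) *+ 2 + S y.
  rewrite /S -mulr_natr mulr_suml -!big_split/=; apply: eq_bigr => i _.
  by rewrite mxE; ring.
by rewrite lerD2r lerD2l lerMn2r cauchy_schwarz.
Qed.

Lemma enormB x y : enorm (x - y) <= enorm x + enorm y.
Proof. by rewrite -(enormN y) enormD. Qed.

Lemma coord_le_enorm x i : `|x ord0 i| <= enorm x.
Proof.
rewrite -ler_sqr ?nnegrE ?enorm_ge0// -S_enorm real_normK ?num_real//.
by rewrite /S (bigD1 i)//= lerDl; apply: sumr_ge0 => j _; exact: sqr_ge0.
Qed.

(** The sharp constant is the square root of [n]. *)
Lemma enorm_le_coord x (a : R) : 0 <= a -> (forall i, `|x ord0 i| <= a) ->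
  enorm x <= n%:R * a.
Proof.
move=> a0 H; rewrite -ler_sqr ?nnegrE ?mulr_ge0 ?enorm_ge0// -S_enorm.
apply: (@le_trans _ _ (\sum_(i < n) a ^+ 2)).
  by apply: ler_sum => i _; rewrite -real_normK ?num_real// ler_sqr ?nnegrE// H.
rewrite sumr_const card_ord -[leLHS]mulr_natl exprMn; apply: ler_wpM2r; first exact: sqr_ge0.
rewrite -natrX ler_nat; case: n => // m.
by rewrite leq_pmulr.
Qed.

Lemma enorm_eq0 x : (enorm x == 0) = (x == 0).
Proof.
apply/idP/eqP => [/eqP x0|->]; last by rewrite enorm0.
apply/rowP => i; apply/eqP; rewrite mxE -normr_eq0 eq_le normr_ge0 andbT -x0.
exact: coord_le_enorm.
Qed.

End euclidean_norm.

Section boxes.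
Variable R : realType.
Local Open Scope ereal_scope.

Lemma cons_rv_ord0 n (a : R) (v : 'rV[R]_n) : cons_rv (a, v) ord0 ord0 = a.
Proof. by have /(congr1 fst) := cons_rvK (a, v). Qed.

Lemma cons_rv_lift n (a : R) (v : 'rV[R]_n) i :
  cons_rv (a, v) ord0 (lift ord0 i) = v ord0 i.
Proof.
have /(congr1 snd)/rowP/(_ i) := cons_rvK (a, v).
rewrite /= mxE => <-; congr (cons_rv _ _ _); exact/val_inj.
Qed.

Lemma measurable_box n (I : 'I_n -> interval R) :
  measurable [set z : 'rV[R]_n | forall i, z ord0 i \in I i].
Proof.
have -> : [set z : 'rV[R]_n | forall i, z ord0 i \in I i] =
    \bigcap_(i in [set: 'I_n]) ((fun z : 'rV[R]_n => z ord0 i) @^-1` [set` I i]).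
  by apply/seteqP; split => z /= H i; [move=> _; exact: H|exact: (H i Logic.I)].
apply: fin_bigcap_measurable => // i _; rewrite -[X in measurable X]setTI.
apply: measurable_coord_rv => //; exact: measurable_itv.
Qed.

Lemma lebesgue_measure_box n (I : 'I_n -> interval R) :
  lebesgue_measure_rv n [set z : 'rV[R]_n | forall i, z ord0 i \in I i] =
  \prod_(i < n) lebesgue_measure [set` I i].
Proof.
elim: n I => [|n IH] I.
  rewrite big_ord0 (_ : [set _ | _] = setT); last first.
    by apply/seteqP; split => z // _; case.
  by rewrite /= diracT.
rewrite big_ord_recl /= /pushforward.
rewrite (_ : _ @^-1` _ = [set` I ord0] `*`
    [set z : 'rV[R]_n | forall i, z ord0 i \in I (lift ord0 i)]); last first.
  apply/seteqP; split => [[a v] /= H|[a v] /= [Ha Hv] i].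
    split; first by have := H ord0; rewrite cons_rv_ord0.
    by move=> i; have := H (lift ord0 i); rewrite cons_rv_lift.
  have [j ->|->] := unliftP ord0 i; last by rewrite cons_rv_ord0.
  by rewrite cons_rv_lift.
rewrite product_measure1E.
- by rewrite [X in (_ * X)]IH.
- exact: measurable_itv.
- exact: measurable_box.
Qed.

Lemma lebesgue_measure_cube n (a b : R) : (a <= b)%R ->
  lebesgue_measure_rv n [set z : 'rV[R]_n | forall i, z ord0 i \in `[a, b[%R] =
  ((b - a) ^+ n)%:E.
Proof.
move=> ab; rewrite (lebesgue_measure_box (fun=> `[a, b[)).
rewrite (eq_bigr (fun=> (b - a)%:E)) => [|i _]; last first.
  rewrite lebesgue_measure_itv/= lte_fin; case: ltP => // ba.
  by rewrite (_ : a = b) ?subrr//; apply/eqP; rewrite eq_le ab ba.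
by rewrite prodEFin prodr_const card_ord.
Qed.

End boxes.

Section cells.
Variables (R : realType) (n : nat).
Implicit Types (L : R) (z : 'rV[R]_n).

(** Nearest lattice point, so that the cells are cubes. *)
Definition lat z : 'rV[int]_n := \row_i Num.floor (z ord0 i + 1 / 2).

Lemma lat_dist z : enorm (of_Zd R (lat z) - z) <= n%:R.
Proof.
rewrite -[leRHS]mulr1; apply: enorm_le_coord => // i; rewrite !mxE.
have /andP[] := floor_itv (z ord0 i + 1 / 2).
rewrite intrD; rewrite ler_norml; lra.
Qed.

Definition cell L (q : 'rV[int]_n) : set 'rV[R]_n := [set z | lat (L *: z) = q].

Lemma cellE L q : 0 < L -> cell L q =
  [set z | forall i, z ord0 i \in `[((q ord0 i)%:~R - 1 / 2) / L, ((q ord0 i)%:~R + 1 / 2) / L[].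
Proof.
move=> L0; apply/seteqP; split => z.
  move=> <- i; rewrite in_itv/= !mxE.
  rewrite ler_pdivrMr// ltr_pdivlMr// (mulrC L).
  have /andP[] := floor_itv (z ord0 i * L + 1 / 2); rewrite intrD => h1 h2.
  by apply/andP; split; lra.
move=> H; apply/rowP => i; rewrite !mxE; apply/floor_def.
have := H i; rewrite in_itv/= ler_pdivrMr// ltr_pdivlMr// (mulrC L) intrD => /andP[h1 h2].
by apply/andP; split; lra.
Qed.

Lemma measurable_cell L q : 0 < L -> measurable (cell L q).
Proof. by move=> L0; rewrite cellE//; exact: measurable_box. Qed.

Lemma lebesgue_measure_cell L q : 0 < L ->
  lebesgue_measure_rv n (cell L q) = (L ^- n)%:E.
Proof.
move=> L0; rewrite cellE// lebesgue_measure_box.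
rewrite (eq_bigr (fun=> (L^-1)%:E)) => [|i _]; last first.
  rewrite lebesgue_measure_itv/= lte_fin ltr_pM2r ?invr_gt0//.
  rewrite ifT; last by lra.
  by rewrite -EFinB; congr (_%:E); field; rewrite gt_eqF.
by rewrite prodEFin prodr_const card_ord exprVn.
Qed.

Lemma measurable_lat L (f : 'rV[int]_n -> \bar R) : 0 < L -> (forall q, 0 <= f q)%E ->
  measurable_fun setT (fun z : 'rV[R]_n => f (lat (L *: z))).
Proof.
by move=> L0 f0; apply: measurable_discrete => // q; exact: measurable_cell.
Qed.

(** Riemann sums over the scaled lattice are integrals of step functions. *)
Lemma integral_lat L (f : 'rV[int]_n -> \bar R) : 0 < L -> (forall q, 0 <= f q)%E ->
  (\int[lebesgue_measure_rv n]_z f (lat (L *: z)) =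
   (L ^- n)%:E * \esum_(q in [set: 'rV[int]_n]) f q)%E.
Proof.
move=> L0 f0; rewrite (integral_discrete _ (X := fun z => lat (L *: z)))//; last first.
  by move=> q; exact: measurable_cell.
rewrite -esumZl//; last by rewrite invr_ge0 exprn_ge0// ltW.
by apply: eq_esum => q _; rewrite [X in (_ * X)%E]lebesgue_measure_cell// muleC.
Qed.

End cells.

Section radial.
Variables (R : realType) (n : nat).
Implicit Types (r M L a : R).
Local Notation mu := (lebesgue_measure_rv n : set 'rV[R]_n -> \bar R).

Lemma lebesgue_measure_eball r : 0 <= r ->
  (lebesgue_measure_rv n (eball n r : set 'rV[R]_n) <= ((2 * r) ^+ n)%:E)%E.
Proof.
move=> r0; have -> : 2 * r = r - - r by ring.
rewrite -lebesgue_measure_cube; last by lra.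
apply: le_measure; rewrite ?inE.
- exact: measurable_eball.
- exact: measurable_box.
- move=> z zr i /=; have := coord_le_enorm z i; rewrite in_itv/= => H.
  have := le_lt_trans H zr; rewrite ltr_norml => /andP[h1 h2].
  by rewrite h2 ltW.
Qed.

Definition outside M : set 'rV[R]_n := [set z | M <= enorm z].

Lemma measurable_outside M : measurable (outside M).
Proof.
rewrite (_ : outside M = ~` eball n M); first by apply: measurableC; exact: measurable_eball.
by apply/seteqP; split => z /=; rewrite /outside /eball/= leNgt => /negP.
Qed.

Lemma measurable_enorm_powR a : measurable_fun setT (fun z : 'rV[R]_n => (enorm z `^ a)%:E).
Proof.
apply/measurable_EFinP; apply: (measurableT_comp (@measurable_powR R a)).
exact: measurable_enorm.
Qed.

Lemma powR2_lt1 a : n%:R < a -> 2 `^ (n%:R - a) < 1 :> R.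
Proof.
move=> na; rewrite -[_ - a]opprB powRN invf_lt1 ?powR_gt0//.
have : 1 `^ (a - n%:R) < 2 `^ (a - n%:R) :> R.
  by apply: gt0_ltr_powR; rewrite ?nnegrE ?ltr1n ?subr_gt0.
by rewrite powR1.
Qed.

(** Dyadic shells: the shell of radius [2^k M] has volume at most
    [(4 2^k M)^n], and the integrand is at most [(2^k M)^-a] there. *)
Lemma integral_tail a M : n%:R < a -> 0 < M ->
  (\int[lebesgue_measure_rv n]_(z in outside M) (enorm z `^ (- a))%:E <=
   (4 ^+ n / (1 - 2 `^ (n%:R - a)) * M `^ (n%:R - a))%:E)%E.
Proof.
move=> na M0.
pose rho := 2 `^ (n%:R - a) : R.
have rho0 : 0 < rho by rewrite powR_gt0.
have rho1 : rho < 1 by exact: powR2_lt1.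
pose c k : R := (M * 2 ^+ k) `^ (- a).
pose h k (z : 'rV[R]_n) : \bar R := ((c k)%:E * (\1_(eball n (M * 2 ^+ k.+1)) z)%:E)%E.
have p2 k : 0 < 2 ^+ k :> R by rewrite exprn_gt0.
have h0 k z : (0 <= h k z)%E by rewrite mule_ge0// lee_fin powR_ge0.
have mi k : measurable_fun setT (fun z => (\1_(eball n (M * 2 ^+ k.+1)) z)%:E : \bar R).
  by apply/measurable_EFinP; apply: measurable_indic; exact: measurable_eball.
have mh k : measurable_fun setT (h k) by exact: measurable_funeM.
apply: (@le_trans _ _ (\int[lebesgue_measure_rv n]_z \sum_(k <oo) h k z)%E).
  rewrite integral_mkcond; apply: ge0_le_integral_nomeas => z _.
    by rewrite patchE; case: ifP => //; rewrite lee_fin powR_ge0.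
  rewrite patchE; case: ifPn => [|_]; last exact: nneseries_ge0.
  rewrite inE /outside/= => Mz.
  have ex : exists k, enorm z < M * 2 ^+ k.+1.
    exists (Num.truncn (enorm z / M)).
    rewrite mulrC -ltr_pdivrMr//.
    apply: (@lt_le_trans _ _ (Num.truncn (enorm z / M)).+1%:R).
      by have /andP[] := truncn_itv (divr_ge0 (enorm_ge0 z) (ltW M0)).
    by rewrite -natrX ler_nat ltnW// ltn_expl.
  case: (ex_minnP ex) => k kz kmin.
  have Mk : M * 2 ^+ k <= enorm z.
    case: k kz kmin => [|k] kz kmin; first by rewrite expr0 mulr1.
    by rewrite leNgt; apply/negP => /kmin; rewrite ltnn.
  apply: (@le_trans _ _ (h k z)).
    rewrite /h indicE mem_set// mule1 lee_fin.
    have Mk0 : 0 < M * 2 ^+ k by rewrite mulr_gt0.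
    have z0 := lt_le_trans Mk0 Mk.
    rewrite /c !powRN lef_pV2 ?posrE ?powR_gt0//.
    rewrite ge0_ler_powR ?nnegrE ?(ltW Mk0) ?(ltW z0)//.
    by rewrite (le_trans _ (ltW na)).
  apply: (@le_trans _ _ (\sum_(0 <= j < k.+1) h j z)%E).
    by rewrite big_nat_recr//= leeDr// sume_ge0.
  by apply: nneseries_lim_ge => j _.
rewrite integral_nneseries//.
apply: (@le_trans _ _ (\sum_(k <oo) ((4 ^+ n * M `^ (n%:R - a)) * rho ^+ k)%:E)%E).
  apply: lee_nneseries => [k _ _|k _]; first by apply: integral_ge0.
  rewrite /h ge0_integralZl//; last by rewrite lee_fin powR_ge0.
  rewrite integral_indic//; last exact: measurable_eball.
  rewrite setIT.
  apply: le_trans (lee_wpmul2l _ (lebesgue_measure_eball _)) _.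
  - by rewrite lee_fin powR_ge0.
  - by rewrite mulr_ge0 ?(ltW M0) ?(ltW (p2 _)).
  rewrite -EFinM lee_fin le_eqVlt; apply/orP; left; apply/eqP.
  have Mk0 : 0 < M * 2 ^+ k by rewrite mulr_gt0.
  have -> : 2 * (M * 2 ^+ k.+1) = 4 * (M * 2 ^+ k) by rewrite exprS; ring.
  rewrite exprMn mulrCA -mulrA; congr (_ * _).
  rewrite -(powR_mulrn _ (ltW Mk0)) -powRD; last by rewrite (gt_eqF Mk0) implybT.
  rewrite addrC powRM ?(ltW M0) ?(ltW (p2 _))//; congr (_ * _).
  rewrite -(@powR_mulrn R 2 k (ler0n R 2)) powRAC.
  by rewrite (powR_mulrn k (powR_ge0 2 (n%:R - a))).
apply: lime_le; first by apply: is_cvg_nneseries => k _ _; rewrite lee_fin mulr_ge0 ?exprn_ge0 ?(ltW rho0) ?mulr_ge0 ?powR_ge0.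
apply: nearW => N; rewrite sumEFin lee_fin.
have := @geometric_le_lim R N (4 ^+ n * M `^ (n%:R - a)) rho.
rewrite ger0_norm ?(ltW rho0)// => H.
apply: le_trans (H _ rho0 rho1) _; first by rewrite mulr_ge0 ?exprn_ge0 ?powR_ge0.
by rewrite le_eqVlt; apply/orP; left; apply/eqP; rewrite -/rho; ring.
Qed.

End radial.

(** * The rate function *)

Section powR_tools.
Variable R : realType.
Implicit Types a b x y : R.

Lemma ler_powRN a x y : 0 <= a -> 0 < x -> x <= y -> y `^ (- a) <= x `^ (- a).
Proof.
move=> a0 x0 xy; have y0 := lt_le_trans x0 xy.
rewrite !powRN lef_pV2 ?posrE ?powR_gt0//; apply: ge0_ler_powR => //.
- by rewrite nnegrE ltW.
- by rewrite nnegrE ltW.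
Qed.

(** [exp (x / m) >= x / m], raised to the power [m]. *)
Lemma powR_le_expR m x : 0 < m -> 0 <= x -> x `^ m <= m `^ m * expR x.
Proof.
move=> m0 x0; have -> : expR x = expR (x / m) `^ m.
  by rewrite -expRM divfK ?gt_eqF.
rewrite -powRM ?(ltW m0) ?expR_ge0//; apply: ge0_ler_powR.
- exact: ltW.
- by rewrite nnegrE.
- by rewrite nnegrE mulr_ge0 ?expR_ge0 ?(ltW m0).
rewrite -ler_pdivrMl// mulrC; apply: le_trans (expR_ge1Dx _); lra.
Qed.

Lemma stretched_exp_decay (e th a : R) : 0 < e -> 0 < th -> 0 < a ->
  exists2 K : R, 0 < K &
    forall r, 0 < r -> expR (- (e * r `^ th)) <= K * r `^ (- a).
Proof.
move=> e0 th0 a0; pose m := a / th.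
have m0 : 0 < m by rewrite divr_gt0.
exists (m `^ m / e `^ m); first by rewrite divr_gt0 ?powR_gt0.
move=> r r0; have u0 : 0 <= e * r `^ th by rewrite mulr_ge0 ?powR_ge0 ?ltW.
have := powR_le_expR m0 u0.
rewrite powRM ?powR_ge0 ?(ltW e0)// -powRrM (_ : th * m = a); last first.
  by rewrite /m mulrC divfK ?gt_eqF.
move=> H; rewrite expRN powRN -div1r ler_pdivrMr ?expR_gt0//.
have ra : 0 < r `^ a by rewrite powR_gt0.
have ea : 0 < e `^ m by rewrite powR_gt0.
rewrite -(ler_pM2l (mulr_gt0 ea ra)) mulr1; apply: le_trans H _.
rewrite le_eqVlt; apply/orP; left; apply/eqP; field.
by rewrite !gt_eqF.
Qed.

End powR_tools.

Section rate_function.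
Variables (R : realType) (al th C0 : R).
Hypotheses (al0 : 0 < al) (th0 : 0 < th) (C00 : 0 < C0).
Implicit Types b s lam e : R.

(** In units of the scale [L]: potential at the origin of an obstacle at distance
    [b] that is moved away by [s], plus the exponent of the law of this move. *)
Definition cost b s : R := C0 * (b + s) `^ (- al) + s `^ th.

Definition feasible b : set R := [set s | 0 <= s /\ 0 < b + s].

(** The integrand of the rate constant, as a function of the distance to the
    origin: the optimal displacement is radial. *)
Definition rate b : R := inf (cost b @` feasible b).

Lemma cost_ge0 b s : 0 <= cost b s.
Proof. by rewrite addr_ge0 ?mulr_ge0 ?powR_ge0 ?ltW. Qed.

Let lb b : lbound (cost b @` feasible b) 0.
Proof. by move=> _ [s _ <-]; exact: cost_ge0. Qed.

Let ne b : 0 <= b -> cost b @` feasible b !=set0.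
Proof. by move=> b0; exists (cost b 1), 1 => //; split=> //; lra. Qed.

Lemma rate_le b s : 0 <= s -> 0 < b + s -> rate b <= cost b s.
Proof.
by move=> s0 bs; apply: ge_inf; [exists 0; exact: lb|exists s].
Qed.

Lemma rate_ge b (K : R) : 0 <= b ->
  (forall s, 0 <= s -> 0 < b + s -> K <= cost b s) -> K <= rate b.
Proof.
move=> b0 H; apply: lb_le_inf; first exact: ne.
by move=> _ [s [s0 bs] <-]; exact: H.
Qed.

Lemma rate_ge0 b : 0 <= b -> 0 <= rate b.
Proof. by move=> b0; apply: rate_ge => // s _ _; exact: cost_ge0. Qed.

Lemma rate_attained b e : 0 <= b -> 0 < e ->
  exists s, [/\ 0 <= s, 0 < b + s & cost b s <= rate b + e].
Proof.
move=> b0 e0.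
have [_ [s [s0 bs] <-] H] := inf_adherent e0 (conj (ne b0) (ex_intro _ 0 (@lb b))).
by exists s; split => //; exact: ltW.
Qed.

Lemma rate_anti b b' : 0 <= b -> b <= b' -> rate b' <= rate b.
Proof.
move=> b0 bb; apply: rate_ge => // s s0 bs.
apply: le_trans (rate_le s0 _) _; first by apply: lt_le_trans bs _; rewrite lerD2r.
by rewrite lerD2r ler_wpM2l ?(ltW C00)// ler_powRN ?(ltW al0)// lerD2r.
Qed.

Lemma rate_le_const b : 0 <= b -> rate b <= C0 + 1.
Proof.
move=> b0; apply: le_trans (rate_le (s := 1) ler01 _) _; first by lra.
rewrite /cost powR1 lerD2r -[leRHS]mulr1 ler_wpM2l ?(ltW C00)//.
have : (b + 1) `^ (- al) <= 1 `^ (- al) by apply: ler_powRN; [exact: ltW| |lra].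
by rewrite powR1.
Qed.

Lemma rate_decay b : 0 < b -> rate b <= C0 * b `^ (- al).
Proof.
move=> b0; apply: le_trans (rate_le (s := 0) (lexx _) _) _; first by rewrite addr0.
by rewrite /cost addr0 powR0 ?addr0// gt_eqF.
Qed.

(** Scaling the displacement along with the distance multiplies the two terms of the
    cost by [lam^-al] and by [lam^th <= 1 <= lam^-al]. *)
Lemma rate_scale lam b : 0 < lam -> lam <= 1 -> 0 <= b ->
  rate (lam * b) <= lam `^ (- al) * rate b.
Proof.
move=> l0 l1 b0.
have p0 : 0 < lam `^ (- al) by rewrite powR_gt0.
rewrite -ler_pdivrMl//; apply: rate_ge => // s s0 bs.
rewrite ler_pdivrMl//; apply: le_trans (rate_le (s := lam * s) _ _) _.
- by rewrite mulr_ge0// ltW.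
- by rewrite -mulrDr mulr_gt0.
rewrite /cost -mulrDr powRM ?(ltW l0) ?(ltW bs)// powRM ?(ltW l0)//.
rewrite mulrDr (mulrCA C0) lerD2l ler_wpM2r ?powR_ge0//.
apply: (@le_trans _ _ 1).
  by rewrite -[leRHS](@powRr0 R lam) ger_powR ?l0 ?l1// ltW.
have : 1 `^ (- al) <= lam `^ (- al) by apply: ler_powRN => //; exact: ltW.
by rewrite powR1.
Qed.

Lemma measurable_rate : measurable_fun setT (fun b => rate (Num.max b 0)).
Proof.
apply: nonincreasing_measurable => // x y xy; apply: rate_anti.
- by rewrite le_max lexx orbT.
- by rewrite ge_max !le_max xy lexx !orbT.
Qed.

Section dimension.
Variable n : nat.
Hypothesis n1 : (1 <= n)%N.

(** For [q = 0] the direction is arbitrary, but there has to be one: the dimension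
    is positive. *)
Lemma exists_radial (q : 'rV[R]_n) (s : R) : 0 <= s ->
  exists y : 'rV[R]_n, enorm y = s /\ enorm (q + y) = enorm q + s.
Proof.
move=> s0; have [->|q0] := eqVneq q 0.
  have [e e1] : exists e : 'rV[R]_n, enorm e = 1.
    case: n n1 => // m _; exists (\row_i (i == ord0)%:R).
    rewrite /enorm (bigD1 ord0)//= mxE eqxx big1 ?expr1n ?addr0 ?sqrtr1// => i i0.
    by rewrite mxE (negbTE i0) expr0n.
  by exists (s *: e); rewrite add0r enormZ e1 mulr1 enorm0 add0r ger0_norm.
have eq0 : enorm q != 0 by rewrite enorm_eq0.
have c0 : 0 <= s / enorm q by rewrite divr_ge0 ?enorm_ge0.
exists ((s / enorm q) *: q); split; first by rewrite enormZ ger0_norm ?divfK.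
have -> : q + (s / enorm q) *: q = (1 + s / enorm q) *: q.
  by rewrite scalerDl scale1r.
by rewrite enormZ ger0_norm ?addr_ge0// mulrDl mul1r divfK.
Qed.

(** By the triangle inequality, a displacement of given length is best made radially
    outwards. The point [y = - q], where the potential term is infinite, is the reason
    for the constraint [0 < b + s] in [feasible]. *)
Lemma rate_integrand (q : 'rV[R]_n) :
  ereal_inf [set (C0%:E / (enorm (q + y) `^ al)%:E + (enorm y `^ th)%:E)%E
     | y in [set: 'rV[R]_n]] = (rate (enorm q))%:E.
Proof.
have inv (r : R) : 0 < r -> ((C0%:E / (r `^ al)%:E)%E = (C0 * r `^ (- al))%:E :> \bar R).
  by move=> r0; rewrite inver gt_eqF ?powR_gt0// powRN.
apply/eqP; rewrite eq_le; apply/andP; split.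
  apply/lee_addgt0Pr => e e0.
  have [s [s0 qs H]] := rate_attained (enorm_ge0 q) e0.
  have [y [ys qy]] := exists_radial q s0.
  apply: le_trans (ereal_inf_lbound _) _.
    by exists y.
  by rewrite qy ys inv// -!EFinD lee_fin.
apply/le_ereal_inf_tmp => _ [y _ <-].
have [qy0|qy0] := eqVneq (enorm (q + y)) 0.
  rewrite qy0 powR0 ?gt_eqF// inver eqxx gt0_muley ?lte_fin//.
  by rewrite addye// leey.
have qy : 0 < enorm (q + y) by rewrite lt_neqAle eq_sym qy0 enorm_ge0.
rewrite inv// -EFinD lee_fin.
have qyle := enormD q y.
apply: le_trans (rate_le (s := enorm y) (enorm_ge0 _) _) _.
  exact: lt_le_trans qyle.
by rewrite lerD2r ler_wpM2l ?(ltW C00)// ler_powRN// ltW.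
Qed.

End dimension.
End rate_function.

(** * Lattice sums *)

Section lattice_sums.
Variables (R : realType) (n : nat).
Implicit Types (L M a : R) (q : 'rV[int]_n) (z : 'rV[R]_n).

Local Notation zn q := (enorm (of_Zd R q)).

Lemma lat_le z : zn (lat z) <= enorm z + n%:R.
Proof.
have := lat_dist z; have := enormD (of_Zd R (lat z) - z) z.
by rewrite subrK; lra.
Qed.

Lemma lat_ge z : enorm z <= zn (lat z) + n%:R.
Proof.
have := lat_dist z; have := enormD (of_Zd R (lat z)) (z - of_Zd R (lat z)).
by rewrite addrC subrK -(enormN (z - _)) opprB; lra.
Qed.

Definition lattice_ball M : set 'rV[int]_n := [set q | zn q <= M].

(** Counting by volume: the unit cells of these points lie in the closed ball of
    radius [M + n]. *)
Lemma esum_lattice_ball M : 0 <= M ->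
  (\esum_(q in [set: 'rV[int]_n]) (\1_(lattice_ball M) q)%:E <=
   ((2 * (M + n%:R + 1)) ^+ n)%:E :> \bar R)%E.
Proof.
move=> M0; have := @integral_lat R n 1 (fun q => (\1_(lattice_ball M) q)%:E) ltr01.
rewrite expr1n invr1 mul1e => <-; last by move=> q; rewrite lee_fin.
apply: le_trans (lebesgue_measure_eball n _); last by rewrite !addr_ge0.
rewrite -[leRHS]mul1e -[leRHS]integral_cst; last exact: measurable_eball.
rewrite [leRHS]integral_mkcond; apply: ge0_le_integral_nomeas => z _.
  by rewrite lee_fin.
rewrite scale1r patchE indicE; case: ifPn => [_|/negP zM].
  by rewrite lee_fin lern1; case: (_ \in _).
rewrite memNset// => /= zM'; apply: zM; rewrite inE /eball/=.
by have := lat_ge z; rewrite /lattice_ball/= in zM'; lra.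
Qed.

Lemma size_lattice_ball M (s : seq 'rV[int]_n) : 0 <= M -> uniq s ->
  (forall q, q \in s -> zn q <= M) ->
  (size s)%:R <= (2 * (M + n%:R + 1)) ^+ n.
Proof.
move=> M0 us sM; rewrite -lee_fin; apply: le_trans (esum_lattice_ball M0).
apply: le_trans (esum_ge_sum us _); last by move=> q; rewrite lee_fin.
rewrite (eq_big_seq (fun=> 1%E)); last first.
  by move=> q /sM qM; rewrite indicE mem_set.
by rewrite sumEFin big_const_seq count_predT iter_addr_0.
Qed.

Lemma finite_lattice_ball M : finite_set (lattice_ball M).
Proof.
apply: contrapT => inf.
pose K := (Num.truncn ((2 * (`|M| + n%:R + 1)) ^+ n : R)).+1.
have [X XM KX] := infinite_set_fset K inf.
have := @size_lattice_ball `|M| (finmap.enum_fset X) (normr_ge0 _) (finmap.fset_uniq X).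
have H q : q \in finmap.enum_fset X -> zn q <= `|M|.
  by move=> /XM qM; apply: le_trans qM (ler_norm _).
move=> /(_ H); apply/negP; rewrite -ltNge.
apply: (@lt_le_trans _ _ K%:R); last by rewrite ler_nat.
have : 0 <= (2 * (`|M| + n%:R + 1)) ^+ n :> R by rewrite exprn_ge0// mulr_ge0// !addr_ge0.
by move=> /truncn_itv/andP[].
Qed.

Definition ball_seq M : seq 'rV[int]_n := finmap.enum_fset (fset_set (lattice_ball M)).

Lemma ball_seq_uniq M : uniq (ball_seq M). Proof. exact: finmap.fset_uniq. Qed.

Lemma mem_ball_seq M q : (q \in ball_seq M) = (zn q <= M).
Proof.
have := in_fset_set (finite_lattice_ball M) q; rewrite /ball_seq => ->.
by apply/idP/idP; rewrite inE.
Qed.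

Lemma size_ball_seq M : 0 <= M -> (size (ball_seq M))%:R <= (2 * (M + n%:R + 1)) ^+ n.
Proof.
move=> M0; apply: size_lattice_ball => //; first exact: ball_seq_uniq.
by move=> q; rewrite mem_ball_seq.
Qed.

Lemma size_ball_seq_scale r L : 0 <= r -> 1 <= L ->
  (size (ball_seq (r * L)))%:R <= (2 * (r + n%:R + 1)) ^+ n * L ^+ n.
Proof.
move=> r0 L1; have L0 : 0 <= L by rewrite (le_trans ler01).
apply: le_trans (size_ball_seq _) _; first exact: mulr_ge0.
rewrite -exprMn; apply: lerXn2r; rewrite ?nnegrE ?mulr_ge0 ?addr_ge0 ?mulr_ge0//.
rewrite -mulrA ler_wpM2l//; have : n%:R + 1 <= (n%:R + 1) * L by rewrite ler_peMr// addr_ge0.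
by lra.
Qed.

(** Outside a ball of radius [M >= 2n], rounding changes norms by a factor of at
    most 2, so that the lattice sum is dominated by the integral. *)
Lemma esum_tail a : n%:R < a -> exists2 K : R, 0 < K & forall M, 2 * n%:R <= M -> 0 < M ->
  (\esum_(q in [set: 'rV[int]_n]) (if M < zn q then zn q `^ (- a) else 0)%:E
    <= (K * M `^ (n%:R - a))%:E :> \bar R)%E.
Proof.
move=> na; have a0 : 0 < a by rewrite (le_lt_trans _ na).
have rho1 : 2 `^ (n%:R - a) < 1 :> R by exact: powR2_lt1.
pose C := (4 ^+ n / (1 - 2 `^ (n%:R - a))) : R.
have C0 : 0 < C by rewrite divr_gt0 ?exprn_gt0// subr_gt0.
have h0 : 0 < 2^-1 :> R by rewrite invr_gt0.
exists (2 `^ a * (C * (2^-1) `^ (n%:R - a))).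
  apply: mulr_gt0; first exact: powR_gt0.
  by apply: mulr_gt0 => //; exact: powR_gt0.
move=> M nM M0.
have := @integral_lat R n 1 (fun q => (if M < zn q then zn q `^ (- a) else 0)%:E) ltr01.
rewrite expr1n invr1 mul1e => <-; last by move=> q; rewrite lee_fin; case: ifP => // _; exact: powR_ge0.
have M20 : 0 < M / 2 by rewrite divr_gt0.
apply: (@le_trans _ _ ((2 `^ a)%:E * \int[lebesgue_measure_rv n]_(z in outside (M / 2)) (enorm z `^ (- a))%:E)%E).
  have mp : measurable_fun (outside (M / 2)) (fun z : 'rV[R]_n => (enorm z `^ (- a))%:E).
    by apply: measurable_funTS; exact: measurable_enorm_powR.
  rewrite -(ge0_integralZl (lebesgue_measure_rv n) (measurable_outside _) mp); last 2 first.
  - by move=> z _; rewrite lee_fin powR_ge0.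
  - by rewrite lee_fin powR_ge0.
  rewrite [leRHS]integral_mkcond; apply: ge0_le_integral_nomeas => z _.
    by rewrite lee_fin; case: ifP => // _; exact: powR_ge0.
  rewrite scale1r; have hl := lat_le z; have hg := lat_ge z.
  rewrite patchE; case: ifPn => Mq; case: ifPn => [Mz|/negP Mz].
  - have q0 : 0 < zn (lat z) by exact: lt_trans Mq.
    have z0 : 0 < enorm z by apply: lt_le_trans M20 _; move: Mz; rewrite inE.
    rewrite -EFinM lee_fin !powRN ler_pdivlMr ?powR_gt0// mulrC.
    rewrite ler_pdivrMr ?powR_gt0// -powRM ?(ltW q0)//.
    apply: ge0_ler_powR; rewrite ?nnegrE ?mulr_ge0 ?(ltW q0) ?(ltW z0) ?(ltW a0)//.
    by lra.
  - by exfalso; apply: Mz; rewrite inE /outside/=; lra.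
  - by rewrite -EFinM lee_fin mulr_ge0 ?powR_ge0.
  - by [].
apply: le_trans (lee_wpmul2l _ (integral_tail na M20)) _; first by rewrite lee_fin powR_ge0.
rewrite -EFinM lee_fin -/C (mulrC M) powRM ?invr_ge0 ?(ltW M0)//.
by rewrite !mulrA.
Qed.

End lattice_sums.

(** * Riemann sums of the rate *)

Section powR_limits.
Variable R : realType.
Implicit Types al e M : R.

Lemma powR_near1 al e : 0 < al -> 0 < e -> exists lam, [/\ 0 < lam, lam < 1 & lam `^ (- al) = 1 + e].
Proof.
move=> al0 e0; have e1 : 0 < 1 + e by rewrite addr_gt0.
have ne : al != 0 by rewrite gt_eqF.
exists ((1 + e) `^ (- al^-1)); split.
- exact: powR_gt0.
- rewrite powRN invf_lt1 ?powR_gt0//.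
  have : 1 `^ al^-1 < (1 + e) `^ al^-1.
    by apply: gt0_ltr_powR; rewrite ?nnegrE ?invr_gt0 ?(ltW e1)// ltrDl.
  by rewrite powR1.
- by rewrite -powRrM mulrNN mulVf// powRr1// ltW.
Qed.

Lemma powR_small (K b e : R) : 0 < K -> 0 < b -> 0 < e ->
  exists2 M, 0 < M & K * M `^ (- b) <= e.
Proof.
move=> K0 b0 e0; exists ((K / e) `^ b^-1); first by rewrite powR_gt0 ?divr_gt0.
rewrite -powRrM mulrN mulVf ?gt_eqF// powR_inv1; last by rewrite ltW// divr_gt0.
have -> : K / (K / e) = e by field; rewrite !gt_eqF.
exact: lexx.
Qed.

End powR_limits.

Section riemann_sums.
Variables (R : realType) (n : nat) (al th C0 : R).
Hypotheses (n1 : (1 <= n)%N) (nal : n%:R < al) (th0 : 0 < th) (C00 : 0 < C0).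
Implicit Types (L M m e lam : R) (q : 'rV[int]_n) (z : 'rV[R]_n).

Local Notation zn q := (enorm (of_Zd R q)).
Local Notation mu := (lebesgue_measure_rv n : set 'rV[R]_n -> \bar R).
Local Notation G b := (rate al th C0 b).

Let al0 : 0 < al. Proof. exact: le_lt_trans nal. Qed.

Lemma expr_small (K e : R) : 0 < K -> 0 < e ->
  exists2 m, 0 < m & K * (2 * m) ^+ n <= e.
Proof.
move=> K0 e0; exists (Num.min (1 / 2) (e / (2 * K))).
  by rewrite lt_min !divr_gt0// mulr_gt0.
set m := Num.min _ _.
have m1 : m <= 1 / 2 by rewrite ge_min lexx.
have m2 : m <= e / (2 * K) by rewrite ge_min lexx orbT.
have m0 : 0 <= m by rewrite le_min !divr_ge0 ?mulr_ge0 ?ltW.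
rewrite ler_pdivlMr ?mulr_gt0// in m2.
apply: (@le_trans _ _ (K * (2 * m))); last by lra.
rewrite ler_pM2l//; case: n n1 => // k _.
rewrite exprS ler_piMr ?mulr_ge0// exprn_ile1 ?mulr_ge0//; lra.
Qed.

Lemma rate_enorm_ge0 z : 0 <= G (enorm z).
Proof. by apply: rate_ge0 => //; exact: enorm_ge0. Qed.

Lemma measurable_rate_enorm :
  measurable_fun setT (fun z : 'rV[R]_n => (G (enorm z))%:E).
Proof.
apply/measurable_EFinP.
have -> : (fun z : 'rV[R]_n => G (enorm z)) =
    (fun b => G (Num.max b 0)) \o @enorm R n.
  by apply/funext => z /=; rewrite max_l// enorm_ge0.
by apply: measurableT_comp; [exact: measurable_rate|exact: measurable_enorm].
Qed.

Definition rate_integral : \bar R := (\int[mu]_z (G (enorm z))%:E)%E.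

Let ballterm (K m : R) (z : 'rV[R]_n) : \bar R := (K%:E * (\1_(eball n m) z)%:E)%E.

Let mball K m : measurable_fun setT (ballterm K m).
Proof.
apply: measurable_funeM; apply/measurable_EFinP; apply: measurable_indic.
exact: measurable_eball.
Qed.

Let ball0 K m z : 0 <= K -> (0 <= ballterm K m z)%E.
Proof. by move=> K0; rewrite mule_ge0// lee_fin. Qed.

Let iball K m : 0 <= K -> 0 <= m ->
  (\int[mu]_z ballterm K m z <= (K * (2 * m) ^+ n)%:E)%E.
Proof.
move=> K0 m0; have mi : measurable_fun setT (fun z => (\1_(eball n m) z)%:E : \bar R).
  apply/measurable_EFinP; apply: measurable_indic; exact: measurable_eball.
rewrite ge0_integralZl//.
rewrite integral_indic//; last exact: measurable_eball.
by rewrite setIT EFinM lee_wpmul2l// lebesgue_measure_eball.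
Qed.

Let tailterm M (z : 'rV[R]_n) : \bar R :=
  (C0%:E * ((fun z => (enorm z `^ (- al))%:E) \_ (outside M : set 'rV[R]_n)) z)%E.

Let mtail M : measurable_fun setT (tailterm M).
Proof.
apply: measurable_funeM; apply/(measurable_restrictT _ (measurable_outside _)).
by apply: measurable_funTS; exact: measurable_enorm_powR.
Qed.

Let tail0 M z : (0 <= tailterm M z)%E.
Proof.
rewrite mule_ge0 ?lee_fin ?(ltW C00)// patchE; case: ifP => // _.
by rewrite lee_fin powR_ge0.
Qed.

Definition tail_const : R := 4 ^+ n / (1 - 2 `^ (n%:R - al)).

Let itail M : 0 < M ->
  (\int[mu]_z tailterm M z <= (C0 * (tail_const * M `^ (n%:R - al)))%:E)%E.
Proof.
move=> M0; rewrite ge0_integralZl//.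
- by rewrite -integral_mkcond EFinM lee_wpmul2l ?lee_fin ?(ltW C00)// integral_tail.
- apply/(measurable_restrictT _ (measurable_outside _)).
  by apply: measurable_funTS; exact: measurable_enorm_powR.
- by move=> z _; rewrite patchE; case: ifP => // _; rewrite lee_fin powR_ge0.
- by rewrite lee_fin ltW.
Qed.

(** The ball of radius [m] and the complement of the ball of radius [M] contribute
    little: the rate is bounded on the former and decays like [|z|^-al] on the latter. *)
Lemma rate_integral_split (f : 'rV[R]_n -> \bar R) m M : 0 < m -> 0 < M ->
  measurable_fun setT f -> (forall z, 0 <= f z)%E ->
  (forall z, (m <= enorm z)%R -> (enorm z < M)%R -> (G (enorm z))%:E <= f z)%E ->
  (rate_integral <= \int[mu]_z f z + ((C0 + 1) * (2 * m) ^+ n)%:E +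
    (C0 * (tail_const * M `^ (n%:R - al)))%:E)%E.
Proof.
move=> m0 M0 mf f0 H; have C1 : 0 <= C0 + 1 by rewrite addr_ge0// ltW.
apply: (@le_trans _ _ (\int[mu]_z (f z + ballterm (C0 + 1) m z + tailterm M z))%E).
  apply: ge0_le_integral_nomeas => z _; first by rewrite lee_fin rate_enorm_ge0.
  have [zm|mz] := ltP (enorm z) m.
    apply: (@le_trans _ _ (ballterm (C0 + 1) m z)).
      rewrite /ballterm indicE mem_set// mule1 lee_fin.
      by apply: rate_le_const => //; exact: enorm_ge0.
    by rewrite -addeA addeCA leeDl// adde_ge0.
  have [zM|Mz] := ltP (enorm z) M.
    by apply: le_trans (H _ mz zM) _; rewrite -addeA leeDl// adde_ge0// ball0.
  apply: (@le_trans _ _ (tailterm M z)); last by rewrite leeDr// adde_ge0// ball0.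
  rewrite /tailterm patchE mem_set// -EFinM lee_fin.
  by apply: rate_decay => //; exact: lt_le_trans Mz.
have mfb : measurable_fun setT (fun z => f z + ballterm (C0 + 1) m z)%E.
  by apply: emeasurable_funD.
rewrite ge0_integralD//; last by move=> z _; rewrite adde_ge0// ball0.
rewrite ge0_integralD//; last by move=> z _; exact: ball0.
by apply: leeD; [apply: leeD => //; apply: iball => //; exact: ltW|exact: itail].
Qed.

Lemma rate_integral_fin : rate_integral \is a fin_num.
Proof.
rewrite ge0_fin_numE; last by apply: integral_ge0 => z _; rewrite lee_fin rate_enorm_ge0.
apply: le_lt_trans (rate_integral_split (f := cst 0%E) ltr01 ltr01 _ _ _) _ => //.
- by move=> z h1 h2; have := le_lt_trans h1 h2; rewrite ltxx.
- by rewrite integral0 add0e -EFinD ltry.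
Qed.

Lemma rate_constantE : rate_constant n al th C0 = fine rate_integral.
Proof.
rewrite /rate_constant; congr fine; apply: eq_integral => z _.
exact: rate_integrand.
Qed.

Let c : R := rate_constant n al th C0.

Let cE : rate_integral = c%:E.
Proof. by rewrite /c rate_constantE fineK// rate_integral_fin. Qed.

Lemma rate_constant_ge0 : 0 <= c.
Proof.
by rewrite -lee_fin -cE; apply: integral_ge0 => z _; rewrite lee_fin rate_enorm_ge0.
Qed.

Lemma eta_small e : 0 < e -> exists2 eta, 0 < eta & eta * c <= e.
Proof.
move=> e0; exists (e / (c + 1)); first by rewrite divr_gt0// ltr_wpDl// rate_constant_ge0.
rewrite mulrAC ler_pdivrMr; last by rewrite ltr_wpDl// rate_constant_ge0.
by rewrite ler_pM2l// lerDl.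
Qed.

(** Rounding to the lattice changes the distances that are at least [m] by a relative
    amount that vanishes for large [L], and [rate_scale] turns a relative change of the
    distance into a relative change of the rate. *)
Lemma riemann_rate_upper e : 0 < e -> exists2 L0, 0 < L0 & forall L, L0 <= L ->
  (\esum_(q in [set: 'rV[int]_n]) (G (zn q / L))%:E <= (L ^+ n * (c + e))%:E)%E.
Proof.
move=> e0; have e20 : 0 < e / 2 by rewrite divr_gt0.
have C1 : 0 < C0 + 1 by rewrite addr_gt0.
have [eta eta0 etac] := eta_small e20.
have [lam [l0 l1 lE]] := powR_near1 al0 eta0.
have [m m0 me] := expr_small C1 e20.
have ml : 0 < m * (1 - lam) by rewrite mulr_gt0// subr_gt0.
have nR : 0 < n%:R :> R by rewrite ltr0n.
(* From this L on, the rounding error n / L is at most m (1 - lam). *)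
exists (n%:R / (m * (1 - lam))); first exact: divr_gt0.
move=> L; rewrite ler_pdivrMr// => nL.
have L0 : 0 < L by rewrite -(pmulr_lgt0 _ ml); exact: lt_le_trans nL.
have g0 q : 0 <= G (zn q / L).
  by apply: rate_ge0 => //; rewrite divr_ge0 ?enorm_ge0// ltW.
have Ln : 0 < L ^+ n by rewrite exprn_gt0.
rewrite EFinM -lee_pdivrMl//; rewrite -(@integral_lat R n L (fun q => (G (zn q / L))%:E))//.
apply: (@le_trans _ _ (\int[mu]_z ((1 + eta)%:E * (G (enorm z))%:E + ballterm (C0 + 1) m z))%E).
  apply: ge0_le_integral_nomeas => z _; first by rewrite lee_fin.
  have [zm|mz] := ltP (enorm z) m.
    rewrite /ballterm indicE mem_set// mule1 -EFinM -EFinD lee_fin.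
    apply: (@le_trans _ _ (C0 + 1)).
      by apply: rate_le_const => //; rewrite divr_ge0 ?enorm_ge0// ltW.
    by rewrite lerDr mulr_ge0 ?rate_enorm_ge0// ltW// addr_gt0.
  apply: (@le_trans _ _ ((1 + eta)%:E * (G (enorm z))%:E)%E); last first.
    by rewrite leeDl// ball0// ltW.
  rewrite -EFinM lee_fin -lE; apply: le_trans (rate_scale _ _ _ _ _ _) => //; rewrite ?enorm_ge0 ?(ltW l1)//.
  apply: rate_anti => //; first by rewrite mulr_ge0 ?enorm_ge0// ltW.
  rewrite ler_pdivlMr//.
  have := lat_ge (L *: z); rewrite enormZ gtr0_norm// => hz.
  have : m * (1 - lam) * L <= (1 - lam) * L * enorm z.
    by rewrite -mulrA mulrC ler_pM2l// mulr_gt0// subr_gt0.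
  by move: hz nL; lra.
have mG : measurable_fun setT (fun z : 'rV[R]_n => (1 + eta)%:E * (G (enorm z))%:E)%E.
  by apply: measurable_funeM; exact: measurable_rate_enorm.
have e1 : 0 <= 1 + eta by rewrite ltW// addr_gt0.
rewrite ge0_integralD//; last 2 first.
- by move=> z _; rewrite mule_ge0// lee_fin rate_enorm_ge0.
- by move=> z _; apply: ball0; exact: ltW.
rewrite ge0_integralZl//; last 2 first.
- exact: measurable_rate_enorm.
- by move=> z _; rewrite lee_fin rate_enorm_ge0.
rewrite [X in (_ * X)%E]cE.
apply: le_trans (leeD (lexx _) (iball (ltW C1) (ltW m0))) _.
by rewrite -EFinM -EFinD lee_fin; lra.
Qed.

Lemma esum_ball_seq (f : 'rV[int]_n -> R) M : (forall q, 0 <= f q) ->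
  (\esum_(q in [set: 'rV[int]_n]) (if zn q <= M then f q else 0)%:E =
   (\sum_(q <- ball_seq n M) f q)%:E :> \bar R)%E.
Proof.
move=> f0; rewrite -sumEFin /ball_seq -fsbig_finite; last exact: finite_lattice_ball.
rewrite -esum_fset; [|exact: finite_lattice_ball|by move=> q _; rewrite lee_fin].
rewrite [RHS]esum_mkcond; apply: eq_esum => q _; rewrite /lattice_ball.
case: ifPn => qM; first by rewrite mem_set.
by rewrite memNset//=; apply/negP.
Qed.

(** The shift by [n%:R] leaves room for an observer who is not at a lattice point. *)
Lemma riemann_rate_lower e : 0 < e -> exists R0 L0, [/\ 0 < R0, 0 < L0 & forall L, L0 <= L ->
  L ^+ n * (c - e) <= \sum_(q <- ball_seq n (R0 * L)) G ((zn q + n%:R) / L)].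
Proof.
move=> e0; have e20 : 0 < e / 2 by rewrite divr_gt0.
have e40 : 0 < e / 4 by rewrite divr_gt0.
have C1 : 0 < C0 + 1 by rewrite addr_gt0.
have [eta eta0 etac] := eta_small e20.
have [lam [l0 l1 lE]] := powR_near1 al0 eta0.
have [m m0 me] := expr_small C1 e40.
have rho1 : 2 `^ (n%:R - al) < 1 :> R by exact: powR2_lt1.
have tc0 : 0 < tail_const by rewrite divr_gt0 ?exprn_gt0// subr_gt0.
have [M M0 Me] : exists2 M : R, 0 < M & C0 * (tail_const * M `^ (n%:R - al)) <= e / 4.
  have [|||M M0 Me] := @powR_small R (C0 * tail_const) (al - n%:R) (e / 4) => //.
  - exact: mulr_gt0.
  - by rewrite subr_gt0.
  - by exists M => //; rewrite mulrA -opprB.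
have ml : 0 < m * (1 - lam) by rewrite mulr_gt0// subr_gt0.
have nR : 0 < n%:R :> R by rewrite ltr0n.
exists (M + 1), (Num.max n%:R (2 * n%:R / (m * (1 - lam)))); split.
- by rewrite addr_gt0.
- by rewrite lt_max nR.
move=> L; rewrite ge_max ler_pdivrMr// => /andP[nL n2L].
have L0 : 0 < L by exact: lt_le_trans nL.
have g0 q : 0 <= G ((zn q + n%:R) / L).
  by apply: rate_ge0 => //; rewrite divr_ge0 ?addr_ge0 ?enorm_ge0// ltW.
have Ln : 0 < L ^+ n by rewrite exprn_gt0.
pose h q : \bar R := (if zn q <= (M + 1) * L then G ((zn q + n%:R) / L) else 0)%:E.
have h0 q : (0 <= h q)%E by rewrite lee_fin; case: ifP.
have mh := measurable_lat L0 h0.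
have e1 : 0 < 1 + eta by rewrite addr_gt0.
have := @rate_integral_split (fun z => (1 + eta)%:E * h (lat (L *: z)))%E m M m0 M0 _ _ _.
rewrite ge0_integralZl//; last by rewrite lee_fin ltW.
rewrite integral_lat// esum_ball_seq// cE -!EFinM -!EFinD lee_fin => H.
have {}H : c <= (1 + eta) * (L ^- n * \sum_(q <- ball_seq n ((M + 1) * L)) G ((zn q + n%:R) / L)) + e / 4 + e / 4.
  apply: le_trans (H _ _ _) _.
  - by apply: measurable_funeM.
  - by move=> z; rewrite mule_ge0// lee_fin ltW.
  - move=> z mz zM.
    have hz := lat_le (L *: z); rewrite enormZ gtr0_norm// in hz.
    rewrite /h ifT; last first.
      by apply: le_trans hz _; have := ltW zM; rewrite -(ler_pM2l L0); lra.
    rewrite -EFinM lee_fin -lE.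
    have z0 : 0 <= enorm z / lam by rewrite divr_ge0 ?enorm_ge0// ltW.
    rewrite -{1}(divfK (lt0r_neq0 l0) (enorm z)) mulrC.
    apply: le_trans (rate_scale al0 th0 C00 l0 (ltW l1) z0) _.
    rewrite ler_pM2l ?powR_gt0//; apply: rate_anti => //.
      by rewrite divr_ge0 ?addr_ge0 ?enorm_ge0// ltW.
    rewrite ler_pdivlMr// mulrAC ler_pdivrMr//.
    have : m * (1 - lam) * L <= (1 - lam) * L * enorm z.
      by rewrite -mulrA mulrC ler_pM2l// mulr_gt0// subr_gt0.
    by move: hz n2L; nra.
  - by rewrite !lerD.
set S := \sum_(q <- _) _ in H *; rewrite -ler_pdivlMl//.
set S' := L ^- n * S in H *.
rewrite -(ler_pM2l e1); nra.
Qed.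

End riemann_sums.

(** * Law of the displacements *)

Section lattice_measurability.
Variables (R : realType) (d : nat).

Lemma measurable_rv_int (A : set 'rV[int]_d) : measurable A.
Proof.
apply: countable_measurable; last exact: countableP.
move=> q; rewrite (_ : [set q] = \bigcap_(i in [set: 'I_d]) ((fun x : 'rV[int]_d => x ord0 i) @^-1` [set q ord0 i])).
  apply: fin_bigcap_measurable => [|i _]; first exact: finite_finset.
  by rewrite -[X in measurable X]setTI; exact: measurable_coord_rv.
apply/seteqP; split => x /=; first by move=> -> i _.
by move=> H; apply/rowP => i; exact: H.
Qed.

Lemma measurable_of_Zd_coord (i : 'I_d) :
  measurable_fun setT (fun q : 'rV[int]_d => of_Zd R q ord0 i).
Proof. by move=> _ Y mY; exact: measurable_rv_int. Qed.

End lattice_measurability.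

Section stretched_sums.
Variables (R : realType) (n : nat).
Local Notation zn q := (enorm (of_Zd R q)).

Lemma esum_stretched_fin (e th : R) : 0 < e -> 0 < th ->
  (\esum_(q in [set: 'rV[int]_n]) (expR (- (e * zn q `^ th)))%:E < +oo :> \bar R)%E.
Proof.
move=> e0 th0; pose a : R := n%:R + 1.
have a0 : 0 < a by rewrite ltr_wpDl.
have na : n%:R < a by rewrite ltrDl.
have [K K0 HK] := stretched_exp_decay e0 th0 a0.
have [C C0 HC] := esum_tail na.
pose M : R := 2 * n%:R + 1.
have M0 : 0 < M by rewrite ltr_wpDl// mulr_ge0.
have nM : 2 * n%:R <= M by rewrite lerDl.
apply: (@le_lt_trans _ _ (\esum_(q in [set: 'rV[int]_n]) ((if zn q <= M then 1 else 0)%:E +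
    K%:E * (if M < zn q then zn q `^ (- a) else 0)%:E)))%E.
  apply: le_esum => q _; have [qM|Mq] := leP (zn q) M.
    rewrite mule0 adde0 lee_fin -expR0 ler_expR oppr_le0 mulr_ge0 ?powR_ge0//.
    exact: ltW.
  rewrite add0e -EFinM lee_fin; apply: HK; exact: lt_trans Mq.
rewrite esumD; last 2 first.
- by move=> q _; rewrite lee_fin; case: ifP.
- by move=> q _; rewrite mule_ge0// lee_fin ?(ltW K0)//; case: ifP => // _; exact: powR_ge0.
rewrite esum_ball_seq// esumZl ?(ltW K0)// => [|q]; last first.
  by rewrite lee_fin; case: ifP => // _; exact: powR_ge0.
rewrite lte_add_pinfty ?ltry//; apply: le_lt_trans (lee_wpmul2l _ (HC M nM M0)) _.
  by rewrite lee_fin ltW.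
by rewrite -EFinM ltry.
Qed.

Definition stretched_sum (th e : R) : R :=
  fine (\esum_(q in [set: 'rV[int]_n]) (expR (- (e * zn q `^ th)))%:E).

Lemma stretched_sumE (th e : R) : 0 < th -> 0 < e ->
  (\esum_(q in [set: 'rV[int]_n]) (expR (- (e * zn q `^ th)))%:E = (stretched_sum th e)%:E)%E.
Proof.
move=> th0 e0; rewrite /stretched_sum fineK// ge0_fin_numE; first exact: esum_stretched_fin.
by apply: esum_ge0 => k _; rewrite lee_fin expR_ge0.
Qed.

Lemma stretched_sum_ge1 (th e : R) : 0 < th -> 0 < e -> 1 <= stretched_sum th e.
Proof.
move=> th0 e0; rewrite -lee_fin -stretched_sumE//.
apply: le_trans (@esum_ge_sum R _ (fun q => (expR (- (e * zn q `^ th)))%:E) [:: 0] isT _); last first.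
  by move=> q; rewrite lee_fin expR_ge0.
rewrite big_seq1 (_ : of_Zd R 0 = 0); last by apply/rowP => i; rewrite !mxE.
by rewrite enorm0 powR0 ?gt_eqF// mulr0 oppr0 expR0.
Qed.

End stretched_sums.

Section displacements.
Variables (R : realType) (d : nat) (theta : R).
Hypothesis th0 : 0 < theta.
Context dO (O : measurableType dO) (P : probability O R).
Variable xi : 'rV[int]_d -> O -> 'rV[int]_d.
Hypothesis iid : iid_displacements P theta xi.

Local Notation zn q := (enorm (of_Zd R q)).

Definition lattice_partition : R := stretched_sum d theta 1.

Local Notation Z := lattice_partition.

Lemma lattice_partitionE :
  (\esum_(k in [set: 'rV[int]_d]) @lattice_weight R theta d k = Z%:E)%E.
Proof.
rewrite -stretched_sumE//; apply: eq_esum => q _.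
by rewrite /lattice_weight mul1r.
Qed.

Lemma lattice_partition_ge1 : 1 <= Z.
Proof. exact: stretched_sum_ge1. Qed.

Let Z0 : 0 < Z. Proof. exact: lt_le_trans lattice_partition_ge1. Qed.

Lemma displacement_prob q p :
  (P (xi q @^-1` [set p]) = (expR (- (zn p `^ theta)) / Z)%:E)%E.
Proof.
have [_ _ ->] := iid; rewrite lattice_partitionE /lattice_weight inver.
by rewrite gt_eqF// -EFinM.
Qed.

Lemma displacement_integral q (f : 'rV[int]_d -> R) : (forall p, 0 <= f p) ->
  (\int[P]_om (f (xi q om))%:E =
   \esum_(p in [set: 'rV[int]_d]) (f p * (expR (- (zn p `^ theta)) / Z))%:E)%E.
Proof.
move=> f0; have [mxi _ _] := iid.
rewrite (integral_discrete P (X := xi q) (f := fun p => (f p)%:E))//; last first.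
  by move=> p; rewrite -[X in measurable X]setTI; apply: mxi => //; exact: measurable_rv_int.
by apply: eq_esum => p _; rewrite [X in (_ * X)%E]displacement_prob -EFinM.
Qed.

End displacements.

(** * The contribution of one obstacle *)

Section good_points.
Variables (R : realType) (d : nat) (u : 'rV[R]_d -> R).
Hypothesis mu : measurable_fun setT u.

Lemma measurable_lattice_shift (S : set 'rV[R]_d) (q : 'rV[int]_d) :
  measurable S -> measurable [set y | S (y - of_Zd R q)].
Proof.
move=> mS; have ms : measurable_fun setT (fun y : 'rV[R]_d => y - of_Zd R q).
  apply: measurable_fun_rvP => i; under eq_fun do rewrite mxE.
  by apply: measurable_funD => //; exact: measurable_coord_rv.
by rewrite -[X in measurable X]setTI; exact: ms.
Qed.

(** Outside of a set that Brownian motion avoids at fixed times, the lower bound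
    given by the essential infimum holds at all lattice translates. *)
Lemma good_points (r : R) :
  (0 < ess_inf (mrestr (lebesgue_measure_rv d) (measurable_eball r)) (EFin \o u))%E ->
  exists (c : R) (N : set 'rV[R]_d),
    [/\ 0 < c, measurable N,
        forall dW (W : measurableType dW) (Q : probability W R) x B,
          brownian_motion Q x B -> forall s, 0 < s -> (Q [set w | N (B s w)] = 0)%E &
        forall y, ~ N y -> forall q, enorm (y - of_Zd R q) < r -> c <= u (y - of_Zd R q)].
Proof.
set E := ess_inf _ _ => E0.
have [c c0 cE] : exists2 c : R, 0 < c & (c%:E <= E)%E.
  move: E0; case: E => [E||]//; first by move=> E0; exists E.
  by move=> _; exists 1 => //; rewrite leey.
pose S := [set z : 'rV[R]_d | enorm z < r /\ u z < c].
have mS : measurable S.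
  rewrite (_ : S = eball d r `&` (u @^-1` `]-oo, c[)); last first.
    by apply/seteqP; split => z /=; rewrite in_itv/=.
  apply: measurableI; first exact: measurable_eball.
  by rewrite -[X in measurable X]setTI; apply: mu => //; exact: measurable_itv.
have S0 : lebesgue_measure_rv d S = 0%E.
  have [A [mA A0 SA]] := ess_inf_le (mrestr (lebesgue_measure_rv d) (measurable_eball r)) (EFin \o u).
  apply/eqP; rewrite eq_le measure_ge0 andbT -A0.
  apply: le_measure; rewrite ?inE//.
    by apply: measurableI => //; exact: measurable_eball.
  move=> z [zr uz]; split => //; apply: SA => /= H.
  by have := le_trans cE H; rewrite lee_fin leNgt uz.
pose F (k : nat) := oapp (fun q => [set y | S (y - of_Zd R q)]) set0 (@unpickle 'rV[int]_d k).
have mF k : measurable (F k).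
  by rewrite /F; case: unpickle => [q|] //=; exact: measurable_lattice_shift.
exists c, (\bigcup_k F k); split => //.
- exact: bigcupT_measurable.
- move=> dW W Q x B BM s s0.
  have mB : measurable_fun setT (B s) by apply: (bm_measurable BM); exact: ltW.
  have mBF k : measurable (B s @^-1` F k) by rewrite -[X in measurable X]setTI; exact: mB.
  rewrite (_ : [set w | _] = \bigcup_k (B s @^-1` F k)); last first.
    by apply/seteqP; split => w [k _ H]; exists k.
  apply: measure_negligible; first exact: bigcupT_measurable.
  apply: negligible_bigcup => k; apply/negligibleP => //.
  rewrite /F; case: unpickle => [q|] /=; last by rewrite preimage_set0.
  exact: (bm_abs_continuous BM).
- move=> y Ny q yq; rewrite leNgt; apply/negP => uc; apply: Ny.
  by exists (pickle q) => //; rewrite /F pickleK.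
Qed.

End good_points.

Section scaling.
Variable R : realType.
Implicit Types L x a b : R.

Lemma powR_div L x a : 0 < L -> 0 <= x -> (x / L) `^ a = x `^ a * L `^ (- a).
Proof.
move=> L0 x0; rewrite powRM ?invr_ge0 ?(ltW L0)//.
by rewrite -(powR_inv1 (ltW L0)) -powRrM mulN1r.
Qed.

Lemma powR_scaleN L x a b : 0 < L -> 0 <= x ->
  L `^ b * (x / L) `^ (- a) = L `^ (a + b) * x `^ (- a).
Proof.
move=> L0 x0; rewrite powR_div// opprK powRD; last by rewrite (gt_eqF L0) implybT.
ring.
Qed.

Lemma powR_scale L x b : 0 < L -> 0 <= x -> L `^ b * (x / L) `^ b = x `^ b.
Proof.
move=> L0 x0; rewrite powR_div// mulrCA -powRD; last by rewrite (gt_eqF L0) implybT.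
by rewrite subrr powRr0 mulr1.
Qed.

End scaling.

Section displacement_factor.
Variables (R : realType) (d : nat) (al th C0 : R) (u : 'rV[R]_d -> R).
Hypotheses (al0 : 0 < al) (th0 : 0 < th) (C00 : 0 < C0).
Context dO (O : measurableType dO) (P : probability O R).
Variable xi : 'rV[int]_d -> O -> 'rV[int]_d.
Hypothesis iid : iid_displacements P th xi.

Local Notation zn q := (enorm (of_Zd R q)).
Local Notation G b := (rate al th C0 b).

(** The expectation over the displacement [p] is dominated by the least cost. The
    factor [1 - e] leaves [exp (- e |p|^th)] for summing over [p]. Near the obstacle,
    where only [c <= u] is known, the exponent [c L^(al + th)] exceeds
    [(C0 + 1) L^th], hence [L^th] times the rate. *)
Lemma displacement_factor (e r c : R) : 0 < e < 1 -> 0 < r -> 0 < c ->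
  (forall x, r <= enorm x -> (1 - e) * (C0 * enorm x `^ (- al)) <= u x) ->
  exists2 L0, 0 < L0 & forall L, L0 <= L -> forall q z,
    (forall p, enorm (z - of_Zd R p) < r -> c <= u (z - of_Zd R p)) ->
    (\int[P]_om (expR (- (L `^ (al + th) * u (z - of_Zd R (xi q om)))))%:E <=
     (stretched_sum d th e * expR (- ((1 - e) * (L `^ th * G (enorm z / L)))))%:E)%E.
Proof.
move=> /andP[e0 e1] r0 c0 ur.
(* From this L on, c L^al >= C0 + 1. *)
exists (((C0 + 1) / c) `^ al^-1); first by rewrite powR_gt0// divr_gt0// addr_gt0.
move=> L LL q z uc.
have C1 : 0 < C0 + 1 by rewrite addr_gt0.
have L0 : 0 < L by apply: lt_le_trans LL; rewrite powR_gt0// divr_gt0.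
have Lal : C0 + 1 <= c * L `^ al.
  rewrite mulrC -ler_pdivrMr//.
  have -> : (C0 + 1) / c = (((C0 + 1) / c) `^ al^-1) `^ al.
    by rewrite -powRrM mulVf ?gt_eqF// powRr1// divr_ge0 ?ltW.
  by apply: ge0_ler_powR; rewrite ?nnegrE ?powR_ge0 ?(ltW L0) ?(ltW al0).
have Lth : 0 < L `^ th by rewrite powR_gt0.
have b0 : 0 <= enorm z / L by rewrite divr_ge0 ?enorm_ge0// ltW.
have [Gb0 Gb1] : 0 <= G (enorm z / L) /\ G (enorm z / L) <= C0 + 1.
  by split; [exact: rate_ge0|exact: rate_le_const].
rewrite (@displacement_integral _ _ _ th0 _ _ _ _ iid _ (fun p => expR (- (L `^ (al + th) * u (z - of_Zd R p))))); last first.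
  by move=> p; exact: expR_ge0.
rewrite EFinM muleC -stretched_sumE//.
rewrite -esumZl ?expR_ge0//; apply: le_esum => p _; rewrite -EFinM lee_fin.
have Z1 := lattice_partition_ge1 d th0.
have Z0 : 0 < lattice_partition d th by exact: lt_le_trans Z1.
apply: (@le_trans _ _ (expR (- (L `^ (al + th) * u (z - of_Zd R p))) * expR (- (zn p `^ th)))).
  rewrite ler_pM2l ?expR_gt0// ler_pdivrMr// ler_peMr// ltW// expR_gt0.
rewrite -!expRD ler_expR.
have pth : 0 <= zn p `^ th by exact: powR_ge0.
have [zp|pz] := ltP (enorm (z - of_Zd R p)) r.
  have uz := uc _ zp.
  have : L `^ th * G (enorm z / L) <= L `^ (al + th) * u (z - of_Zd R p).
    apply: (@le_trans _ _ (L `^ th * (c * L `^ al))).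
      by rewrite ler_pM2l//; exact: le_trans Gb1 Lal.
    rewrite powRD; last by rewrite (gt_eqF L0) implybT.
    rewrite (_ : L `^ th * _ = L `^ al * L `^ th * c); last by ring.
    by rewrite ler_pM2l// mulr_gt0// powR_gt0.
  have : 0 <= L `^ th * G (enorm z / L) by rewrite mulr_ge0// ltW.
  nra.
have uz := ur _ pz.
have zp0 : 0 < enorm (z - of_Zd R p) by exact: lt_le_trans pz.
have tri := enormB z (of_Zd R p).
have s0 : 0 <= zn p / L by rewrite divr_ge0 ?enorm_ge0// ltW.
have bs : enorm (z - of_Zd R p) / L <= enorm z / L + zn p / L.
  by rewrite -mulrDl ler_pM2r ?invr_gt0.
have zL0 : 0 < enorm (z - of_Zd R p) / L by rewrite divr_gt0.
have GG : G (enorm z / L) <= C0 * (enorm (z - of_Zd R p) / L) `^ (- al) + (zn p / L) `^ th.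
  apply: le_trans (rate_le al th C00 s0 _) _; first exact: lt_le_trans bs.
  by rewrite lerD2r ler_pM2l// ler_powRN// ltW.
have {}GG : L `^ th * G (enorm z / L) <=
    L `^ (al + th) * (C0 * enorm (z - of_Zd R p) `^ (- al)) + zn p `^ th.
  rewrite -(powR_scale th L0 (enorm_ge0 (of_Zd R p))).
  have e1' := powR_scaleN al th L0 (ltW zp0).
  rewrite (mulrCA _ C0) -e1' (mulrCA C0) -mulrDr ler_pM2l//.
have LT : 0 < L `^ (al + th) by rewrite powR_gt0.
have : (1 - e) * (L `^ th * G (enorm z / L)) <= (1 - e) *
    (L `^ (al + th) * (C0 * enorm (z - of_Zd R p) `^ (- al)) + zn p `^ th).
  by rewrite ler_pM2l// subr_gt0.
have : L `^ (al + th) * ((1 - e) * (C0 * enorm (z - of_Zd R p) `^ (- al))) <= L `^ (al + th) * u (z - of_Zd R p).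
  by rewrite ler_pM2l.
lra.
Qed.

End displacement_factor.

(** * Upper bound for the annealed field *)

Section potential_measurability.
Variables (R : realType) (d : nat) (u : 'rV[R]_d -> R).
Hypotheses (mu : measurable_fun setT u) (u0 : forall x, 0 <= u x).
Context dO (O : measurableType dO).
Variable xi : 'rV[int]_d -> O -> 'rV[int]_d.
Hypothesis mxi : forall q, measurable_fun setT (xi q).

Lemma measurable_potential :
  measurable_fun setT (fun z : O * 'rV[R]_d => potential u (xi^~ z.1) z.2).
Proof.
apply: measurable_esum => [q z|q]; first by rewrite lee_fin.
apply/measurable_EFinP; apply: (measurableT_comp mu).
apply: measurable_fun_rvP => i; under eq_fun do rewrite !mxE.
apply: measurable_funB.
  apply: measurable_funB => //.
  exact: (measurableT_comp (measurable_coord_rv i) measurable_snd).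
have m2 : measurable_fun setT (fun z : O * 'rV[R]_d => xi q z.1).
  exact: (measurableT_comp (mxi q) measurable_fst).
have -> : (fun z : O * 'rV[R]_d => (xi q z.1 ord0 i)%:~R) =
   (fun p => of_Zd R p ord0 i) \o (fun z => xi q z.1).
  by apply/funext => z; rewrite /= mxE.
by apply: measurableT_comp m2; exact: measurable_of_Zd_coord.
Qed.

Lemma potential_ge0 (z : 'rV[int]_d -> 'rV[int]_d) y : (0 <= potential u z y)%E.
Proof. by apply: esum_ge0 => q _; rewrite lee_fin. Qed.

End potential_measurability.

Lemma prode_le (R : realType) (I : Type) (s : seq I) (a : I -> \bar R) (b : I -> R) :
  (forall i, 0 <= a i)%E -> (forall i, (a i <= (b i)%:E)%E) ->
  (\prod_(i <- s) a i <= (\prod_(i <- s) b i)%:E)%E.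
Proof.
move=> a0 ab; suff: (0 <= \prod_(i <- s) a i /\
    \prod_(i <- s) a i <= (\prod_(i <- s) b i)%:E)%E by case.
elim: s => [|i s [h0 h1]]; first by rewrite !big_nil; split => //; rewrite lee_fin.
by rewrite !big_cons EFinM; split; [exact: mule_ge0|exact: lee_pmul].
Qed.

Section upper_annealed.
Variables (R : realType) (d : nat) (al th C0 : R) (u : 'rV[R]_d -> R).
Hypotheses (d1 : (1 <= d)%N) (dal : d%:R < al) (th0 : 0 < th) (C00 : 0 < C0).
Hypotheses (mu : measurable_fun setT u) (u0 : forall x, 0 <= u x).
Hypothesis u_lower : forall e : R, 0 < e -> exists2 r, 1 <= r &
  forall x, r <= enorm x -> (1 - e) * (C0 * enorm x `^ (- al)) <= u x.
Hypothesis u_inf : forall r : R, 1 <= r ->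
  (0 < ess_inf (mrestr (lebesgue_measure_rv d) (measurable_eball r)) (EFin \o u))%E.
Context dO (O : measurableType dO) (P : probability O R).
Variable xi : 'rV[int]_d -> O -> 'rV[int]_d.
Hypothesis iid : iid_displacements P th xi.

Local Notation zn q := (enorm (of_Zd R q)).
Local Notation G b := (rate al th C0 b).
Local Notation c := (rate_constant d al th C0).

Let al0 : 0 < al. Proof. exact: le_lt_trans dal. Qed.

Lemma of_ZdD (p q : 'rV[int]_d) : of_Zd R (p + q) = of_Zd R p + of_Zd R q.
Proof. by apply/rowP => i; rewrite !mxE intrD. Qed.

(** All other obstacles are dropped, and the remaining displacements are independent. *)
Lemma annealed_prod (s : seq 'rV[int]_d) (T : R) y : uniq s -> 0 <= T ->
  (\int[P]_om expeR (- (T%:E * potential u (xi^~ om) y)) <=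
   \prod_(q <- s) \int[P]_om (expR (- (T * u (y - of_Zd R q - of_Zd R (xi q om)))))%:E)%E.
Proof.
move=> us T0; have [mxi indxi _] := iid.
pose f q p := expR (- (T * u (y - of_Zd R q - of_Zd R p))).
have mf q : measurable_fun setT (f q).
  by move=> _ Y mY; exact: measurable_rv_int.
rewrite -(@integral_prod_indep _ _ _ _ _ _ _ _ mxi indxi s f us mf); last first.
  by move=> q p; exact: expR_ge0.
apply: ge0_le_integral_nomeas => om _; first exact: expeR_ge0.
rewrite /f -expR_sum -[leRHS]/(expeR _%:E) lee_expeR.
rewrite sumrN -mulr_sumr EFinN leeN2 EFinM lee_wpmul2l ?lee_fin// -sumEFin.
apply: (@esum_ge_sum _ _ (fun q => (u (y - of_Zd R q - of_Zd R (xi q om)))%:E)) => //.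
by move=> q; rewrite lee_fin.
Qed.

(** The obstacles kept are those around the lattice point nearest to [y]. There are
    [O(L^d)] of them, so the constant factors of [displacement_factor] contribute
    [exp (O(L^d))] only, and the sum of their rates is a Riemann sum. *)
Lemma upper_annealed (e : R) : 0 < e -> exists N : set 'rV[R]_d,
  [/\ measurable N,
      forall dW (W : measurableType dW) (Q : probability W R) x B,
        brownian_motion Q x B -> forall s, 0 < s -> (Q [set w | N (B s w)] = 0)%E &
      exists2 L0, 0 < L0 & forall L, L0 <= L -> forall y, ~ N y ->
        (\int[P]_om expeR (- ((L `^ (al + th))%:E * potential u (xi^~ om) y)) <=
         (expR (- ((c - e) * L `^ (d%:R + th))))%:E)%E].
Proof.
move=> e0; have e40 : 0 < e / 4 by rewrite divr_gt0.
have c0 := rate_constant_ge0 d1 dal th0 C00.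
have [eta eta0 etac] := eta_small d1 dal th0 C00 e40.
pose eps := Num.min eta (1 / 2).
have eps0 : 0 < eps by rewrite lt_min eta0 divr_gt0.
have eps1 : eps < 1.
  by apply: (@le_lt_trans _ _ (1 / 2)); [rewrite ge_min lexx orbT|lra].
have epsc : eps * c <= e / 4.
  by apply: le_trans etac; apply: ler_wpM2r => //; rewrite ge_min lexx.
have [r r1 ur] := u_lower eps0.
have [c' [N [c'0 mN QN uN]]] := good_points mu (u_inf r1).
have epsI : 0 < eps < 1 by rewrite eps0.
have r0 : 0 < r by exact: lt_le_trans r1.
have [L1 L10 HL1] := displacement_factor al0 th0 C00 iid epsI r0 c'0 ur.
have [R0 [L2 [R00 L20 HL2]]] := riemann_rate_lower d1 dal th0 C00 e40.
pose S : R := stretched_sum d th eps.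
have S1 : 1 <= S by exact: stretched_sum_ge1.
have lnS : 0 <= ln S by exact: ln_ge0.
pose K := (2 * (R0 + d%:R + 1)) ^+ d.
have K0 : 0 <= K by rewrite exprn_ge0// mulr_ge0// !addr_ge0// ltW.
(* K L^d bounds the number of obstacles, and from L3 on the constant factors cost at
   most e / 4 L^(d + th). *)
pose L3 := (4 * (K * ln S) / e) `^ th^-1.
exists N; split => //; exists (Num.max 1 (Num.max L1 (Num.max L2 L3))).
  by rewrite lt_max ltr01.
move=> L; rewrite !ge_max => /and4P[L1L HL1L HL2L HL3L] y Ny.
have L0 : 0 < L by exact: lt_le_trans L1L.
have Lth0 : 0 < L `^ th by rewrite powR_gt0.
have Ld0 : 0 < L ^+ d by rewrite exprn_gt0.
have HL3 : K * ln S <= e / 4 * L `^ th.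
  have X0 : 0 <= 4 * (K * ln S) / e by rewrite divr_ge0 ?(ltW e0)// !mulr_ge0.
  have : L3 `^ th <= L `^ th.
    by apply: ge0_ler_powR; rewrite ?nnegrE ?powR_ge0 ?(ltW L0) ?(ltW th0).
  rewrite /L3 -powRrM mulVf ?gt_eqF// powRr1// ler_pdivrMr//; lra.
pose s0 := ball_seq d (R0 * L).
pose s := [seq lat y + q | q <- s0].
have us : uniq s by rewrite map_inj_uniq ?ball_seq_uniq//; exact: addrI.
apply: le_trans (annealed_prod y us (powR_ge0 _ _)) _.
rewrite big_map.
apply: le_trans (@prode_le R _ s0 _ (fun q => S * expR (- ((1 - eps) * (L `^ th * G ((zn q + d%:R) / L))))) _ _) _.
- by move=> q; apply: integral_ge0 => om _; rewrite lee_fin expR_ge0.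
- move=> q; apply: le_trans (HL1 L HL1L (lat y + q) (y - of_Zd R (lat y + q)) _) _.
    by move=> p; rewrite -addrA -opprD -of_ZdD; exact: uN.
  rewrite lee_fin -/S; apply: ler_wpM2l; first by rewrite (le_trans _ S1).
  rewrite ler_expR lerN2 ler_wpM2l ?subr_ge0 ?(ltW eps1)// ler_wpM2l ?(ltW Lth0)//.
  apply: rate_anti => //; first by rewrite divr_ge0 ?enorm_ge0// ltW.
  rewrite ler_pM2r ?invr_gt0// of_ZdD opprD addrA.
  have := enormB (y - of_Zd R (lat y)) (of_Zd R q).
  by have := lat_dist y; rewrite -enormN opprB; lra.
rewrite lee_fin big_split/= big_const_seq count_predT iter_mulr_1.
rewrite -{1}(@lnK _ S) ?posrE ?(lt_le_trans ltr01 S1)// -expRM_natl.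
rewrite -expR_sum -expRD ler_expR sumrN -mulr_sumr -mulr_sumr.
rewrite powRD; last by rewrite (gt_eqF L0) implybT.
rewrite powR_mulrn ?(ltW L0)//.
have hs : (size s0)%:R * ln S <= e / 4 * (L ^+ d * L `^ th).
  apply: (@le_trans _ _ (K * ln S * L ^+ d)).
    by rewrite mulrAC; apply: ler_wpM2r => //; exact: (size_ball_seq_scale _ (ltW R00) L1L).
  by rewrite mulrCA mulrC; apply: ler_wpM2l => //; exact: ltW.
have hG : L ^+ d * L `^ th * (c - e / 4) <= L `^ th * \sum_(q <- s0) G ((zn q + d%:R) / L).
  by rewrite mulrAC mulrC ler_pM2l//; exact: HL2.
set X := L ^+ d * L `^ th in hs hG *.
have X0 : 0 < X by exact: mulr_gt0.
set A := (size s0)%:R * ln S in hs *; set B := L `^ th * _ in hG *.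
have : (1 - eps) * (X * (c - e / 4)) <= (1 - eps) * B by rewrite ler_pM2l// subr_gt0.
have : eps * c * X <= e / 4 * X by rewrite ler_pM2r.
have : 0 <= eps * (e / 4) * X by rewrite !mulr_ge0// ltW.
have : 0 <= e * X by rewrite mulr_ge0// ltW.
lra.
Qed.

End upper_annealed.

(** * Prescribing finitely many displacements *)

Section independent_events.
Context dO (O : measurableType dO) (R : realType) (P : probability O R).
Context dT (T : measurableType dT) (I : countType) (X : I -> O -> T).
Hypothesis mX : forall i, measurable_fun setT (X i).
Hypothesis indX : mutually_independent P X.
Local Open Scope ereal_scope.

(** Prescribing finitely many variables costs the product of the probabilities;
    all the others satisfy their constraints up to a union bound, which is
    independent of the prescription. *)
Lemma indep_prescribe (s : seq I) (A B : I -> set T) (e : R) : uniq s ->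
  (forall i, measurable (A i)) -> (forall i, measurable (B i)) -> (0 <= e)%R ->
  \esum_(i in [set: I]) (if i \in s then 0 else P (X i @^-1` (~` B i))) <= e%:E ->
  let E := [set w | forall i, if i \in s then A i (X i w) else B i (X i w)] in
  measurable E /\ (1 - e)%R%:E * \prod_(i <- s) P (X i @^-1` A i) <= P E.
Proof.
move=> us mA mB e0 He E.
have mXS i (S : set T) : measurable S -> measurable (X i @^-1` S).
  by move=> mS; rewrite -[X in measurable X]setTI; exact: mX.
pose N := \bigcap_(i in [set` s]) (X i @^-1` A i).
have mN : measurable N.
  by apply: fin_bigcap_measurable => [|i _]; [exact: finite_seq|exact: mXS].
have NE : P N = \prod_(i <- s) P (X i @^-1` A i) by exact: indX.
pose F k := oapp (fun i => if i \in s then set0 else N `&` X i @^-1` (~` B i)) set0 (@pickle_inv I k).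
have mF k : measurable (F k).
  rewrite /F; case: pickle_inv => [i|] //=; case: ifP => // _.
  by apply: measurableI => //; apply: mXS; exact: measurableC.
have EE : E = N `\` \bigcup_k F k.
  apply/seteqP; split => w.
    move=> Ew; split.
      by move=> i /= is_; have := Ew i; rewrite is_.
    move=> [k _]; rewrite /F; case: pickle_inv => [i|] //=; case: ifPn => //= /negbTE si [_].
    by have := Ew i; rewrite si.
  move=> [Nw Fw] i; case: ifPn => si; first exact: Nw.
  apply: contrapT => Bw; apply: Fw; exists (pickle i) => //.
  by rewrite /F pickleK_inv /= (negbTE si); split.
have mE : measurable E by rewrite EE; apply: measurableD => //; exact: bigcupT_measurable.
split => //; rewrite -NE.
have PF : P (\bigcup_k F k) <= P N * e%:E.
  apply: (@le_trans _ _ (\sum_(k <oo) P (F k))).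
    by apply: measure_sigma_subadditive => //; exact: bigcupT_measurable.
  have P0 : 0 <= P N by exact: measure_ge0.
  have fN : P N \is a fin_num by exact: fin_num_measure.
  have Pi0 i : 0 <= (if i \in s then 0 else P (X i @^-1` (~` B i))) by case: ifP.
  apply: (@le_trans _ _ ((fine (P N))%:E * \esum_(i in [set: I]) (if i \in s then 0 else P (X i @^-1` (~` B i))))); last first.
    by rewrite fineK// lee_wpmul2l.
  rewrite -esumZl ?fine_ge0// esum_nneseries => [|i]; last by rewrite mule_ge0// fineK.
  apply: lee_nneseries => [k _ _|k _]; first exact: measure_ge0.
  rewrite /F; case: pickle_inv => [i|] /=; last by rewrite measure0.
  case: ifPn => si; first by rewrite measure0 mule0.
  rewrite fineK// NE.
  have := indX (s := i :: s) (A := fun j => if j == i then ~` B i else A j).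
  rewrite /= us si => /(_ isT) H.
  rewrite [X in X <= _](_ : _ = P (X i @^-1` (~` B i)) * \prod_(i <- s) P (X i @^-1` A i)); first by rewrite muleC.
  rewrite big_cons eqxx in H.
  rewrite (eq_big_seq (fun j => P (X j @^-1` (if j == i then ~` B i else A j)))) => [|j js]; last first.
    by case: eqP => // ji; rewrite -ji js in si.
  rewrite -H; last by move=> j; case: ifP => _ //; exact: measurableC.
  congr (P _); apply/seteqP; split => w /=.
    move=> [Nw Bw] j /=; rewrite inE => /orP[/eqP->|js]; first by rewrite eqxx.
    by case: eqP => [ji|_]; [rewrite -ji js in si|exact: Nw].
  move=> Hw; split.
    move=> j /= js; have := Hw j; rewrite /= inE js orbT => /(_ isT).
    by case: eqP => // ji; rewrite -ji js in si.
  by have := Hw i; rewrite /= inE eqxx => /(_ isT).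
have mU : measurable (\bigcup_k F k) by exact: bigcupT_measurable.
rewrite EE measureD//; last first.
  by rewrite ltey_eq fin_num_measure.
have fN : P N \is a fin_num by exact: fin_num_measure.
apply: (@le_trans _ _ (P N - P N * e%:E)).
  by rewrite -(fineK fN) -!EFinM -EFinB lee_fin; lra.
rewrite leeB// (le_trans _ PF)// le_measure ?inE//; exact: measurableI.
Qed.

End independent_events.

(** * Near-optimal displacements *)

Section truncation.
Variables (R : realType) (n : nat).
Implicit Types z x y : 'rV[R]_n.

Lemma ler_enorm x y : (forall i, `|x ord0 i| <= `|y ord0 i|) -> enorm x <= enorm y.
Proof.
move=> xy; apply: ler_wsqrtr; apply: ler_sum => i _.
by rewrite -(real_normK (num_real (x ord0 i))) -(real_normK (num_real (y ord0 i))) lerXn2r ?nnegrE.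
Qed.

(** Rounding towards the origin, so that the norm does not increase. *)
Definition tlat z : 'rV[int]_n :=
  \row_i (if 0 <= z ord0 i then Num.floor (z ord0 i) else - Num.floor (- z ord0 i)).

Lemma tlat_le z : enorm (of_Zd R (tlat z)) <= enorm z.
Proof.
apply: ler_enorm => i; rewrite !mxE; case: ifPn => [z0|].
  rewrite !ger0_norm ?ler0z ?floor_ge0//.
  by have /andP[] := floor_itv (z ord0 i).
rewrite -ltNge => z0; rewrite rmorphN/= normrN (ltr0_norm z0).
have z1 : 0 <= - z ord0 i by rewrite oppr_ge0 ltW.
rewrite ger0_norm ?ler0z ?floor_ge0//.
by have /andP[] := floor_itv (- z ord0 i).
Qed.

Lemma tlat_dist z : enorm (of_Zd R (tlat z) - z) <= n%:R.
Proof.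
rewrite -[leRHS]mulr1; apply: enorm_le_coord => // i; rewrite !mxE; case: ifPn => z0.
  have /andP[] := floor_itv (z ord0 i); rewrite intrD ler_norml; lra.
have /andP[] := floor_itv (- z ord0 i); rewrite rmorphN/= intrD ler_norml; lra.
Qed.

End truncation.

Section displacement_tail.
Variables (R : realType) (d : nat) (th : R).
Hypothesis th0 : 0 < th.
Context dO (O : measurableType dO) (P : probability O R).
Variable xi : 'rV[int]_d -> O -> 'rV[int]_d.
Hypothesis iid : iid_displacements P th xi.

Local Notation zn q := (enorm (of_Zd R q)).

(** Half of the exponent in the law is kept for summing over the displacements, the
    other half decays faster than any power. *)
Lemma displacement_tail (a : R) : 0 < a -> exists2 K : R, 0 < K & forall q v, 0 < v ->
  (P (xi q @^-1` [set p | (v < zn p)%R]) <= (K * v `^ (- a))%:E)%E.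
Proof.
move=> a0; have h0 : 0 < 1 / 2 :> R by rewrite divr_gt0.
have [K1 K10 HK1] := stretched_exp_decay h0 th0 a0.
pose S : R := stretched_sum d th (1 / 2).
have S0 : 0 < S by apply: lt_le_trans (stretched_sum_ge1 d th0 h0).
exists (S * K1); first exact: mulr_gt0.
move=> q v v0; pose A := [set p : 'rV[int]_d | (v < zn p)%R].
have [mxi _ _] := iid.
have mA : measurable (xi q @^-1` A).
  by rewrite -[X in measurable X]setTI; apply: mxi => //; exact: measurable_rv_int.
have -> : P (xi q @^-1` A) = (\int[P]_om (\1_A (xi q om))%:E)%E.
  by rewrite -(setIT (xi q @^-1` A)) -(integral_indic P measurableT mA).
rewrite (@displacement_integral _ _ _ th0 _ _ _ _ iid _ (fun p => \1_A p)); last first.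
  by move=> p; rewrite indicE.
apply: (@le_trans _ _ ((expR (- (1 / 2 * v `^ th)))%:E * \esum_(p in [set: 'rV[int]_d]) (expR (- (1 / 2 * zn p `^ th)))%:E)%E).
  rewrite -esumZl ?expR_ge0//; apply: le_esum => p _; rewrite -EFinM lee_fin indicE.
  have [pA|pA] := boolP (p \in A); last by rewrite mul0r mulr_ge0 ?expR_ge0.
  rewrite [leLHS]mul1r; have Z1 := lattice_partition_ge1 d th0.
  have Z0 : 0 < lattice_partition d th by exact: lt_le_trans Z1.
  apply: (@le_trans _ _ (expR (- (zn p `^ th)))).
    by rewrite ler_pdivrMr// ler_peMr// ltW// expR_gt0.
  rewrite -expRD ler_expR.
  have : v `^ th <= zn p `^ th.
    move: pA; rewrite inE /A/= => vp.
    by apply: ge0_ler_powR; rewrite ?nnegrE ?(ltW th0) ?(ltW v0) ?(ltW vp) ?enorm_ge0.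
  by lra.
rewrite stretched_sumE// -/S.
by rewrite -EFinM lee_fin (mulrC _ S) -(mulrA S K1); apply: ler_wpM2l; [exact: ltW|exact: HK1].
Qed.

Lemma displacement_far (e : R) : 0 < e -> exists2 M0 : R, 0 < M0 & forall M : R, M0 <= M ->
  (\esum_(q in [set: 'rV[int]_d])
     (if q \in ball_seq d M then 0
      else P (xi q @^-1` (~` [set p | (zn p <= zn q / 2)%R]))) <= e%:E)%E.
Proof.
move=> e0; pose a : R := d%:R + 1.
have a0 : 0 < a by rewrite ltr_wpDl.
have da : d%:R < a by rewrite ltrDl.
have [K K0 HK] := displacement_tail a0.
have [C C0 HC] := esum_tail da.
pose D := K * 2 `^ a.
have D0 : 0 < D by rewrite mulr_gt0 ?powR_gt0.
exists (Num.max (2 * d%:R + 1) (D * C / e)).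
  by rewrite lt_max ltr_wpDl ?mulr_ge0.
move=> M; rewrite ge_max => /andP[M1 M2].
have M0 : 0 < M by apply: lt_le_trans M1; rewrite ltr_wpDl ?mulr_ge0.
apply: (@le_trans _ _ (D%:E * \esum_(q in [set: 'rV[int]_d]) (if M < zn q then zn q `^ (- a) else 0)%:E)%E).
  rewrite -esumZl ?(ltW D0)//; last by move=> q; rewrite lee_fin; case: ifP => // _; exact: powR_ge0.
  apply: le_esum => q _; rewrite mem_ball_seq; have [qM|Mq] := leP (zn q) M.
    by rewrite mule0.
  have q0 : 0 < zn q by exact: lt_trans Mq.
  have q20 : 0 < zn q / 2 by rewrite divr_gt0.
  rewrite (_ : ~` _ = [set p | (zn q / 2 < zn p)%R]); last first.
    by apply/seteqP; split => p /=; rewrite ltNge => /negP.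
  apply: le_trans (HK q _ q20) _; rewrite -EFinM lee_fin powR_div ?(ltW q0)//.
  by rewrite opprK /D (mulrC _ (2 `^ a)) mulrA.
apply: le_trans (lee_wpmul2l _ (HC M _ M0)) _; rewrite ?lee_fin ?(ltW D0)//.
  by apply: le_trans M1; rewrite lerDl.
have -> : d%:R - a = -1 by rewrite /a; ring.
by rewrite powR_inv1 ?(ltW M0)// mulrA ler_pdivrMr// (mulrC e) -ler_pdivrMr.
Qed.

End displacement_tail.

Section near_choice.
Variables (R : realType) (d : nat) (al th C0 : R) (u : 'rV[R]_d -> R).
Hypotheses (d1 : (1 <= d)%N) (al0 : 0 < al) (th0 : 0 < th) (C00 : 0 < C0).
Hypothesis u_upper : forall e : R, 0 < e -> exists2 r, 1 <= r &
  forall x, r <= enorm x -> u x <= (1 + e) * (C0 * enorm x `^ (- al)).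

Local Notation zn q := (enorm (of_Zd R q)).
Local Notation G b := (rate al th C0 b).

(** A near-optimal displacement leaves the obstacle at a distance of order [L], where
    [u] is given by its asymptotics. *)
Lemma near_minimizer_lower (b s : R) : 0 < b + s ->
  cost al th C0 b s <= C0 + 2 -> (C0 / (C0 + 2)) `^ al^-1 <= b + s.
Proof.
move=> bs0 H; have C2 : 0 < C0 + 2 by rewrite addr_gt0.
have X0 : 0 < C0 / (C0 + 2) by rewrite divr_gt0.
have H1 : C0 * (b + s) `^ (- al) <= C0 + 2.
  by apply: le_trans H; rewrite lerDl powR_ge0.
have H2 : C0 / (C0 + 2) <= (b + s) `^ al.
  move: H1; rewrite powRN ler_pdivrMr ?powR_gt0// => H1.
  by rewrite ler_pdivrMr// mulrC.
have -> : b + s = ((b + s) `^ al) `^ al^-1.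
  by rewrite -powRrM mulfV ?gt_eqF// powRr1// ltW.
by apply: ge0_ler_powR; rewrite ?nnegrE ?powR_ge0 ?(ltW X0) ?invr_ge0 ?(ltW al0).
Qed.

(** Moving the obstacle [q] radially outwards to a near-optimal distance makes its
    cost, seen from all points of a small ball, almost the rate. *)
Lemma near_choice (e : R) : 0 < e -> e <= 1 ->
  exists2 kap, 0 < kap & exists2 L0, 0 < L0 & forall L, L0 <= L -> forall q,
    exists y : 'rV[int]_d, forall x, enorm x <= kap * L ->
    L `^ (al + th) * u (x - of_Zd R q - of_Zd R y) + zn y `^ th <=
    (1 + e) * (L `^ th * (G (zn q / L) + e)).
Proof.
move=> e0 e1; have e30 : 0 < e / 3 by rewrite divr_gt0.
have [lam [l0 l1 lE]] := powR_near1 al0 e30.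
pose del := (C0 / (C0 + 2)) `^ al^-1.
have C2 : 0 < C0 + 2 by rewrite addr_gt0.
have del0 : 0 < del by rewrite powR_gt0// divr_gt0.
have dl : 0 < del * (1 - lam) by rewrite mulr_gt0// subr_gt0.
pose kap := del * (1 - lam) / 2.
have kap0 : 0 < kap by rewrite divr_gt0.
have [r r1 ur] := u_upper e30.
have r0 : 0 < r by exact: lt_le_trans r1.
exists kap => //; exists (Num.max (d%:R / kap) (r / (lam * del))).
  by rewrite lt_max (divr_gt0 r0 (mulr_gt0 l0 del0)) orbT.
move=> L; rewrite ge_max ler_pdivrMr// ler_pdivrMr ?mulr_gt0// => /andP[dL rL] q.
have L0 : 0 < L.
  by rewrite -(pmulr_lgt0 _ (mulr_gt0 l0 del0)); exact: lt_le_trans rL.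
pose b := zn q / L.
have b0 : 0 <= b by rewrite divr_ge0 ?enorm_ge0// ltW.
have [s [s0 bs0 Hs]] := rate_attained al th C00 b0 e0.
have bsd : del <= b + s.
  apply: near_minimizer_lower => //; apply: le_trans Hs _.
  have := rate_le_const th al0 C00 b0; lra.
have [Y [Ys qY]] := exists_radial d1 (of_Zd R q) (mulr_ge0 s0 (ltW L0)).
exists (tlat Y) => x xk; set w := x - _ - _.
(* The observer at distance kap L and the rounding of Y move the obstacle by at most
   2 kap L, which is at most (1 - lam) L (b + s). *)
have wL : lam * (L * (b + s)) <= enorm w.
  have : enorm (of_Zd R q + Y) <= enorm w + enorm x + enorm (of_Zd R (tlat Y) - Y).
    rewrite (_ : _ + Y = - w + x - (of_Zd R (tlat Y) - Y)); last first.
      by rewrite /w; apply/rowP => i; rewrite !mxE; ring.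
    by apply: le_trans (enormB _ _) _; rewrite lerD2r -(enormN w); exact: enormD.
  rewrite qY; have := tlat_dist Y.
  have -> : zn q + s * L = L * (b + s) by rewrite /b; field; rewrite gt_eqF.
  have : L * (2 * kap) <= L * ((b + s) * (1 - lam)).
    by rewrite ler_pM2l// /kap mulrC divfK// ler_pM2r// subr_gt0.
  by lra.
have bsL : 0 < L * (b + s) by rewrite mulr_gt0.
have w0 : 0 < enorm w by apply: lt_le_trans wL; rewrite mulr_gt0.
have rw : r <= enorm w.
  apply: le_trans wL; apply: le_trans rL _.
  by rewrite mulrCA ler_pM2l// ler_pM2l.
have uw := ur _ rw.
have wal : enorm w `^ (- al) <= (1 + e / 3) * (L `^ (- al) * (b + s) `^ (- al)).
  apply: (@le_trans _ _ ((lam * (L * (b + s))) `^ (- al))).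
    by apply: ler_powRN => //; [exact: ltW|exact: mulr_gt0].
  by rewrite powRM ?(ltW l0) ?(ltW bsL)// lE powRM ?(ltW L0) ?(ltW bs0).
have yY : zn (tlat Y) `^ th <= L `^ th * s `^ th.
  rewrite -powRM ?(ltW L0)//; apply: ge0_ler_powR; rewrite ?nnegrE ?enorm_ge0 ?mulr_ge0 ?(ltW th0) ?(ltW L0)//.
  by rewrite mulrC -Ys; exact: tlat_le.
have Lth : 0 < L `^ th by rewrite powR_gt0.
have LT : L `^ (al + th) * L `^ (- al) = L `^ th.
  rewrite -powRD; last by rewrite (gt_eqF L0) implybT.
  by congr (_ `^ _); ring.
have LT0 : 0 < L `^ (al + th) by rewrite powR_gt0.
have B0 : 0 < C0 * (b + s) `^ (- al) by rewrite mulr_gt0 ?powR_gt0.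
have uL : L `^ (al + th) * u w <= (1 + e) * (L `^ th * (C0 * (b + s) `^ (- al))).
  apply: (@le_trans _ _ (L `^ (al + th) * ((1 + e / 3) * (C0 * ((1 + e / 3) * (L `^ (- al) * (b + s) `^ (- al))))))).
    rewrite ler_pM2l//; apply: le_trans uw _.
    by rewrite ler_pM2l ?addr_gt0// ler_pM2l.
  rewrite (_ : _ * _ = (1 + e / 3) ^+ 2 * ((L `^ (al + th) * L `^ (- al)) * (C0 * (b + s) `^ (- al)))); last by ring.
  rewrite LT ler_pM2r; last exact: mulr_gt0.
  have ee : e * e <= e by rewrite ler_piMr// ltW.
  by rewrite expr2; lra.
have : (1 + e) * (L `^ th * cost al th C0 b s) <= (1 + e) * (L `^ th * (G b + e)).
  by rewrite ler_pM2l ?addr_gt0// ler_pM2l.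
have : 0 <= e * (L `^ th * s `^ th) by rewrite !mulr_ge0 ?powR_ge0// ltW.
rewrite /cost /b; rewrite /b in uL; lra.
Qed.

End near_choice.

(** * Lower bound for the annealed field *)

Section annealed_lower.
Variables (R : realType) (d : nat) (al th C0 : R) (u : 'rV[R]_d -> R).
Hypotheses (d1 : (1 <= d)%N) (dal : d%:R < al) (th0 : 0 < th) (C00 : 0 < C0).
Hypothesis u0 : forall x, 0 <= u x.
Hypothesis u_upper : forall e : R, 0 < e -> exists2 r, 1 <= r &
  forall x, r <= enorm x -> u x <= (1 + e) * (C0 * enorm x `^ (- al)).
Context dO (O : measurableType dO) (P : probability O R).
Variable xi : 'rV[int]_d -> O -> 'rV[int]_d.
Hypothesis iid : iid_displacements P th xi.

Local Notation zn q := (enorm (of_Zd R q)).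
Local Notation G b := (rate al th C0 b).
Local Notation c := (rate_constant d al th C0).

Let al0 : 0 < al. Proof. exact: le_lt_trans dal. Qed.

(** The event [A] prescribes near-optimal displacements within distance [r L], and
    displacements of at most half the distance beyond. On [A] the near obstacles cost
    what the Riemann sum predicts, and the far ones at most a multiple of
    [r^(d - al) L^(d + th)], which is small for large [r]. The number [D] bounds the
    energy; it depends on the choice of the displacements, whose probability
    compensates for it. *)
Lemma annealed_lower (e : R) : 0 < e -> exists2 kap : R, 0 < kap &
  exists2 L0 : R, 0 < L0 & forall L, L0 <= L -> exists (A : set O) (D : R),
  [/\ measurable A, 
      ((expR (D - (c + e) * L `^ (d%:R + th)))%:E <= P A)%E &
      forall om, A om -> forall x, enorm x <= kap * L ->
        ((L `^ (al + th))%:E * potential u (xi^~ om) x <= D%:E)%E].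
Proof.
move=> e0; have e40 : 0 < e / 4 by rewrite divr_gt0.
have c0 := rate_constant_ge0 d1 dal th0 C00.
have [r1 r11 ur1] := u_upper ltr01.
have r10 : 0 < r1 by exact: lt_le_trans r11.
have [Kt Kt0 HKt] := esum_tail dal.
pose F := 2 * C0 * 4 `^ al * Kt.
have F0 : 0 < F by rewrite !mulr_gt0 ?powR_gt0.
have dal' : 0 < al - d%:R by rewrite subr_gt0.
have [r r0 Hr] := powR_small F0 dal' e40.
pose K := (2 * (r + d%:R + 1)) ^+ d.
have K0 : 0 <= K by rewrite exprn_ge0// mulr_ge0// !addr_ge0// ltW.
have cK : 0 < c + 2 + 2 * K by rewrite ltr_wpDr ?mulr_ge0// ltr_wpDl.
(* The error e1 is made once in the Riemann sum and once for each of the at most K L^d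
   near obstacles, so that (1 + e1) (c + e1 + e1 K) <= c + e / 4. *)
pose e1 := Num.min 1 (e / 4 / (c + 2 + 2 * K)).
have e10 : 0 < e1 by rewrite lt_min ltr01 divr_gt0.
have e11 : e1 <= 1 by rewrite ge_min lexx.
have e1K : e1 * (c + 2 + 2 * K) <= e / 4.
  by rewrite -ler_pdivlMr// ge_min lexx orbT.
have [kap1 kap10 [L1 L10 HL1]] := near_choice d1 al0 th0 C00 u_upper e10 e11.
have [L2 L20 HL2] := riemann_rate_upper d1 dal th0 C00 e10.
have half0 : 0 < 1 / 2 :> R by rewrite divr_gt0.
have [M0 M00 HM0] := displacement_far th0 iid half0.
pose Z : R := lattice_partition d th.
have Z1 : 1 <= Z by exact: lattice_partition_ge1.
have Z0 : 0 < Z by exact: lt_le_trans Z1.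
have lnZ : 0 <= ln Z by exact: ln_ge0.
have ln2 : 0 <= ln 2 :> R by apply: ln_ge0; rewrite ler1n.
(* From L3 on, the normalisation Z^-1 of each prescribed law and the factor 1 / 2 cost
   at most e / 4 L^(d + th). *)
pose L3 := (4 * (K * ln Z + ln 2) / e) `^ th^-1.
pose kap := Num.min kap1 (r / 4).
have kap0 : 0 < kap by rewrite lt_min kap10 divr_gt0.
exists kap => //.
exists (Num.max 1 (Num.max L1 (Num.max L2 (Num.max L3 (Num.max (M0 / r) (Num.max (2 * d%:R / r) (4 * r1 / r))))))).
  by rewrite lt_max ltr01.
move=> L; rewrite !ge_max => /and5P[L1L HL1L HL2L HL3L /and3P[]].
rewrite !ler_pdivrMr// => M0L dL r1L.
have L0 : 0 < L by exact: lt_le_trans L1L.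
have Lth0 : 0 < L `^ th by rewrite powR_gt0.
have Ld0 : 1 <= L ^+ d by exact: exprn_ege1.
have Ld00 : 0 < L ^+ d by exact: lt_le_trans Ld0.
pose X := L ^+ d * L `^ th.
have XE : L `^ (d%:R + th) = X.
  by rewrite powRD ?(gt_eqF L0) ?implybT// powR_mulrn// ltW.
have X0 : 0 < X by exact: mulr_gt0.
have HL3 : K * ln Z + ln 2 <= e / 4 * L `^ th.
  have Y0 : 0 <= 4 * (K * ln Z + ln 2) / e by rewrite divr_ge0 ?(ltW e0)// mulr_ge0// addr_ge0// mulr_ge0.
  have : L3 `^ th <= L `^ th.
    by apply: ge0_ler_powR; rewrite ?nnegrE ?powR_ge0 ?(ltW L0) ?(ltW th0).
  rewrite /L3 -powRrM mulVf ?gt_eqF// powRr1// ler_pdivrMr//; lra.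
have [y Hy] := choice (HL1 L HL1L).
pose s := ball_seq d (r * L).
have rL0 : 0 < r * L by exact: mulr_gt0.
pose T := L `^ (al + th).
have T0 : 0 < T by rewrite powR_gt0.
have kapL : kap * L <= kap1 * L by rewrite ler_pM2r// ge_min lexx.
have kapr : kap * L <= r / 4 * L by rewrite ler_pM2r// ge_min lexx orbT.
(* bd q bounds the energy of obstacle q together with the cost of its displacement. *)
pose bd (q : 'rV[int]_d) := (1 + e1) * (L `^ th * (G (zn q / L) + e1)).
pose D := \sum_(q <- s) (bd q - zn (y q) `^ th) + e / 4 * X.
have [mxi indxi _] := iid.
have M0rL : M0 <= r * L by rewrite mulrC.
have us : uniq s by exact: ball_seq_uniq.
have mset (S : 'rV[int]_d -> set 'rV[int]_d) q : measurable (S q) by exact: measurable_rv_int.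
have := indep_prescribe mxi indxi us (mset (fun q => [set y q]))
  (mset (fun q => [set p | zn p <= zn q / 2])) (ltW half0) (HM0 _ M0rL).
set E := [set w | _] => -[mE PE].
exists E, D; split => //.
  apply: le_trans PE.
  under eq_bigr do rewrite (displacement_prob th0 iid).
  rewrite prodEFin -EFinM lee_fin -/Z big_split/= -expR_sum big_const_seq count_predT iter_mulr_1.
  have hs : (size s)%:R * ln Z + ln 2 <= e / 4 * X.
    apply: (@le_trans _ _ ((K * ln Z + ln 2) * L ^+ d)); last first.
      by rewrite /X (mulrC (L ^+ d)) mulrA ler_pM2r.
    rewrite mulrDl lerD//; last by rewrite ler_peMr.
    rewrite mulrAC; apply: ler_wpM2r => //; exact: (size_ball_seq_scale _ (ltW r0) L1L).
  have -> : (1 - 1 / 2) * (expR (\sum_(q <- s) - (zn (y q) `^ th)) * Z^-1 ^+ size s) =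
      expR (\sum_(q <- s) - (zn (y q) `^ th) - ((size s)%:R * ln Z + ln 2)).
    rewrite expRD expRN expRD lnK ?posrE// expRM_natl lnK ?posrE// exprVn invfM.
    by move: (expR _) (Z ^- _) => a b; lra.
  rewrite ler_expR XE /D big_split/=.
  have : \sum_(q <- s) bd q <= (c + e / 4) * X.
    rewrite /bd -mulr_sumr -mulr_sumr big_split/= big_const_seq count_predT iter_addr_0.
    have HG : \sum_(q <- s) G (zn q / L) <= L ^+ d * (c + e1).
      rewrite -lee_fin; apply: le_trans (HL2 L HL2L).
      rewrite -sumEFin; apply: esum_ge_sum => // q; rewrite lee_fin; apply: rate_ge0 => //.
      by rewrite divr_ge0 ?enorm_ge0// ltW.
    have Hs : e1 *+ size s <= e1 * K * L ^+ d.
      rewrite -[_ *+ _]mulr_natr -mulrA ler_pM2l//; exact: (size_ball_seq_scale _ (ltW r0) L1L).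
    apply: (@le_trans _ _ ((1 + e1) * (L `^ th * (L ^+ d * (c + e1) + e1 * K * L ^+ d)))).
      by rewrite ler_pM2l ?addr_gt0// ler_pM2l// lerD.
    rewrite (_ : _ * _ = (1 + e1) * (c + e1 + e1 * K) * X); last by rewrite /X; ring.
    rewrite ler_pM2r//.
    have : e1 * e1 <= e1 by rewrite ler_piMr// ltW.
    have : e1 * e1 * K <= e1 * K by rewrite ler_wpM2r// ler_piMr// ltW.
    by move: e1K; lra.
  have : 0 < e * X by exact: mulr_gt0.
  by move: hs; lra.
move=> om Eom x xk; rewrite /potential -esumZl ?(ltW T0)//; last by move=> q; rewrite lee_fin.
have bd0 q : 0 <= bd q - zn (y q) `^ th.
  have := Hy q 0; rewrite enorm0 => /(_ _); rewrite mulr_ge0 ?(ltW kap10) ?(ltW L0)// => /(_ isT).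
  rewrite -/(bd q) -/T; have := u0 (0 - of_Zd R q - of_Zd R (y q)).
  by move=> /(ler_wpM2l (ltW T0)); rewrite mulr0; lra.
have P1 (q : 'rV[int]_d) : 0 <= (if r * L < zn q then zn q `^ (- al) else 0).
  by case: ifP => // _; exact: powR_ge0.
pose Q := T * (2 * C0 * 4 `^ al).
have Q0 : 0 <= Q by rewrite !mulr_ge0 ?powR_ge0// ltW.
apply: (@le_trans _ _ (\esum_(q in [set: 'rV[int]_d])
  ((if zn q <= r * L then bd q - zn (y q) `^ th else 0)%:E +
   Q%:E * (if r * L < zn q then zn q `^ (- al) else 0)%:E))%E).
  apply: le_esum => q _; rewrite -!EFinM -EFinD lee_fin.
  have := Eom q; rewrite mem_ball_seq; have [qr ->|rq qh] := leP (zn q) (r * L).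
    rewrite mulr0 addr0 lerBrDr; apply: Hy; exact: le_trans kapL.
  rewrite add0r /Q -(mulrA T) -/T ler_pM2l//.
  have q0 : 0 < zn q by exact: lt_trans rq.
  have wq : zn q / 4 <= enorm (x - of_Zd R q - of_Zd R (xi q om)).
    set w := x - _ - _.
    have : zn q <= enorm w + enorm x + zn (xi q om).
      rewrite {1}(_ : of_Zd R q = - w + x - of_Zd R (xi q om)); last first.
        by rewrite /w; apply/rowP => i; rewrite !mxE; ring.
      by apply: le_trans (enormB _ _) _; rewrite lerD2r -(enormN w); exact: enormD.
    by move: qh xk kapr rq => /=; lra.
  have q40 : 0 < zn q / 4 by rewrite divr_gt0.
  have rw : r1 <= zn q / 4 by move: r1L rq; lra.
  apply: le_trans (ur1 _ (le_trans rw wq)) _.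
  rewrite -!mulrA ler_pM2l ?addr_gt0// ler_pM2l//.
  apply: le_trans (ler_powRN (ltW al0) q40 wq) _.
  by rewrite powR_div ?(ltW q0)// opprK mulrC.
rewrite esumD; last 2 first.
- by move=> q _; rewrite lee_fin; case: ifP.
- by move=> q _; rewrite -EFinM lee_fin mulr_ge0.
rewrite esum_ball_seq// esumZl// /D EFinD leeD2l//.
have drL : 2 * d%:R <= r * L by rewrite mulrC in dL *; rewrite (mulrC r).
apply: le_trans (lee_wpmul2l _ (HKt _ drL rL0)) _; rewrite ?lee_fin//.
rewrite powRM ?(ltW r0) ?(ltW L0)//.
have -> : Q * (Kt * (r `^ (d%:R - al) * L `^ (d%:R - al))) = F * r `^ (- (al - d%:R)) * (T * L `^ (d%:R - al)).
  by rewrite /Q /F opprB; ring.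
rewrite (_ : T * _ = X); last first.
  rewrite /T -powRD ?(gt_eqF L0) ?implybT// -XE; congr (_ `^ _); ring.
by rewrite ler_pM2r.
Qed.

End annealed_lower.

(** * Lower bound for the survival probability *)

Section survival_lower.
Context dW (W : measurableType dW) (R : realType) (Q : probability W R).
Variables (d : nat) (x : 'rV[R]_d) (B : R -> W -> 'rV[R]_d).
Hypothesis BM : brownian_motion Q x B.
Variable V : 'rV[R]_d -> \bar R.
Hypothesis V0 : forall y, (0 <= V y)%E.
Local Open Scope ereal_scope.

Lemma survival_le1E (t : R) :
  \int[Q]_w expeR (- \int[lebesgue_measure]_(s in `[0%R, t]) V (B s w)) <= 1.
Proof.
rewrite -[leRHS](integral_prob_cst Q 1); apply: ge0_le_integral_nomeas => w _.
  exact: expeR_ge0.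
rewrite -expeR0 lee_expeR oppe_le0; exact: integral_ge0.
Qed.

Lemma survival_fin (t : R) :
  (survival Q B V t)%:E =
  \int[Q]_w expeR (- \int[lebesgue_measure]_(s in `[0%R, t]) V (B s w)).
Proof.
rewrite /survival fineK// ge0_fin_numE; last by apply: integral_ge0 => w _; exact: expeR_ge0.
by apply: le_lt_trans (survival_le1E t) _; rewrite ltry.
Qed.

(** Restrict the expectation to the paths that stay in the box. *)
Lemma survival_lower (t r m : R) : (0 < t)%R -> (0 < r)%R -> (forall i, `|x ord0 i| < r)%R ->
  (forall y : 'rV[R]_d, (forall i, `|y ord0 i| <= r)%R -> V y <= m%:E) ->
  (expR (- (t * m)) * (expR (- (24 * d%:R * t / r ^+ 2)) * Psi r x) <= survival Q B V t)%R.
Proof.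
move=> t0 r0 xr Vm; have [mS QS] := bm_stay_box BM t0 r0 xr.
set S := [set w | _] in mS QS.
rewrite -lee_fin survival_fin EFinM.
apply: (@le_trans _ _ ((expR (- (t * m)))%:E * Q S)).
  by rewrite lee_wpmul2l// lee_fin expR_ge0.
have mi : measurable_fun setT (fun w => (\1_S w)%:E : \bar R).
  by apply/measurable_EFinP; exact: measurable_indic.
rewrite -(setIT S) -(integral_indic Q measurableT mS) -(ge0_integralZl_EFin Q measurableT _ mi (expR_ge0 _))//.
apply: ge0_le_integral_nomeas => w _.
  by rewrite mule_ge0// lee_fin ?expR_ge0.
rewrite indicE; have [wS|wS] := boolP (w \in S); last by rewrite mule0 expeR_ge0.
rewrite mule1 -[leLHS]/(expeR (- (t * m)%:E)) lee_expeR leeN2.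
rewrite inE in wS.
have -> : (t * m)%:E = \int[lebesgue_measure]_(s in `[0%R, t]) (cst m%:E) s.
  rewrite integral_cst//= lebesgue_measure_itv/= lte_fin t0 oppr0 adde0 muleC.
  by rewrite EFinM.
apply: ge0_le_integral_nomeas => s //=; rewrite in_itv/= => s0t.
by apply: Vm => i; exact: wS.
Qed.

End survival_lower.

Section start_box.
Variables (R : realType) (d : nat).

(** The starting point is well inside the box: [cos v >= 1 - v^2 / 2 >= 1 / 2] for
    [|v| <= 1]. *)
Lemma Psi_unit_cube (r : R) (x : 'rV[R]_d) : 1 <= r -> unit_cube R d x ->
  (1 / 2) ^+ d <= Psi r x.
Proof.
move=> r1 xc; rewrite /Psi.
have -> : (1 / 2) ^+ d = \prod_(i < d) (1 / 2) :> R by rewrite prodr_const card_ord.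
apply: ler_prod => i _; rewrite divr_ge0//=.
have := xc i => xi; have xa : `|x ord0 i| <= 1 / 2 by rewrite ler_norml.
have r0 : 0 < r by exact: lt_le_trans r1.
rewrite /psi ifT; last by apply: le_lt_trans xa _; lra.
apply: le_trans (cos_ge1Bsqr _).
have p0 := pi_gt0 R; have p4 : pi <= 4 :> R by have := pihalf_lt2 R; lra.
have : `|pi / 2 / r * x ord0 i| <= 1.
  rewrite normrM ger0_norm ?divr_ge0 ?(ltW r0) ?(ltW p0)//.
  have : pi / 2 / r <= 2 by rewrite ler_pdivrMr//; lra.
  have : 0 <= pi / 2 / r by rewrite !divr_ge0 ?(ltW r0) ?(ltW p0).
  have := normr_ge0 (x ord0 i); nra.
move=> /(lerXn2r 2); rewrite !nnegrE normr_ge0 ler01 => /(_ isT isT).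
rewrite real_normK ?num_real// expr1n; lra.
Qed.

End start_box.

(** * The two bounds combined *)

Section moment_lower.
Variables (R : realType) (d : nat) (al th C0 : R) (u : 'rV[R]_d -> R).
Hypotheses (d1 : (1 <= d)%N) (dal : d%:R < al) (ald : al < d%:R + 2).
Hypotheses (th0 : 0 < th) (C00 : 0 < C0).
Hypothesis u0 : forall x, 0 <= u x.
Hypothesis u_upper : forall e : R, 0 < e -> exists2 r, 1 <= r &
  forall x, r <= enorm x -> u x <= (1 + e) * (C0 * enorm x `^ (- al)).
Context dO (O : measurableType dO) (P : probability O R).
Variable xi : 'rV[int]_d -> O -> 'rV[int]_d.
Hypothesis iid : iid_displacements P th xi.

Local Notation c := (rate_constant d al th C0).

Let al0 : 0 < al. Proof. exact: le_lt_trans dal. Qed.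

(** Confining the motion to a box of side of order [L] costs [exp (- O(t / L^2))], and
    [t / L^2] is of order [L^(al + th - 2)], negligible with respect to [L^(d + th)]
    since [al < d + 2]. *)
Lemma moment_lower (p e : R) : 1 <= p -> 0 < e ->
  exists2 L0 : R, 0 < L0 & forall L, L0 <= L -> forall t, p * t = L `^ (al + th) ->
  forall dW (W : measurableType dW) (Q : probability W R) x B,
  brownian_motion Q x B -> unit_cube R d x ->
  ((expR (- ((c + e) * L `^ (d%:R + th))))%:E <=
   \int[P]_om (survival Q B (potential u (xi^~ om)) t `^ p)%:E)%E.
Proof.
move=> p1 e0; have e20 : 0 < e / 2 by rewrite divr_gt0.
have e40 : 0 < e / 4 by rewrite divr_gt0.
have p0 : 0 < p by exact: lt_le_trans p1.
have [kap kap0 [L1 L10 HL1]] := annealed_lower d1 dal th0 C00 u0 u_upper iid e20.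
have d0 : 0 < d%:R :> R by rewrite ltr0n.
pose K : R := 24 * d%:R * (d%:R / kap) ^+ 2.
have K0 : 0 < K by rewrite mulr_gt0 ?exprn_gt0 ?divr_gt0// mulr_gt0.
have b0 : 0 < d%:R + 2 - al by rewrite subr_gt0.
have [M M0 HM] := powR_small K0 b0 e40.
have ln2 : 0 <= ln 2 :> R by apply: ln_ge0; rewrite ler1n.
exists (Num.max 1 (Num.max L1 (Num.max (d%:R / kap) (Num.max M (p * (d%:R * ln 2) / (e / 4)))))).
  by rewrite lt_max ltr01.
move=> L; rewrite !ge_max => /and5P[L1L HL1L dL ML pL] t pt dW W Q x B BM xc.
have L0 : 0 < L by exact: lt_le_trans L1L.
have T0 : 0 < L `^ (al + th) by rewrite powR_gt0.
have t0 : 0 < t by rewrite -(pmulr_rgt0 _ p0) pt.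
have [A [D [mA PA HA]]] := HL1 L HL1L.
pose X := L `^ (d%:R + th); have X0 : 0 < X by rewrite powR_gt0.
pose r := kap * L / d%:R.
have r0 : 0 < r by rewrite divr_gt0// mulr_gt0.
have r1 : 1 <= r.
  by move: dL; rewrite ler_pdivrMr// /r ler_pdivlMr// mul1r mulrC.
have xr i : `|x ord0 i| < r.
  have xi' : `|x ord0 i| <= 1 / 2 by rewrite ler_norml; exact: xc.
  by apply: le_lt_trans xi' _; lra.
have LX : L <= X.
  rewrite /X -{1}(powRr1 (ltW L0)); apply: ler_powR => //.
  by rewrite ler_wpDr ?(ltW th0)// ler1n.
pose m := 24 * d%:R * t / r ^+ 2.
have pm : p * m + p * (d%:R * ln 2) <= e / 2 * X.
  have h1 : p * m <= e / 4 * X.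
    have -> : p * m = K * (L `^ (al + th) * L `^ (- 2)).
      rewrite powRN powR_mulrn ?(ltW L0)// -pt /m /K /r.
      by field; rewrite !gt_eqF.
    rewrite -powRD ?(gt_eqF L0) ?implybT//.
    have -> : al + th + - 2 = - (d%:R + 2 - al) + (d%:R + th) by ring.
    rewrite powRD ?(gt_eqF L0) ?implybT// mulrA ler_pM2r//.
    apply: le_trans HM; rewrite ler_pM2l//.
    by apply: ler_powRN => //; exact: ltW.
  have h2 : p * (d%:R * ln 2) <= e / 4 * X.
    move: pL; rewrite ler_pdivrMr// => pL; apply: le_trans pL _.
    by rewrite mulrC ler_pM2l.
  by lra.
pose k := expR (- (D / p)) * (expR (- m) * (1 / 2) ^+ d).
have k0 : 0 <= k by rewrite !mulr_ge0 ?expR_ge0// exprn_ge0// divr_ge0.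
have kp : k `^ p = expR (- D - (p * m + p * (d%:R * ln 2))).
  rewrite /k; have -> : (1 / 2) ^+ d = expR (- (d%:R * ln 2)) :> R.
    by rewrite expRN expRM_natl lnK ?posrE// div1r exprVn.
  rewrite -!expRD -expRM; congr expR; field; by rewrite gt_eqF.
apply: (@le_trans _ _ ((k `^ p)%:E * P A)%E).
  apply: le_trans (lee_wpmul2l _ PA); last by rewrite lee_fin powR_ge0.
  rewrite kp -EFinM -expRD lee_fin ler_expR -/X; lra.
have mi : measurable_fun setT (fun w => (\1_A w)%:E : \bar R).
  by apply/measurable_EFinP; exact: measurable_indic.
rewrite -(setIT A) -(integral_indic P measurableT mA).
rewrite -(ge0_integralZl_EFin P measurableT _ mi (powR_ge0 _ _))//.
apply: ge0_le_integral_nomeas => om _.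
  by rewrite mule_ge0// lee_fin ?powR_ge0.
rewrite indicE; have [omA|omA] := boolP (om \in A); last first.
  by rewrite mule0 lee_fin powR_ge0.
rewrite mule1 lee_fin; rewrite inE in omA.
have V0 y : (0 <= potential u (xi^~ om) y)%E by exact: potential_ge0.
have Vm (y : 'rV[R]_d) : (forall i, `|y ord0 i| <= r) ->
    (potential u (xi^~ om) y <= (D / L `^ (al + th))%:E)%E.
  move=> yr; have := HA om omA y.
  have -> : enorm y <= kap * L.
    apply: le_trans (enorm_le_coord (ltW r0) yr) _.
    by rewrite /r mulrC divfK// gt_eqF.
  by move=> /(_ isT); rewrite -lee_pdivlMl// -EFinM mulrC.
have Hs := survival_lower BM V0 t0 r0 xr Vm.
have ks : k <= survival Q B (potential u (xi^~ om)) t.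
  apply: le_trans Hs; rewrite /k.
  have -> : D / p = t * (D / L `^ (al + th)).
    by rewrite -pt; field; rewrite !gt_eqF.
  rewrite ler_pM2l ?expR_gt0// ler_pM2l ?expR_gt0//.
  exact: Psi_unit_cube.
by apply: ge0_ler_powR; rewrite ?nnegrE ?(ltW p0) ?k0 ?(le_trans k0 ks).
Qed.

End moment_lower.

Theorem proposition3p4 (R : realType) (d : nat) (alpha theta C0 : R)
    (u : 'rV[R]_d -> R)
    (dO : measure_display) (O : measurableType dO) (P : probability O R)
    (xi : 'rV[int]_d -> O -> 'rV[int]_d)
    (dW : measure_display) (W : measurableType dW)
    (Q : 'rV[R]_d -> probability W R) (B : R -> W -> 'rV[R]_d) :
  (1 <= d)%N ->
  d%:R < alpha < d%:R + 2 ->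
  0 < theta ->
  0 < C0 ->
  (forall x, 0 <= u x) ->
  kato_class u ->
  (exists2 o : 'rV[R]_d -> R,
     forall x, x != 0 -> u x = C0 * enorm x `^ (- alpha) * (1 + o x) &
     forall e : R, 0 < e -> \forall r \near +oo, forall x, r <= enorm x -> `|o x| < e) ->
  (forall r : R, 1 <= r ->
     (0 < ess_inf (mrestr (lebesgue_measure_rv d) (measurable_eball r))
            (EFin \o u))%E) ->
  iid_displacements P theta xi ->
  (forall x, brownian_motion (Q x) x B) ->
  forall p : R, 1 <= p ->
  forall e : R, 0 < e -> \forall t \near +oo, forall x0, unit_cube R d x0 ->
    `| t `^ (- ((d%:R + theta) / (alpha + theta))) *
         ln (fine 'E_P[fun om =>
           survival (Q x0) B (potential u (xi^~ om)) t `^ p])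
       - (- (p `^ ((d%:R + theta) / (alpha + theta)) *
             rate_constant d alpha theta C0)) | < e.
Proof.
move=> d1 /andP[dal ald] th0 C00 u0 [mu _] [rem u_eq rem_small] u_inf iid BM p p1 e e0.
have p0 : 0 < p by exact: lt_le_trans p1.
have al0 : 0 < alpha by exact: le_lt_trans dal.
have u_both (eps : R) : 0 < eps -> exists2 r, 1 <= r & forall x, r <= enorm x ->
    (1 - eps) * (C0 * enorm x `^ (- alpha)) <= u x <= (1 + eps) * (C0 * enorm x `^ (- alpha)).
  move=> eps0; have [M [_ HM]] := rem_small eps eps0.
  exists (Num.max 1 (M + 1)); first by rewrite le_max lexx.
  move=> x; rewrite ge_max => /andP[x1 xM].
  have x0 : x != 0 by rewrite -enorm_eq0 gt_eqF// (lt_le_trans ltr01).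
  have Mx : M < enorm x by apply: lt_le_trans xM; rewrite ltrDl.
  have := HM _ Mx x (lexx _); rewrite ltr_norml => /andP[h1 h2].
  rewrite u_eq// ![_ * (C0 * _)]mulrC.
  have X0 : 0 <= C0 * enorm x `^ (- alpha) by rewrite mulr_ge0 ?powR_ge0// ltW.
  by apply/andP; split; apply: ler_wpM2l => //; lra.
have u_lower (eps : R) : 0 < eps -> exists2 r, 1 <= r &
    forall x, r <= enorm x -> (1 - eps) * (C0 * enorm x `^ (- alpha)) <= u x.
  by move=> /u_both[r r1 H]; exists r => // x /H/andP[].
have u_upper (eps : R) : 0 < eps -> exists2 r, 1 <= r &
    forall x, r <= enorm x -> u x <= (1 + eps) * (C0 * enorm x `^ (- alpha)).
  by move=> /u_both[r r1 H]; exists r => // x /H/andP[].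
set kappa := (d%:R + theta) / (alpha + theta); set c := rate_constant d alpha theta C0.
have ath0 : 0 < alpha + theta by rewrite addr_gt0.
have pk0 : 0 < p `^ kappa by rewrite powR_gt0.
pose e' := e / 2 / p `^ kappa.
have e'0 : 0 < e' by rewrite !divr_gt0.
have [N [mN QN [L1 L10 HL1]]] := upper_annealed d1 dal th0 C00 mu u0 u_lower u_inf iid e'0.
have [L2 L20 HL2] := moment_lower d1 dal ald th0 C00 u0 u_upper iid p1 e'0.
have mU := measurable_potential mu u0 (let: And3 mxi _ _ := iid in mxi).
near=> t => x0 x0c.
have t1 : 1 <= t by near: t; exact: nbhs_pinfty_ge.
have t0 : 0 < t by exact: lt_le_trans t1.
pose L := (p * t) `^ (alpha + theta)^-1.
have pt0 : 0 < p * t by exact: mulr_gt0.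
have LE : L `^ (alpha + theta) = p * t.
  by rewrite -powRrM mulVf ?gt_eqF// powRr1// ltW.
have LX : L `^ (d%:R + theta) = p `^ kappa * t `^ kappa.
  by rewrite -powRrM (mulrC _^-1) -/kappa powRM// ltW.
have Lbig M : 0 < M -> M `^ (alpha + theta) <= t -> M <= L.
  move=> M0 Mt.
  have -> : M = (M `^ (alpha + theta)) `^ (alpha + theta)^-1.
    by rewrite -powRrM mulfV ?gt_eqF// powRr1// ltW.
  apply: ge0_ler_powR; rewrite ?nnegrE ?powR_ge0 ?invr_ge0 ?(ltW ath0) ?(ltW pt0)//.
  by apply: le_trans Mt _; rewrite ler_peMl// ltW.
have LL1 : L1 <= L by apply: Lbig => //; near: t; exact: nbhs_pinfty_ge.
have LL2 : L2 <= L by apply: Lbig => //; near: t; exact: nbhs_pinfty_ge.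
pose I := (\int[P]_om (survival (Q x0) B (potential u (xi^~ om)) t `^ p)%:E)%E.
have Ilo : ((expR (- ((c + e') * L `^ (d%:R + theta))))%:E <= I)%E.
  by apply: (HL2 L LL2 t (esym LE) _ _ _ _ _ (BM x0)).
have Ihi : (I <= (expR (- ((c - e') * L `^ (d%:R + theta))))%:E)%E.
  apply: (@survival_moment_upper _ _ _ _ _ _ _ (BM x0) _ _ P
    (fun om => potential u (xi^~ om)) mU _ t p _ N t0 p1 (expR_ge0 _) mN).
  - by move=> om y; exact: potential_ge0.
  - by move=> s s0; exact: (QN _ _ _ _ _ (BM x0) s s0).
  - by move=> y Ny; rewrite -LE; exact: HL1.
have Ifin : I \is a fin_num.
  rewrite ge0_fin_numE; first by apply: le_lt_trans Ihi _; rewrite ltry.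
  by apply: le_trans Ilo; rewrite lee_fin expR_ge0.
rewrite unlock -/I.
have Ipos : 0 < fine I.
  by rewrite -lte_fin fineK//; apply: lt_le_trans Ilo; rewrite lte_fin expR_gt0.
have lnlo : - ((c + e') * L `^ (d%:R + theta)) <= ln (fine I).
  by rewrite -[leLHS]expRK ler_ln ?posrE ?expR_gt0// -lee_fin fineK.
have lnhi : ln (fine I) <= - ((c - e') * L `^ (d%:R + theta)).
  by rewrite -[leRHS]expRK ler_ln ?posrE ?expR_gt0// -lee_fin fineK.
have tk0 : 0 < t `^ (- kappa) by rewrite powR_gt0.
have tt : t `^ (- kappa) * t `^ kappa = 1.
  by rewrite -powRD ?(gt_eqF t0) ?implybT// addNr powRr0.
have tL a : t `^ (- kappa) * (a * L `^ (d%:R + theta)) = a * p `^ kappa.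
  by rewrite LX mulrCA (mulrCA _ (p `^ kappa)) tt mulr1.
have {}lnlo : - ((c + e') * p `^ kappa) <= t `^ (- kappa) * ln (fine I).
  by rewrite -(tL (c + e')) -(mulrN (t `^ (- kappa))) ler_pM2l.
have {}lnhi : t `^ (- kappa) * ln (fine I) <= - ((c - e') * p `^ kappa).
  by rewrite -(tL (c - e')) -(mulrN (t `^ (- kappa))) ler_pM2l.
have e'p : e' * p `^ kappa = e / 2 by rewrite /e' divfK// gt_eqF.
by move: lnlo lnhi; rewrite mulrDl mulrBl e'p ltr_norml => h1 h2; apply/andP; split; lra.
Unshelve. all: by end_near.
Qed.
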